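(* Let $P$ be the Metropolis-Hastings kernel targeting $\pi$ with proposal density $q(x,y)$, and let $\tilde{P}$ be the corresponding delayed-acceptance kernel constructed from $q$ and the approximating density $\hat{\pi}$. Suppose that $q$ is a uniformly local proposal, and that for some function $h:[0,\infty)\to[0,\infty)$ with $h(r)<\infty$ for all $r<\infty$, and for $\pi$-almost all $x$, $$\{y\in\mathcal{X}:|\log r_2(x,y)|>h(\|y-x\|)\}\subseteq\mathcal{C}(x).$$ If $P$ is variance bounding then so is $\tilde{P}$.
   Context: The state space is $(\mathcal{X},\mathcal{F})$ with $\mathcal{X}\subseteq\mathbb{R}^d$ Lebesgue measurable and $\mathcal{F}$ the $\sigma$-algebra of Lebesgue-measurable subsets of $\mathcal{X}$. The target $\pi$ and the approximation (surrogate) $\hat{\pi}$ are distributions with densities $\pi(x)$ and $\hat{\pi}(x)$ with respect to Lebesgue measure. $\|\cdot\|$ is the Euclidean norm. The Metropolis-Hastings kernel is $P(x,\mathrm{d}y)=q(x,y)\alpha(x,y)\,\mathrm{d}y+[1-\overline{\alpha}(x)]\delta_x(\mathrm{d}y)$, where $\alpha(x,y)=1\wedge r(x,y)$, $r(x,y)=\frac{\pi(y)q(y,x)}{\pi(x)q(x,y)}$ and $\overline{\alpha}(x)=\int q(x,y)\alpha(x,y)\,\mathrm{d}y$. The delayed-acceptance kernel is $\tilde{P}(x,\mathrm{d}y)=q(x,y)\tilde{\alpha}(x,y)\,\mathrm{d}y+[1-\overline{\tilde{\alpha}}(x)]\delta_x(\mathrm{d}y)$, where $\tilde{\alpha}(x,y)=[1\wedge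 r_1(x,y)][1\wedge r_2(x,y)]$, $r_1(x,y)=\frac{\hat{\pi}(y)q(y,x)}{\hat{\pi}(x)q(x,y)}$, $r_2(x,y)=\frac{\pi(y)/\hat{\pi}(y)}{\pi(x)/\hat{\pi}(x)}$ and $\overline{\tilde{\alpha}}(x)=\int q(x,y)\tilde{\alpha}(x,y)\,\mathrm{d}y$. $\mathcal{C}(x):=\{y\in\mathcal{X}:\mathrm{sign}[\log r_1(x,y)]\,\mathrm{sign}[\log r_2(x,y)]\ge0\}$. A proposal $q$ is uniformly local if for every $\epsilon>0$ there exists $r<\infty$ such that for all $x\in\mathcal{X}$, $\int_{B(x,r)^c}q(x,y)\,\mathrm{d}y<\epsilon$, where $B(x,r)=\{y\in\mathcal{X}:\|y-x\|<r\}$. For a kernel $P$ with stationary distribution $\pi$ and associated chain $\{X_t\}_{t\ge1}$ with $X_1\sim\pi$, the asymptotic variance of a functional $h$ is $\mathsf{var}(h,P):=\lim_{n\to\infty} n\,\mathrm{Var}\left[\frac1n\sum_{i=1}^n h(X_i)\right]$. $P$ is variance bounding if $\mathsf{var}(h,P)<\infty$ for all $h\in L^2(\pi)$.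
   Formalization: ''h(r)<∞ for all r<∞'' is read as: h is bounded on every bounded interval [0,r] (mere finiteness of h makes the claim false); and π is assumed absolutely continuous with respect to π̂, so that r_1 and r_2 are defined for π-almost all x. *)

(* Defs.v *)
From HB Require Import structures.
From mathcomp Require Import all_boot all_order all_algebra.
From mathcomp Require Import all_classical all_reals all_analysis.
From mathcomp Require Import measurable_realfun.

Set Implicit Arguments.
Unset Strict Implicit.
Unset Printing Implicit Defensive.
Import Order.TTheory GRing.Theory Num.Theory.
Import numFieldNormedType.Exports.
Local Open Scope classical_set_scope.
Local Open Scope ring_scope.
Local Open Scope ereal_scope.

(* R^n is represented by n.-tuples. *)
Section cons_pushforward.
Context {R : realType} {n : nat}.
Local Notation Rn := (n.-tuple (measurableTypeR R)).
Local Notation RSn := (n.+1.-tuple (measurableTypeR R)).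

Definition consp (z : measurableTypeR R * Rn) : RSn := [tuple of z.1 :: z.2].

Lemma measurable_consp : measurable_fun setT consp.
Proof. exact: measurable_cons measurable_fst measurable_snd. Qed.

Variable mu : {sigma_finite_measure set Rn -> \bar R}.

Definition cons_measure (A : set RSn) : \bar R :=
  pushforward (@lebesgue_measure R \x mu) consp A.

Let cons0 : cons_measure set0 = 0.
Proof. by rewrite /cons_measure /pushforward preimage_set0 measure0. Qed.

Let cons_ge0 A : 0 <= cons_measure A.
Proof. by rewrite /cons_measure /pushforward measure_ge0. Qed.

Let cons_sigma_additive : semi_sigma_additive cons_measure.
Proof.
move=> F mF tF mUF; rewrite /cons_measure /pushforward preimage_bigcup.
apply: measure_semi_sigma_additive.
- by move=> i; rewrite -[X in measurable X]setTI; exact: measurable_consp.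
- apply/trivIsetP => /= i j _ _ ij; rewrite -preimage_setI.
  by move/trivIsetP : tF => /(_ _ _ _ _ ij) ->//; rewrite preimage_set0.
- rewrite -preimage_bigcup -[X in measurable X]setTI.
  exact: measurable_consp.
Qed.

HB.instance Definition _ :=
  isMeasure.Build _ _ _ cons_measure cons0 cons_ge0 cons_sigma_additive.

Let cons_sigma_finite : sigma_finite setT cons_measure.
Proof.
have /sigma_finiteP[F [TF ndF Foo]] := sigma_finiteT (@lebesgue_measure R).
have /sigma_finiteP[G [TG ndG Goo]] := sigma_finiteT mu.
pose uncons (t : RSn) : measurableTypeR R * Rn :=
  (thead t, [tuple of behead t]).
have munc : measurable_fun setT uncons.
  by apply/measurable_fun_pair => /=; [exact: measurable_tnth|
                                      exact: measurable_behead].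
have unK z : uncons (consp z) = z.
  by case: z => x t; congr pair; rewrite ?theadE//; exact/val_inj.
exists (fun k => uncons @^-1` (F k `*` G k)).
  rewrite -preimage_bigcup [X in _ @^-1` X](_ : _ = setT) ?preimage_setT//.
  apply/seteqP; split => // -[x y] _.
  have [i _ Fnx] : (\bigcup_k F k) x by rewrite -TF.
  have [j _ Gky] : (\bigcup_k G k) y by rewrite -TG.
  exists (maxn i j) => //; split => /=.
    by move: x Fnx; exact/subsetPset/ndF/leq_maxl.
  by move: y Gky; exact/subsetPset/ndG/leq_maxr.
move=> k; have [mFk Fk] := Foo k; have [mGk Gk] := Goo k.
have mFG : measurable (F k `*` G k) by exact: measurableX.
split; first by rewrite -[X in measurable X]setTI; exact: munc.
rewrite /cons_measure /pushforward -comp_preimage.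
rewrite (_ : uncons \o consp = id); last by apply/funext => z; exact: unK.
by rewrite preimage_id product_measure1E// lte_mul_pinfty// ge0_fin_numE.
Qed.

HB.instance Definition _ :=
  Measure_isSigmaFinite.Build _ _ _ cons_measure cons_sigma_finite.

End cons_pushforward.


Section euclidean_space.
Variable R : realType.

(* Lebesgue measure on the Borel sets of R^n, as an iterated product. *)
Fixpoint borel_lebesgue (n : nat) :
    {sigma_finite_measure set (n.-tuple (measurableTypeR R)) -> \bar R} :=
  match n with
  | 0 => \d_([tuple] : 0.-tuple (measurableTypeR R))
  | n'.+1 => cons_measure (borel_lebesgue n')
  end.

Definition lebesgue_outer (n : nat) :
    {outer_measure set (n.-tuple (measurableTypeR R)) -> \bar R} :=
  ((borel_lebesgue n)^*)%mu.

(* R^n with the (complete) sigma-algebra of all Lebesgue-measurable sets. *)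
Definition euclid (n : nat) := caratheodory_type (lebesgue_outer n).
HB.instance Definition _ n := Measurable.on (euclid n).

Definition lebesgue_euclid (n : nat) : {measure set (euclid n) -> \bar R} :=
  lebesgue_outer n.

End euclidean_space.

(* Nonemptiness is automatic when a probability density lives on the set; it is
   recorded because measurable types are pointed. *)
Record lebesgue_domain (R : realType) (n : nat) := LebesgueDomain {
  domain_set :> set (euclid R n);
  domain_measurable : measurable domain_set;
  domain_nonempty : domain_set !=set0 }.

Definition state (R : realType) (n : nat) (X : lebesgue_domain R n) : Type :=
  set_type (domain_set X).

Section state_space.
Context {R : realType} {n : nat} (X : lebesgue_domain R n).

Definition point_of (x : state X) : euclid R n := set_val x.

HB.instance Definition _ := Choice.on (state X).

Let state_point : state X :=
  SigSub (mem_set (projT2 (cid (domain_nonempty X)))).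

HB.instance Definition _ := isPointed.Build (state X) state_point.

Definition state_display : measure_display.
Proof. exact: default_measure_display. Qed.

(* As the domain is measurable, these are the Lebesgue-measurable subsets
   of R^n contained in it. *)
Definition state_measurable : set (set (state X)) :=
  [set point_of @^-1` B | B in measurable].

Let state_measurable0 : state_measurable set0.
Proof. by exists set0 => //; rewrite preimage_set0. Qed.

Let state_measurableC A : state_measurable A -> state_measurable (~` A).
Proof.
by move=> [B mB <-]; exists (~` B); [exact: measurableC|rewrite preimage_setC].
Qed.

Let state_measurable_bigcup (F : (set (state X))^nat) :
  (forall i, state_measurable (F i)) -> state_measurable (\bigcup_i (F i)).
Proof.
move=> mF; have /choice[G GP] : forall i, exists B : set (euclid R n),
    measurable B /\ point_of @^-1` B = F i.
  by move=> i; have [B mB BF] := mF i; exists B.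
exists (\bigcup_i G i).
  by apply: bigcupT_measurable => i; have [] := GP i.
by rewrite preimage_bigcup; apply: eq_bigcupr => i _; have [] := GP i.
Qed.

HB.instance Definition _ := isMeasurable.Build state_display (state X)
  state_measurable0 state_measurableC state_measurable_bigcup.

Lemma point_of_inj : injective point_of.
Proof. exact: val_inj. Qed.

Lemma image_point_of_preimage (B : set (euclid R n)) :
  point_of @` (point_of @^-1` B) = B `&` X.
Proof.
apply/seteqP; split => [_ [x Bx <-]|x [Bx Xx]].
  by split => //; exact: set_valP.
by exists (SigSub (mem_set Xx)).
Qed.

Lemma measurable_image_point_of (A : set (state X)) :
  measurable A -> measurable (point_of @` A).
Proof.
move=> [B mB <-]; rewrite image_point_of_preimage.
exact: measurableI mB (domain_measurable X).
Qed.

Definition lebesgue_state (A : set (state X)) : \bar R :=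
  lebesgue_euclid R n (point_of @` A).

Let lebesgue_state0 : lebesgue_state set0 = 0.
Proof. by rewrite /lebesgue_state image_set0 measure0. Qed.

Let lebesgue_state_ge0 A : 0 <= lebesgue_state A.
Proof. by rewrite /lebesgue_state measure_ge0. Qed.

Let lebesgue_state_sigma_additive : semi_sigma_additive lebesgue_state.
Proof.
move=> F mF tF mUF; rewrite /lebesgue_state image_bigcup.
apply: measure_semi_sigma_additive.
- by move=> i; exact: measurable_image_point_of.
- apply/trivIsetP => /= i j _ _ ij.
  rewrite -subset0 => _ [[x Fx <-] [y Fy /point_of_inj yx]].
  move/trivIsetP : tF => /(_ _ _ I I ij) FiFj.
  by have : (F i `&` F j) x; [split => //; rewrite -yx|rewrite FiFj].
- by rewrite -image_bigcup; exact: measurable_image_point_of.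
Qed.

HB.instance Definition _ := isMeasure.Build _ _ _ lebesgue_state
  lebesgue_state0 lebesgue_state_ge0 lebesgue_state_sigma_additive.

Definition euclidean_dist (x y : state X) : R :=
  Num.sqrt (\sum_(i < n) (tnth (point_of y) i - tnth (point_of x) i) ^+ 2)%R.

End state_space.
Arguments lebesgue_state {R n} X A.

Section kernel_cons.
Context {d0 d : measure_display} {T0 : measurableType d0}
  {T : measurableType d} {R : realType} {n : nat}.
Variables (l : R.-pker T0 ~> T) (k : R.-pker T ~> (n.-tuple T)).

Definition tcons (y : T) (s : n.-tuple T) : n.+1.-tuple T := [tuple of y :: s].

Lemma measurable_tcons2 :
  measurable_fun setT (fun z : T * n.-tuple T => tcons z.1 z.2).
Proof. exact: measurable_cons measurable_fst measurable_snd. Qed.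

Lemma measurable_tcons y : measurable_fun setT (tcons y).
Proof. exact: (measurableT_comp measurable_tcons2 (pair1_measurable y)). Qed.

(* Draw y from l x, then s from k y, and return y :: s. *)
Definition kcons (x : T0) (U : set (n.+1.-tuple T)) : \bar R :=
  \int[l x]_y k y (tcons y @^-1` U).

Lemma measurable_kcons_section (U : set (n.+1.-tuple T)) : measurable U ->
  measurable_fun setT (fun y => k y (tcons y @^-1` U)).
Proof.
move=> mU; pose V := (fun z : T * n.-tuple T => tcons z.1 z.2) @^-1` U.
have mV : measurable V.
  by rewrite /V -[X in measurable X]setTI; exact: measurable_tcons2.
rewrite (_ : (fun y => _) = (fun y => k y (xsection V y))).
  by apply: measurable_fun_xsection_finite_kernel; rewrite inE.
apply/funext => y; congr (k y _).
by apply/seteqP; split => s; rewrite /xsection /V/= inE.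
Qed.

Let kcons0 x : kcons x set0 = 0.
Proof.
by rewrite /kcons integral0_eq// => y _; rewrite preimage_set0 measure0.
Qed.

Let kcons_ge0 x U : 0 <= kcons x U.
Proof. by apply: integral_ge0 => y _; exact: measure_ge0. Qed.

Let kcons_sigma_additive x : semi_sigma_additive (kcons x).
Proof.
move=> F mF tF mUF; rewrite [X in _ --> X](_ : _ =
    \int[l x]_y \sum_(i <oo) k y (tcons y @^-1` F i)); last first.
  apply: eq_integral => y _; rewrite preimage_bigcup.
  apply/esym/cvg_lim => //; apply: measure_semi_sigma_additive.
  - move=> i; rewrite -[X in measurable X]setTI.
    exact: measurable_tcons.
  - apply/trivIsetP => /= i j _ _ ij; rewrite -preimage_setI.
    by move/trivIsetP : tF => /(_ _ _ _ _ ij) ->//; rewrite preimage_set0.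
  - rewrite -preimage_bigcup -[X in measurable X]setTI.
    exact: measurable_tcons.
rewrite integral_nneseries//; last by move=> i; exact: measurable_kcons_section.
apply: is_cvg_nneseries => i _ _.
exact: kcons_ge0.
Qed.

HB.instance Definition _ x := isMeasure.Build _ _ _ (kcons x)
  (kcons0 x) (kcons_ge0 x) (@kcons_sigma_additive x).

Definition mkcons : T0 -> {measure set (n.+1.-tuple T) -> \bar R} := kcons.

Let measurable_kcons U : measurable U -> measurable_fun setT (mkcons ^~ U).
Proof.
move=> mU; rewrite /mkcons /kcons.
apply: (measurable_fun_integral_finite_kernel
  (fun z : T0 * T => k z.2 (tcons z.2 @^-1` U)) l).
  by move=> z; exact: measure_ge0.
exact: (measurableT_comp (measurable_kcons_section mU) measurable_snd).
Qed.

HB.instance Definition _ := isKernel.Build _ _ _ _ _ mkcons measurable_kcons.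

Let kcons_setT x : mkcons x setT = 1.
Proof.
rewrite /mkcons /= /kcons.
under eq_integral do rewrite preimage_setT prob_kernel.
by rewrite integral_cst// prob_kernel mule1.
Qed.

HB.instance Definition _ :=
  Kernel_isProbability.Build _ _ _ _ _ mkcons kcons_setT.

End kernel_cons.

Section kernel_law.
Context {d0 d : measure_display} {T0 : measurableType d0}
  {T : measurableType d} {R : realType}.
Variables (k : R.-pker T0 ~> T) (x : T0).

Definition kernel_law : set T -> \bar R := k x.

HB.instance Definition _ := Measure.on kernel_law.

Let kernel_law_setT : kernel_law setT = 1.
Proof. exact: prob_kernel. Qed.

HB.instance Definition _ :=
  Measure_isProbability.Build _ _ _ kernel_law kernel_law_setT.

End kernel_law.

Section markov_chain.
Context {d : measure_display} {T : measurableType d} {R : realType}.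
Variables (pi : probability T R) (P : R.-pker T ~> T).

(* Law of (X_2, ..., X_{n+1}) given X_1 = x, for a Markov chain of kernel P. *)
Fixpoint trajectory (n : nat) : R.-pker T ~> (n.-tuple T) :=
  match n with
  | 0 => kdirac (measurable_cst ([tuple] : 0.-tuple T))
  | n'.+1 => mkcons P (trajectory n')
  end.

Definition initial_kernel : R.-pker unit ~> T :=
  kprobability (measurable_cst (pi : pprobability T R)).

(* Joint law of (X_1, ..., X_n) for the Markov chain of kernel P with X_1 of
   law pi. *)
Definition chain_law (n : nat) : probability (n.-tuple T) R :=
  match n with
  | 0 => \d_([tuple] : 0.-tuple T)
  | n'.+1 => kernel_law (mkcons initial_kernel (trajectory n')) tt
  end.

Definition scaled_variance (h : T -> R) (n : nat) : \bar R :=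
  n%:R%:E * 'V_(chain_law n)[fun t => (n%:R^-1 * \sum_(i < n) h (tnth t i))%R].

Definition asymptotic_variance (h : T -> R) : \bar R :=
  limn (scaled_variance h).

(* limn is only meaningful for convergent sequences, whence the first clause. *)
Definition variance_bounding : Prop :=
  forall h : T -> R, h \in Lfun pi 2%:E ->
    cvgn (scaled_variance h) /\ asymptotic_variance h < +oo.

End markov_chain.

Section metropolis_hastings.
Context {R : realType} {n : nat} {X : lebesgue_domain R n}.
Local Notation S := (state X).

Definition is_density (mu : probability S R) (f : S -> R) : Prop :=
  [/\ measurable_fun [set: S] f,
      forall x, (0 <= f x)%R &
      forall A, measurable A ->
        mu A = \int[lebesgue_state X]_(x in A) (f x)%:E].

Definition is_proposal_density (q : S -> S -> R) : Prop :=
  [/\ measurable_fun [set: S * S] (fun z => q z.1 z.2),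
      forall x y, (0 <= q x y)%R &
      forall x, \int[lebesgue_state X]_y (q x y)%:E = 1].

Definition is_accept_reject_kernel (q a : S -> S -> R) (k : R.-pker S ~> S) :
    Prop :=
  forall x A, measurable A ->
    k x A = \int[lebesgue_state X]_(y in A) (q x y * a x y)%:E +
            (1 - \int[lebesgue_state X]_z (q x z * a x z)%:E) * \d_x A.

(* The usual Metropolis-Hastings convention: an acceptance ratio is 1 where its
   denominator vanishes. *)
Definition acceptance_ratio (a b : R) : R :=
  if b == 0%R then 1%R else (a / b)%R.

Section acceptance.
Variables (pi pihat : S -> R) (q : S -> S -> R).

Definition mh_ratio (x y : S) : R :=
  acceptance_ratio (pi y * q y x) (pi x * q x y).

Definition mh_acceptance (x y : S) : R := Num.min 1%R (mh_ratio x y).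

Definition is_mh_kernel (P : R.-pker S ~> S) : Prop :=
  is_accept_reject_kernel q mh_acceptance P.

Definition da_ratio1 (x y : S) : R :=
  acceptance_ratio (pihat y * q y x) (pihat x * q x y).

Definition da_ratio2 (x y : S) : R :=
  acceptance_ratio (pi y / pihat y) (pi x / pihat x).

Definition da_acceptance (x y : S) : R :=
  (Num.min 1 (da_ratio1 x y) * Num.min 1 (da_ratio2 x y))%R.

Definition is_da_kernel (P : R.-pker S ~> S) : Prop :=
  is_accept_reject_kernel q da_acceptance P.

(* Logarithms are extended-real valued, with log 0 = -oo. *)
Definition log_ratio1 (x y : S) : \bar R := lne (da_ratio1 x y)%:E.
Definition log_ratio2 (x y : S) : \bar R := lne (da_ratio2 x y)%:E.

Definition esign (u : \bar R) : R :=
  match u with +oo => 1%R | -oo => (-1)%R | r%:E => Num.sg r end.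

Definition concordant (x : S) : set S :=
  [set y | (0 <= esign (log_ratio1 x y) * esign (log_ratio2 x y))%R].

End acceptance.

Definition uniformly_local (q : S -> S -> R) : Prop :=
  forall eps : R, (0 < eps)%R -> exists r : R, forall x : S,
    \int[lebesgue_state X]_(y in ~` [set y | (euclidean_dist x y < r)%R])
      (q x y)%:E
      < eps%:E.

End metropolis_hastings.

(* Main.v *)
(** Both kernels are reversible for [Pi], and a reversible kernel is variance
    bounding iff its conductance over the sets of measure at most 1/2 is bounded
    below.  Uniform locality makes proposals beyond some radius [r] cost at most
    half of the conductance of [P]; within radius [r] the control on [r_2] gives
    [alpha~ >= exp (- sup_[0,r] h) alpha], so [P~] keeps a positive conductance.

    Conductance implies variance bounding: Cheeger's inequality bounds the
    spectrum of [P~] on mean-zero functions away from 1, which solves the Poisson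
    equation [f = g - P~ g] up to a small error; the scaled variances of
    coboundaries telescope, and the error contributes a uniformly small amount.

    Variance bounding implies conductance: along sets [A] of vanishing
    conductance the chain is nearly frozen, so that the scaled variance of the
    normalised indicator of [A] is of order [n] for a long time; a gliding hump
    sums such indicators into one square-integrable function of infinite
    asymptotic variance. *)
Require Import Defs.
From HB Require Import structures.
From mathcomp Require Import all_boot all_order all_algebra.
From mathcomp Require Import all_classical all_reals all_analysis.
From mathcomp Require Import measurable_realfun.
From mathcomp Require Import ring lra zify.

Set Implicit Arguments.
Unset Strict Implicit.
Unset Printing Implicit Defensive.

Import Order.TTheory GRing.Theory Num.Theory.
Import numFieldNormedType.Exports.
Local Open Scope classical_set_scope.
Local Open Scope ring_scope.
Local Open Scope ereal_scope.

(** * Cheeger's inequality on a finite set *)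

(** No spectral theorem is used. A gap below 1 says nothing about the spectrum near -1, so powers of
    the kernel operator K need not contract; every iteration is made with the lazy operator L = (I +
    K) / 2, whose form is nonnegative and which contracts mean-zero functions. Since I - K = 2 (I -
    L), finite sums of powers of L solve the Poisson equation up to the remainder L^m f. Operator
    arguments are run on bounded measurable functions, where all means are finite and products stay
    in the class; truncation then reaches L^2, because the bounds on scaled variances are uniform in
    time. Cheeger's inequality is a finite sum over levels. It reaches general spaces by rounding
    the values of f, not by discretising the space. For kernels with a rejection atom, reversibility
    is checked on disjoint sets, which the atom does not connect. The comparison of the two kernels
    is made under the proposal, hence for Lebesgue measure, so that null sets of the target have to
    be converted into Lebesgue-null sets where the surrogate vanishes. *)

Section finite_cheeger_halfline.
Local Open Scope ring_scope.
Context {R : realFieldType} {I : finType}.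
Variables (Q : I -> I -> R) (p : I -> R) (kap : R).
Hypotheses (Qsym : forall i j, Q i j = Q j i) (Q0 : forall i j, 0 <= Q i j).
Hypothesis Qp : forall i, \sum_j Q i j = p i.
Hypothesis kap0 : 0 < kap.

(** A discrete layer-cake formula with weight [2 * t + 1] at level [t]. The common bound [M] on the
    levels allows exchanging this sum with sums over states. *)
Lemma sum_odd_sqr (M g : nat) : (g <= M)%N ->
  (g%:R ^+ 2 : R) = \sum_(t < M) (if (t < g)%N then (2 * t + 1)%:R else 0).
Proof.
move=> gM; rewrite -big_mkcond/= -(big_ord_widen M (fun t => (2 * t + 1)%:R))//.
elim: g {gM} => [|g IH]; first by rewrite big_ord0 expr0n.
rewrite big_ord_recr/= -IH -natr1 (natrD _ (2 * g)%N) natrM; ring.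
Qed.

(** Co-area argument: the bounds on the superlevel sets, summed with weights [2 * t + 1], compare
    [kap * G] with the sum of [Q i j] times the positive part of the difference of squares.
    Factoring that difference and applying Young's inequality brings in the Dirichlet form. *)
Lemma finite_cheeger_halfline (g : I -> nat) :
  (forall t, kap * \sum_(i | (t < g i)%N) p i <=
     \sum_(i | (t < g i)%N) \sum_(j | ~~ (t < g j)%N) Q i j) ->
  kap ^+ 2 * \sum_i p i * (g i)%:R ^+ 2 <=
  4 * \sum_i \sum_j Q i j * ((g i)%:R - (g j)%:R) ^+ 2.
Proof.
move=> H; pose M := (\max_i g i)%N.
have gM i : (g i <= M)%N by exact: leq_bigmax.
set G := \sum_i p i * _; set E := \sum_i \sum_j _.
have step1 : kap * G <= \sum_i \sum_j Q i j *
    \sum_(t < M) (if (t < g i)%N && ~~ (t < g j)%N then (2 * t + 1)%:R else 0).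
  have -> : G = \sum_(t < M) (2 * t + 1)%:R * \sum_(i | (t < g i)%N) p i.
    rewrite /G; under eq_bigr => i _ do rewrite (sum_odd_sqr (gM i)) mulr_sumr.
    rewrite exchange_big/=; apply: eq_bigr => t _.
    rewrite mulr_sumr [RHS]big_mkcond/=; apply: eq_bigr => i _.
    by case: ifP => _; rewrite ?mulr0// mulrC.
  rewrite mulr_sumr.
  have -> : \sum_i \sum_j Q i j * \sum_(t < M)
      (if (t < g i)%N && ~~ (t < g j)%N then (2 * t + 1)%:R else 0) =
    \sum_(t < M) (2 * t + 1)%:R *
      \sum_(i | (t < g i)%N) \sum_(j | ~~ (t < g j)%N) Q i j.
    under eq_bigr => i _ do under eq_bigr => j _ do rewrite mulr_sumr.
    under eq_bigr => i _ do rewrite exchange_big/=.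
    rewrite exchange_big/=; apply: eq_bigr => t _.
    rewrite mulr_sumr [RHS]big_mkcond/=; apply: eq_bigr => i _.
    case: ifP => _ /=; last by rewrite big1// => j _; rewrite mulr0.
    rewrite mulr_sumr [RHS]big_mkcond/=; apply: eq_bigr => j _.
    by case: ifP => _; rewrite ?mulr0// mulrC.
  by apply: ler_sum => t _; rewrite mulrCA ler_wpM2l// H.
have step2 : kap * G <= \sum_i \sum_j Q i j *
   (2 / kap * ((g i)%:R - (g j)%:R) ^+ 2 +
    kap / 4 * ((g i)%:R ^+ 2 + (g j)%:R ^+ 2)).
  apply: (le_trans step1); apply: ler_sum => i _; apply: ler_sum => j _.
  rewrite ler_wpM2l//.
  (* The weights are tuned so that, as (x + y)^2 <= 2 (x^2 + y^2), the second term sums to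
     [kap * G / 2], half of the left-hand side. *)
  have amgm (x y : R) : x * y <= 2 / kap * x ^+ 2 + kap / 8 * y ^+ 2.
    rewrite -subr_ge0.
    have -> : 2 / kap * x ^+ 2 + kap / 8 * y ^+ 2 - x * y =
      2 / kap * (x - kap / 4 * y) ^+ 2 by field; rewrite gt_eqF.
    by rewrite mulr_ge0 ?sqr_ge0// divr_ge0// ltW.
  have [gij|gij] := leqP (g j) (g i); last first.
    rewrite big1; last by move=> t _; case: ifP => // /andP[]; lia.
    by rewrite addr_ge0// mulr_ge0 ?addr_ge0 ?sqr_ge0 ?divr_ge0 ?(ltW kap0).
  have -> : \sum_(t < M) (if (t < g i)%N && ~~ (t < g j)%N
      then (2 * t + 1)%:R else 0) = (g i)%:R ^+ 2 - (g j)%:R ^+ 2 :> R.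
    rewrite (sum_odd_sqr (gM i)) (sum_odd_sqr (gM j)) -sumrB.
    apply: eq_bigr => t _; case: (ltnP t (g j)) => tj /=.
      by rewrite (leq_trans tj gij)/= subrr.
    by rewrite andbT subr0.
  rewrite subr_sqr; apply: (le_trans (amgm _ _)); rewrite lerD2l.
  rewrite -subr_ge0.
  have -> : kap / 4 * ((g i)%:R ^+ 2 + (g j)%:R ^+ 2) -
    kap / 8 * ((g i)%:R + (g j)%:R) ^+ 2 =
    kap / 8 * ((g i)%:R - (g j)%:R) ^+ 2 by field.
  by rewrite mulr_ge0 ?sqr_ge0// divr_ge0// ltW.
have GE : \sum_i \sum_j Q i j * ((g i)%:R ^+ 2 + (g j)%:R ^+ 2) = G + G.
  under eq_bigr => i _ do under eq_bigr => j _ do rewrite mulrDr.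
  under eq_bigr => i _ do rewrite big_split/=.
  rewrite big_split/=; congr (_ + _).
    by apply: eq_bigr => i _; rewrite -mulr_suml Qp.
  rewrite exchange_big/=; apply: eq_bigr => i _.
  by rewrite -mulr_suml -Qp; congr (_ * _); apply: eq_bigr => j _.
have step3 : kap * G <= 2 / kap * E + kap / 4 * (G + G).
  apply: (le_trans step2); rewrite -GE /E !mulr_sumr -big_split/=.
  rewrite ler_sum// => i _; rewrite !mulr_sumr -big_split/= ler_sum// => j _.
  by rewrite le_eqVlt; apply/orP; left; apply/eqP; field; rewrite gt_eqF.
have : kap * (kap * G) <= kap * (2 / kap * E + kap / 4 * (G + G)).
  by rewrite ler_wpM2l// ltW.
have -> : kap * (2 / kap * E + kap / 4 * (G + G)) = 2 * E + kap ^+ 2 * G / 2.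
  by field; rewrite gt_eqF.
have -> : kap * (kap * G) = kap ^+ 2 * G by ring.
lra.
Qed.

End finite_cheeger_halfline.

Section finite_conductance.
Local Open Scope ring_scope.

(** [m] is the least index whose strict upper tail weighs at most 1/2. If [m > 0], the tail above
    [m - 1] weighs more than 1/2 by minimality, so what lies below [m] weighs less. *)
Lemma finite_median {R : realFieldType} (N : nat) (p : 'I_N -> R) :
  (forall i, 0 <= p i) -> \sum_i p i = 1 ->
  exists m : nat, \sum_(i < N | (m < i)%N) p i <= 2^-1 /\
                  \sum_(i < N | (i < m)%N) p i <= 2^-1.
Proof.
move=> p0 p1.
have ex : exists m, \sum_(i < N | (m < i)%N) p i <= 2^-1.
  exists N; rewrite big_pred0 ?invr_ge0// => i.
  by apply/negbTE; rewrite -leqNgt ltnW.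
case: (ex_minnP ex) => m Hm mmin; exists m; split=> //.
case: m Hm mmin => [|m] Hm mmin; first by rewrite big_pred0 ?invr_ge0.
have : ~~ (\sum_(i < N | (m < i)%N) p i <= 2^-1).
  by apply/negP => /mmin; rewrite ltnn.
rewrite -ltNge => H.
have := p1; rewrite (bigID (fun i : 'I_N => (m < i)%N))/=.
under [X in _ + X]eq_bigl => i do rewrite -leqNgt -ltnS.
lra.
Qed.

(** Around a median [m], the positive and negative parts of [i - m], both given by truncated
    subtraction, have superlevel sets of mass at most 1/2, so the half-line bound applies to
    each. *)
Lemma finite_cheeger {R : realFieldType} (N : nat) (Q : 'I_N -> 'I_N -> R)
    (kap : R) : 0 < kap ->
  (forall i j, Q i j = Q j i) -> (forall i j, 0 <= Q i j) ->
  \sum_i \sum_j Q i j = 1 ->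
  (forall A : pred 'I_N, \sum_(i | A i) \sum_j Q i j <= 2^-1 ->
     kap * (\sum_(i | A i) \sum_j Q i j) <=
       \sum_(i | A i) \sum_(j | ~~ A j) Q i j) ->
  exists m : nat, kap ^+ 2 * \sum_i (\sum_j Q i j) * (i%:R - m%:R) ^+ 2 <=
    4 * \sum_i \sum_j Q i j * (i%:R - j%:R) ^+ 2.
Proof.
move=> kap0 Qsym Q0 Q1 cond; pose p i := \sum_j Q i j.
have p0 i : 0 <= p i by exact: sumr_ge0.
have [m [mu ml]] := finite_median p0 Q1; exists m.
have mono (A B : pred 'I_N) : (forall i, A i -> B i) ->
    \sum_(i | B i) p i <= 2^-1 -> \sum_(i | A i) p i <= 2^-1.
  move=> AB; apply: le_trans; rewrite big_mkcond [leRHS]big_mkcond/=.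
  by apply: ler_sum => i _; case: ifP => [/AB -> //|_]; case: ifP.
have up : kap ^+ 2 * \sum_i p i * (i - m)%N%:R ^+ 2 <=
    4 * \sum_i \sum_j Q i j * ((i - m)%N%:R - (j - m)%N%:R) ^+ 2.
  apply: (@finite_cheeger_halfline _ _ Q p kap Qsym Q0 _ kap0
    (fun i : 'I_N => (i - m)%N)) => // t.
  by apply: cond; apply: mono mu => i; lia.
have lo : kap ^+ 2 * \sum_i p i * (m - i)%N%:R ^+ 2 <=
    4 * \sum_i \sum_j Q i j * ((m - i)%N%:R - (m - j)%N%:R) ^+ 2.
  apply: (@finite_cheeger_halfline _ _ Q p kap Qsym Q0 _ kap0
    (fun i : 'I_N => (m - i)%N)) => // t.
  by apply: cond; apply: mono ml => i; lia.
have natB (a b : nat) : a%:R - b%:R = (a - b)%N%:R - (b - a)%N%:R :> R.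
  case: (leqP a b) => [ab|/ltnW ab].
    by have /eqP -> : (a - b == 0)%N by []; rewrite natrB// sub0r opprB.
  by have /eqP -> : (b - a == 0)%N by []; rewrite natrB// subr0.
have trunc0 (a b : nat) : (a - b)%N%:R * (b - a)%N%:R = 0 :> R.
  by case: (leqP a b) => [|/ltnW] /eqP ->; rewrite ?mul0r ?mulr0.
apply: (le_trans _ (le_trans (lerD up lo) _)).
  rewrite -mulrDr -big_split/= ler_wpM2l ?sqr_ge0// ler_sum// => i _.
  rewrite -mulrDr; apply: ler_wpM2l; first exact: p0.
  rewrite natB sqrrB.
  by rewrite trunc0 mul0rn subr0.
rewrite -mulrDr -big_split/= ler_wpM2l// ler_sum// => i _.
rewrite -big_split/= ler_sum// => j _; rewrite -mulrDr ler_wpM2l//.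
have -> : (i%:R - j%:R : R) = ((i - m)%N%:R - (j - m)%N%:R) -
    ((m - i)%N%:R - (m - j)%N%:R).
  by have := natB i m; have := natB j m; lra.
have := trunc0 i m; have := trunc0 j m.
set a := (i - m)%N%:R; set b := (m - i)%N%:R.
set c := (j - m)%N%:R; set d := (m - j)%N%:R => cd ab.
(* As a b = c d = 0, the full squared difference exceeds the sum of those of the two parts by
   exactly 2 (a d + c b). *)
have : 0 <= a * d + c * b by rewrite addr_ge0 ?mulr_ge0 ?ler0n.
nra.
Qed.

End finite_conductance.

(** * Integrals against mixtures of measures *)

Section mixtures.
Context {d d' : measure_display} {Y : measurableType d} {Z : measurableType d'}
  {R : realType}.
Import HBNNSimple.

Lemma measurable_mixture (nu : Y -> {measure set Z -> \bar R})
    (f : Z -> \bar R) :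
  (forall U, measurable U -> measurable_fun setT (fun y => nu y U)) ->
  (forall z, 0 <= f z) -> measurable_fun setT f ->
  measurable_fun setT (fun y => \int[nu y]_z f z).
Proof.
move=> mnu f0 mf; pose f_ := nnsfun_approx measurableT mf.
have fE y : \int[nu y]_z f z = limn (fun n => \int[nu y]_z (f_ n z)%:E).
  rewrite -monotone_convergence//.
  - apply: eq_integral => z _; apply/esym/cvg_lim => //.
    exact: cvg_nnsfun_approx.
  - by move=> n; exact/measurable_EFinP.
  - by move=> n z _; rewrite lee_fin.
  - by move=> z _ a b ab; rewrite lee_fin; exact/lefP/nd_nnsfun_approx.
apply: (emeasurable_fun_cvg (fun n y => \int[nu y]_z (f_ n z)%:E)).
  move=> n; under eq_fun do rewrite integralT_nnsfun sintegralE.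
  apply: emeasurable_fsum => // r; apply: measurable_funeM; exact: mnu.
move=> y _; rewrite fE; apply: ereal_nondecreasing_is_cvgn => a b ab.
apply: ge0_le_integral => //.
- by move=> z _; rewrite lee_fin.
- exact/measurable_EFinP.
- exact/measurable_EFinP.
- by move=> z _; rewrite lee_fin; exact/lefP/nd_nnsfun_approx.
Qed.

(** The right-hand side depends on [l] and [nu] only through the numbers [\int[l]_y nu y U], which
    reduces identities between mixtures to identities on sets. *)
Lemma integral_mixture_lim (l : {measure set Y -> \bar R})
    (nu : Y -> {measure set Z -> \bar R}) (f : Z -> \bar R)
    (mf : measurable_fun setT f) :
  (forall U, measurable U -> measurable_fun setT (fun y => nu y U)) ->
  (forall z, 0 <= f z) ->
  let f_ := nnsfun_approx measurableT mf in
  \int[l]_y \int[nu y]_z f z = limn (fun n =>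
    (\sum_(r \in range (f_ n))
       r%:E * \int[l]_y nu y (f_ n @^-1` [set r]))%E).
Proof.
move=> mnu f0 f_.
have fE (m : {measure set Z -> \bar R}) :
    \int[m]_z f z = limn (fun n => \int[m]_z (f_ n z)%:E).
  rewrite -monotone_convergence//.
  - apply: eq_integral => z _; apply/esym/cvg_lim => //.
    exact: cvg_nnsfun_approx.
  - by move=> n; exact/measurable_EFinP.
  - by move=> n z _; rewrite lee_fin.
  - by move=> z _ a b ab; rewrite lee_fin; exact/lefP/nd_nnsfun_approx.
under eq_integral do rewrite fE.
rewrite monotone_convergence//.
- congr (limn _); apply/funext => n.
  under eq_integral do rewrite integralT_nnsfun sintegralE.
  rewrite ge0_integral_fsum//; last 2 first.
  + by move=> r; apply: measurable_funeM; exact: mnu.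
  + by move=> r y _; exact: nnsfun_mulemu_ge0.
  apply: eq_fsbigr => r /set_mem [z _ <-].
  by rewrite ge0_integralZl_EFin//; exact: mnu.
- move=> n; apply: measurable_mixture => //; first by move=> z; rewrite lee_fin.
  exact/measurable_EFinP.
- by move=> n y _; apply: integral_ge0 => z _; rewrite lee_fin.
- move=> y _ a b ab; apply: ge0_le_integral => //.
  + by move=> z _; rewrite lee_fin.
  + exact/measurable_EFinP.
  + exact/measurable_EFinP.
  + by move=> z _; rewrite lee_fin; exact/lefP/nd_nnsfun_approx.
Qed.

End mixtures.

Section eq_integral_mixture.
Import HBNNSimple.

Lemma eq_integral_mixture {d1 d2 d'} {Y1 : measurableType d1}
    {Y2 : measurableType d2} {Z : measurableType d'} {R : realType}
    (l1 : {measure set Y1 -> \bar R}) (nu1 : Y1 -> {measure set Z -> \bar R})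
    (l2 : {measure set Y2 -> \bar R}) (nu2 : Y2 -> {measure set Z -> \bar R})
    (f : Z -> \bar R) :
  (forall U, measurable U -> measurable_fun setT (fun y => nu1 y U)) ->
  (forall U, measurable U -> measurable_fun setT (fun y => nu2 y U)) ->
  (forall U, measurable U ->
     \int[l1]_y nu1 y U = \int[l2]_y nu2 y U) ->
  (forall z, 0 <= f z) -> measurable_fun setT f ->
  \int[l1]_y \int[nu1 y]_z f z = \int[l2]_y \int[nu2 y]_z f z.
Proof.
move=> mnu1 mnu2 nuE f0 mf; rewrite !(integral_mixture_lim _ mf)//.
congr (limn _); apply/funext => n; apply: eq_fsbigr => r _.
by rewrite nuE.
Qed.

End eq_integral_mixture.

Lemma integral_mixture {d d'} {Y : measurableType d}
    {Z : measurableType d'} {R : realType}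
    (mu : {measure set Z -> \bar R}) (l : {measure set Y -> \bar R})
    (nu : Y -> {measure set Z -> \bar R}) (f : Z -> \bar R) :
  (forall U, measurable U -> measurable_fun setT (fun y => nu y U)) ->
  (forall U, measurable U -> mu U = \int[l]_y nu y U) ->
  (forall z, 0 <= f z) -> measurable_fun setT f ->
  \int[mu]_z f z = \int[l]_y \int[nu y]_z f z.
Proof.
move=> mnu muE f0 mf.
rewrite -(@eq_integral_mixture _ _ _ unit _ _ _ \d_tt (fun=> mu))//.
  by rewrite integral_dirac// diracT mul1e.
by move=> U mU; rewrite -muE// integral_dirac// diracT mul1e.
Qed.

(** A measure with a density is the mixture of the point masses at [z] scaled by [phi z]; this works
    for an arbitrary [l], sigma-finite or not. *)
Lemma integral_density {d} {Z : measurableType d} {R : realType}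
    (l mu : {measure set Z -> \bar R}) (phi : Z -> R) (f : Z -> \bar R) :
  (forall z, (0 <= phi z)%R) -> measurable_fun setT phi ->
  (forall U, measurable U -> mu U = \int[l]_(z in U) (phi z)%:E) ->
  (forall z, 0 <= f z) -> measurable_fun setT f ->
  \int[mu]_z f z = \int[l]_z ((phi z)%:E * f z).
Proof.
move=> phi0 mphi muE f0 mf.
pose nu z : {measure set Z -> \bar R} := mscale (NngNum (phi0 z)) \d_z.
have nuE z U : nu z U = (phi z * \1_U z)%:E by rewrite EFinM.
rewrite (@integral_mixture _ _ _ _ _ _ l nu)//.
- apply: eq_integral => z _.
  rewrite ge0_integral_mscale// integral_dirac// diracT mul1e//.
- move=> U mU; under eq_fun do rewrite nuE.
  by apply/measurable_EFinP; apply: measurable_funM => //; exact: measurable_indic.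
- move=> U mU; rewrite muE// integral_mkcond; apply: eq_integral => z _.
  by rewrite nuE epatch_indic EFinM.
Qed.

(** * Bounded measurable functions and reversible kernels *)

Section bounded_functions.
Local Open Scope ring_scope.
Context {d : measure_display} {T : measurableType d} {R : realType}.
Implicit Types f g : T -> R.

(** A class stable under products and kernel operators and integrable for every probability, so that
    computations with means carry no integrability conditions. *)
Definition bounded_mfun f : Prop :=
  measurable_fun setT f /\ exists M : R, forall x, `|f x| <= M.

Lemma bounded_mfun_cst (c : R) : bounded_mfun (fun=> c).
Proof. by split => //; exists `|c|. Qed.

Lemma bounded_mfunD f g : bounded_mfun f -> bounded_mfun g ->
  bounded_mfun (fun x => f x + g x).
Proof.
move=> [mf [M fM]] [mg [N gN]]; split; first exact: measurable_funD.
by exists (M + N) => x; rewrite (le_trans (ler_normD _ _))// lerD.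
Qed.

Lemma bounded_mfunM f g : bounded_mfun f -> bounded_mfun g ->
  bounded_mfun (fun x => f x * g x).
Proof.
move=> [mf [M fM]] [mg [N gN]]; split; first exact: measurable_funM.
by exists (M * N) => x; rewrite normrM ler_pM.
Qed.

Lemma bounded_mfunZ c f : bounded_mfun f -> bounded_mfun (fun x => c * f x).
Proof. exact/bounded_mfunM/bounded_mfun_cst. Qed.

Lemma bounded_mfunN f : bounded_mfun f -> bounded_mfun (fun x => - f x).
Proof.
by move=> /(bounded_mfunZ (-1)); under eq_fun do rewrite mulN1r.
Qed.

Lemma bounded_mfunB f g : bounded_mfun f -> bounded_mfun g ->
  bounded_mfun (fun x => f x - g x).
Proof. by move=> bf bg; exact/bounded_mfunD/bounded_mfunN. Qed.

Lemma bounded_mfunX f n : bounded_mfun f -> bounded_mfun (fun x => f x ^+ n).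
Proof.
move=> bf; elim: n => [|n IH]; first exact: bounded_mfun_cst.
by under eq_fun do rewrite exprS; exact: bounded_mfunM.
Qed.

Lemma bounded_mfun_indic (A : set T) : measurable A -> bounded_mfun \1_A.
Proof.
move=> mA; split; first exact: measurable_indic.
by exists 1 => x; rewrite indicE; case: (_ \in _); rewrite ?normr1 ?normr0.
Qed.

Lemma bounded_mfun_sum I (s : seq I) (F : I -> T -> R) :
  (forall i, bounded_mfun (F i)) -> bounded_mfun (fun x => \sum_(i <- s) F i x).
Proof.
move=> bF; elim: s => [|i s IH].
  by under eq_fun do rewrite big_nil; exact: bounded_mfun_cst.
by under eq_fun do rewrite big_cons; exact: bounded_mfunD.
Qed.

Definition mean (P : probability T R) f : R := fine (\int[P]_x (f x)%:E)%E.

Variable P : probability T R.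

Lemma bounded_mfun_integrable f : bounded_mfun f ->
  P.-integrable setT (EFin \o f).
Proof.
move=> [mf [M fM]]; apply: measurable_bounded_integrable => //.
  by rewrite -ge0_fin_numE// fin_num_measure.
exists M; split; first exact: num_real.
by move=> N MN x _ /=; exact: le_trans (fM x) (ltW MN).
Qed.

Lemma meanE f : bounded_mfun f -> (\int[P]_x (f x)%:E = (mean P f)%:E)%E.
Proof.
move=> bf; rewrite fineK//.
exact: (integrable_fin_num measurableT (bounded_mfun_integrable bf)).
Qed.

Lemma eq_mean f g : f =1 g -> mean P f = mean P g.
Proof. by move=> /funext ->. Qed.

Lemma meanD f g : bounded_mfun f -> bounded_mfun g ->
  mean P (fun x => f x + g x) = mean P f + mean P g.
Proof. by move=> bf bg; apply: RintegralD => //; exact: bounded_mfun_integrable. Qed.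

Lemma meanB f g : bounded_mfun f -> bounded_mfun g ->
  mean P (fun x => f x - g x) = mean P f - mean P g.
Proof. by move=> bf bg; apply: RintegralB => //; exact: bounded_mfun_integrable. Qed.

Lemma meanZ c f : bounded_mfun f -> mean P (fun x => c * f x) = c * mean P f.
Proof. by move=> bf; apply: RintegralZl => //; exact: bounded_mfun_integrable. Qed.

Lemma mean_cst c : mean P (fun=> c) = c.
Proof. by rewrite /mean integral_cst//= probability_setT mule1. Qed.

Lemma mean_le f g : bounded_mfun f -> bounded_mfun g ->
  (forall x, f x <= g x) -> mean P f <= mean P g.
Proof.
by move=> bf bg fg; apply: le_Rintegral => //; exact: bounded_mfun_integrable.
Qed.

Lemma mean_ge0 f : (forall x, 0 <= f x) -> 0 <= mean P f.
Proof. by move=> f0; apply: Rintegral_ge0. Qed.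

Lemma normr_mean_le f M : bounded_mfun f -> (forall x, `|f x| <= M) ->
  `|mean P f| <= M.
Proof.
move=> bf fM; rewrite ler_norml; apply/andP; split.
  rewrite -[leLHS]mean_cst; apply: mean_le => //; first exact: bounded_mfun_cst.
  by move=> x; have := fM x; rewrite ler_norml => /andP[].
rewrite -[leRHS]mean_cst; apply: mean_le => //; first exact: bounded_mfun_cst.
by move=> x; have := fM x; rewrite ler_norml => /andP[].
Qed.

Lemma mean_sum I (s : seq I) (F : I -> T -> R) :
  (forall i, bounded_mfun (F i)) ->
  mean P (fun x => \sum_(i <- s) F i x) = \sum_(i <- s) mean P (F i).
Proof.
move=> bF; elim: s => [|i s IH].
  by rewrite big_nil; under eq_mean do rewrite big_nil; exact: mean_cst.
rewrite big_cons -IH -meanD//; last exact: bounded_mfun_sum.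
by apply: eq_mean => x; rewrite big_cons.
Qed.

Lemma mean_indic (A : set T) : measurable A -> mean P \1_A = fine (P A).
Proof. by move=> mA; rewrite /mean integral_indic// setIT. Qed.

End bounded_functions.

Section kernel_operator.
Local Open Scope ring_scope.
Context {d : measure_display} {T : measurableType d} {R : realType}.
Variables (K : R.-pker T ~> T).
Implicit Types f g : T -> R.

Definition kop f (x : T) : R := mean (kernel_law K x) f.

Lemma measurable_fun_kernel_integral (f : T -> \bar R) :
  (forall x, (0 <= f x)%E) -> measurable_fun setT f ->
  measurable_fun setT (fun x => \int[K x]_y f y)%E.
Proof.
move=> f0 mf; apply: measurable_mixture => // U mU.
exact: measurable_kernel.
Qed.

Lemma kopD f g x : bounded_mfun f -> bounded_mfun g ->
  kop (fun y => f y + g y) x = kop f x + kop g x.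
Proof. exact: meanD. Qed.

Lemma kopB f g x : bounded_mfun f -> bounded_mfun g ->
  kop (fun y => f y - g y) x = kop f x - kop g x.
Proof. exact: meanB. Qed.

Lemma kopZ c f x : bounded_mfun f -> kop (fun y => c * f y) x = c * kop f x.
Proof. exact: meanZ. Qed.

Lemma kop_cst c x : kop (fun=> c) x = c.
Proof. exact: mean_cst. Qed.

Lemma kop_sum I (s : seq I) (F : I -> T -> R) x :
  (forall i, bounded_mfun (F i)) ->
  kop (fun y => \sum_(i <- s) F i y) x = \sum_(i <- s) kop (F i) x.
Proof. exact: mean_sum. Qed.

Lemma kop_ge0 f x : (forall y, 0 <= f y) -> 0 <= kop f x.
Proof. exact: mean_ge0. Qed.

Lemma bounded_mfun_kop f : bounded_mfun f -> bounded_mfun (kop f).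
Proof.
move=> bf; case: (bf) => mf [M fM]; split; last first.
  by exists M => x; exact: normr_mean_le.
(* Shifting by [M] makes the integrand nonnegative, as [measurable_fun_kernel_integral] requires. *)
have -> : kop f = fun x => fine (\int[K x]_y (f y + M)%:E)%E - M.
  apply/funext => x; rewrite -[X in _ = _ - X](mean_cst (kernel_law K x)).
  rewrite -[LHS](addrK (mean (kernel_law K x) (fun=> M))) -kopD//.
  exact: bounded_mfun_cst.
apply: measurable_funB => //; apply: measurableT_comp => //.
apply: (@measurable_fun_kernel_integral (fun y => (f y + M)%:E)) => [y|].
  rewrite lee_fin -lerBlDr sub0r.
  by have := fM y; rewrite ler_norml => /andP[].
by apply/measurable_EFinP; exact: measurable_funD.
Qed.

End kernel_operator.

Ltac bmf := repeat first [ assumption | exact: bounded_mfun_cst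
  | match goal with H : forall _, bounded_mfun _ |- _ => apply: H end
  | apply: bounded_mfunD | apply: bounded_mfunB | apply: bounded_mfunN
  | apply: bounded_mfunX | apply: bounded_mfunM
  | apply: bounded_mfun_indic | apply: bounded_mfun_kop ].

Section reversible_kernel.
Local Open Scope ring_scope.
Context {d : measure_display} {T : measurableType d} {R : realType}.
Variables (P : probability T R) (K : R.-pker T ~> T).
Implicit Types f g : T -> R.

Definition reversible_kernel : Prop := forall A B, measurable A ->
  measurable B -> (\int[P]_(x in A) K x B = \int[P]_(x in B) K x A)%E.

Hypothesis Krev : reversible_kernel.

(** One of the two sets of the reversibility identity becomes a function. Both sides are mixtures
    over [P], of [K x] scaled by [\1_B x] and of the point mass at [x] scaled by [K x B]; on sets
    they agree by reversibility. *)
Lemma reversible_indic_kop (B : set T) f : measurable B -> bounded_mfun f ->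
  (forall x, 0 <= f x) ->
  (\int[P]_(x in B) (kop K f x)%:E = \int[P]_x ((f x)%:E * K x B))%E.
Proof.
move=> mB bf f0.
have KB0 x : 0 <= fine (K x B) by exact: fine_ge0.
have KBE x : (fine (K x B))%:E = K x B.
  by rewrite fineK// (@fin_num_measure _ _ _ (kernel_law K x)).
have B0 x : 0 <= (\1_B x : R) by rewrite indicE ler0n.
pose nu1 x : {measure set T -> \bar R} := mscale (NngNum (B0 x)) (K x).
pose nu2 x : {measure set T -> \bar R} := mscale (NngNum (KB0 x)) \d_x.
transitivity (\int[P]_x \int[nu1 x]_y (f y)%:E)%E.
  rewrite integral_mkcond; apply: eq_integral => x _.
  rewrite ge0_integral_mscale//; last 2 first.
  - by apply/measurable_EFinP; case: bf.
  - by move=> y _; rewrite lee_fin.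
  by rewrite epatch_indic muleC -(meanE (kernel_law K x) bf).
rewrite (eq_integral_mixture (l2 := P) (nu2 := nu2)).
- apply: eq_integral => x _.
  have mf : measurable_fun setT (EFin \o f) by apply/measurable_EFinP; case: bf.
  rewrite ge0_integral_mscale//; last by move=> y _; rewrite lee_fin.
  by rewrite integral_dirac// diracT mul1e muleC; congr (_ * _)%E; exact: KBE.
- move=> U mU; apply: emeasurable_funM; last exact: measurable_kernel.
  by apply/measurable_EFinP; exact: measurable_indic.
- move=> U mU; apply: emeasurable_funM.
    by under eq_fun do rewrite KBE; exact: measurable_kernel.
  by apply/measurable_EFinP; exact: measurable_indic.
- move=> U mU; transitivity (\int[P]_(x in B) K x U)%E.
    rewrite [RHS]integral_mkcond; apply: eq_integral => x _.
    by rewrite epatch_indic muleC.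
  rewrite Krev// [LHS]integral_mkcond; apply: eq_integral => x _.
  by rewrite epatch_indic; congr (_ * _)%E; rewrite KBE.
- by move=> x; rewrite lee_fin.
- by apply/measurable_EFinP; case: bf.
Qed.

(** The remaining set becomes a function by a second comparison of mixtures, whose instance on sets
    is [reversible_indic_kop]. *)
Lemma reversible_kop_ge0 f g : bounded_mfun f -> bounded_mfun g ->
  (forall x, 0 <= f x) -> (forall x, 0 <= g x) ->
  mean P (fun x => f x * kop K g x) = mean P (fun x => g x * kop K f x).
Proof.
move=> bf bg f0 g0; congr fine.
have Kg0 x : 0 <= kop K g x by exact: kop_ge0.
have bKg := bounded_mfun_kop K bg.
pose nu1 x : {measure set T -> \bar R} := mscale (NngNum (Kg0 x)) \d_x.
pose nu2 x : {measure set T -> \bar R} := mscale (NngNum (g0 x)) (K x).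
have mf : measurable_fun setT (EFin \o f) by apply/measurable_EFinP; case: bf.
transitivity (\int[P]_x \int[nu1 x]_y (f y)%:E)%E.
  apply: eq_integral => x _.
  rewrite ge0_integral_mscale//; last by move=> y _; rewrite lee_fin.
  by rewrite integral_dirac// diracT mul1e muleC -EFinM.
rewrite (eq_integral_mixture (l2 := P) (nu2 := nu2))//.
- apply: eq_integral => x _.
  rewrite ge0_integral_mscale//; last by move=> y _; rewrite lee_fin.
  by rewrite (meanE (kernel_law K x) bf) -EFinM.
- move=> U mU; apply: emeasurable_funM.
    by apply/measurable_EFinP; case: bKg.
  by apply/measurable_EFinP; exact: measurable_indic.
- move=> U mU; apply: emeasurable_funM; last exact: measurable_kernel.
  by apply/measurable_EFinP; case: bg.
- move=> U mU; transitivity (\int[P]_(x in U) (kop K g x)%:E)%E.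
    rewrite [RHS]integral_mkcond; apply: eq_integral => x _.
    by rewrite epatch_indic.
  by rewrite reversible_indic_kop.
Qed.

(** Stationarity, as reversibility against the constant 1. *)
Lemma mean_kop f : bounded_mfun f -> mean P (kop K f) = mean P f.
Proof.
move=> bf; have bK := bounded_mfun_kop K bf; case: (bf) => _ [M fM].
have f0 x : 0 <= f x + M.
  by rewrite -lerBlDr sub0r; have := fM x; rewrite ler_norml => /andP[].
have bM : bounded_mfun (fun x => f x + M) by bmf.
have := reversible_kop_ge0 (bounded_mfun_cst 1) bM (fun=> ler01) f0.
have -> : mean P (fun x => 1 * kop K (fun y => f y + M) x) =
    mean P (kop K f) + M.
  rewrite -(mean_cst P M) -meanD//; last by bmf.
  apply: eq_mean => x; rewrite mul1r kopD ?kop_cst ?mean_cst//.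
  exact: bounded_mfun_cst.
have -> : mean P (fun x => (f x + M) * kop K (fun=> 1) x) = mean P f + M.
  rewrite -(mean_cst P M) -meanD//; last by bmf.
  by apply: eq_mean => x; rewrite kop_cst mulr1 mean_cst.
exact: addIr.
Qed.

Lemma reversible_kop f g : bounded_mfun f -> bounded_mfun g ->
  mean P (fun x => f x * kop K g x) = mean P (fun x => g x * kop K f x).
Proof.
move=> bf bg; have bKf := bounded_mfun_kop K bf.
have bKg := bounded_mfun_kop K bg.
case: (bf) (bg) => _ [M fM] [_ [N gN]].
have f0 x : 0 <= f x + M.
  by rewrite -lerBlDr sub0r; have := fM x; rewrite ler_norml => /andP[].
have g0 x : 0 <= g x + N.
  by rewrite -lerBlDr sub0r; have := gN x; rewrite ler_norml => /andP[].
have bM : bounded_mfun (fun x => f x + M) by bmf.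
have bN : bounded_mfun (fun x => g x + N) by bmf.
have expand (u v : T -> R) (a b : R) : bounded_mfun u -> bounded_mfun v ->
    mean P (fun x => (u x + a) * kop K (fun y => v y + b) x) =
    mean P (fun x => u x * kop K v x) + (b * mean P u + a * mean P v + a * b).
  move=> bu bv; have bKv := bounded_mfun_kop K bv.
  rewrite -(mean_kop bv) -!meanZ// -(mean_cst P (a * b)) -!meanD//; try by bmf.
  apply: eq_mean => x; rewrite kopD ?kop_cst//; last exact: bounded_mfun_cst.
  by ring.
have := reversible_kop_ge0 bM bN f0 g0.
rewrite (expand f g M N bf bg) (expand g f N M bg bf).
move: (mean P (fun x => f x * _)) (mean P (fun x => g x * _)) => a b; lra.
Qed.

End reversible_kernel.

(** * Poincaré inequality from a conductance bound *)

Section poincare_inequality.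
Local Open Scope ring_scope.
Context {d : measure_display} {T : measurableType d} {R : realType}.
Variables (P : probability T R) (K : R.-pker T ~> T).
Hypothesis Krev : reversible_kernel P K.
Variable kap : R.
Hypothesis kap0 : 0 < kap.
Hypothesis cond : forall B : set T, measurable B -> mean P \1_B <= 2^-1 ->
  kap * mean P \1_B <= mean P (fun x => \1_B x * kop K \1_(~` B) x).
Implicit Types f g : T -> R.

Section finite_valued.
Variables (N : nat) (F : T -> 'I_N).
Hypothesis mF : forall i, measurable (F @^-1` [set i]).
Implicit Types u v : 'I_N -> R.

Let D i : set T := F @^-1` [set i].

Let stepE u : (fun x => u (F x)) = (fun x => \sum_i u i * \1_(D i) x).
Proof.
apply/funext => x; rewrite (bigD1 (F x))//= indicE mem_set// mulr1 big1 ?addr0//.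
move=> i iF; rewrite indicE memNset ?mulr0// /D /= => Fi.
by rewrite -Fi eqxx in iF.
Qed.

Lemma bounded_mfun_finite_valued u : bounded_mfun (fun x => u (F x)).
Proof.
rewrite stepE; apply: bounded_mfun_sum => i; apply: bounded_mfunZ.
exact/bounded_mfun_indic/mF.
Qed.

Let Q i j := mean P (fun x => \1_(D i) x * kop K \1_(D j) x).

Let bD i : bounded_mfun (\1_(D i) : T -> R).
Proof. exact/bounded_mfun_indic/mF. Qed.

Let mean_step u v :
  mean P (fun x => u (F x) * kop K (fun y => v (F y)) x) =
  \sum_i \sum_j u i * v j * Q i j.
Proof.
have bKD i := bounded_mfun_kop K (bD i).
transitivity (mean P (fun x => \sum_i \sum_j
    u i * v j * (\1_(D i) x * kop K \1_(D j) x))).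
  apply: eq_mean => x; rewrite [u _](congr1 (fun h => h x) (stepE u)) stepE.
  rewrite kop_sum; last by move=> i; exact: bounded_mfunZ.
  rewrite mulr_suml; apply: eq_bigr => i _.
  rewrite mulr_sumr; apply: eq_bigr => j _.
  by rewrite kopZ//; ring.
rewrite mean_sum => [|i]; last first.
  by apply: bounded_mfun_sum => j; bmf.
apply: eq_bigr => i _; rewrite mean_sum => [|j]; last by bmf.
by apply: eq_bigr => j _; rewrite meanZ//; bmf.
Qed.

Let mean_step1 u : mean P (fun x => u (F x)) = \sum_i \sum_j u i * Q i j.
Proof.
have := mean_step u (fun=> 1); under eq_mean do rewrite kop_cst mulr1.
by move=> ->; apply: eq_bigr => i _; apply: eq_bigr => j _; rewrite mulr1.
Qed.

(** The flows [Q i j] between level sets of [F] form a symmetric array of total mass 1 whose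
    marginal is the law of [F], and conductance is tested on unions of level sets. In the constant
    8, a factor 4 is Cheeger's and a factor 2 comes from expanding the squared differences. *)
Lemma finite_valued_poincare :
  kap ^+ 2 * (mean P (fun x => (F x)%:R ^+ 2) - mean P (fun x => (F x)%:R) ^+ 2)
  <= 8 * (mean P (fun x => (F x)%:R ^+ 2) -
          mean P (fun x => (F x)%:R * kop K (fun y => (F y)%:R) x)).
Proof.
have Qsym i j : Q i j = Q j i by exact: reversible_kop.
have Q0 i j : 0 <= Q i j.
  apply: mean_ge0 => x; rewrite mulr_ge0 ?indicE ?ler0n//.
  by apply: kop_ge0 => y; rewrite indicE ler0n.
have Q1 : \sum_i \sum_j Q i j = 1.
  rewrite -(mean_cst P 1) (mean_step1 (fun=> 1)).
  by apply: eq_bigr => i _; apply: eq_bigr => j _; rewrite mul1r.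
have cond' (A : pred 'I_N) : \sum_(i | A i) \sum_j Q i j <= 2^-1 ->
    kap * (\sum_(i | A i) \sum_j Q i j) <=
      \sum_(i | A i) \sum_(j | ~~ A j) Q i j.
  pose B := [set x | A (F x)].
  have BE : \1_B = (fun x => (A (F x))%:R) :> (T -> R).
    by apply/funext => x; rewrite indicE; congr (nat_of_bool _)%:R;
      apply/idP/idP; rewrite inE.
  have CE : \1_(~` B) = (fun x => (~~ A (F x))%:R) :> (T -> R).
    apply/funext => x; rewrite indicE; congr (nat_of_bool _)%:R.
    by apply/idP/idP; rewrite inE => /negP.
  have mB : measurable B.
    have [mA _] := bounded_mfun_finite_valued (fun i => (A i)%:R).
    rewrite (_ : B = [set: T] `&` (fun x => (A (F x))%:R : R) @^-1` [set 1]).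
      exact: mA.
    rewrite setTI; apply/seteqP; split => x; rewrite /B/=; first by move=> ->.
    by case: (A _) => // /eqP; rewrite eq_sym oner_eq0.
  have := cond mB; rewrite CE BE (mean_step1 (fun i => (A i)%:R)).
  rewrite (mean_step (fun i => (A i)%:R) (fun i => (~~ A i)%:R)).
  have -> : \sum_i \sum_j (A i)%:R * Q i j = \sum_(i | A i) \sum_j Q i j.
    rewrite [RHS]big_mkcond/=; apply: eq_bigr => i _.
    case: (A i); first by apply: eq_bigr => j _; rewrite mul1r.
    by rewrite big1// => j _; rewrite mul0r.
  suff -> : \sum_i \sum_j (A i)%:R * (~~ A j)%:R * Q i j =
      \sum_(i | A i) \sum_(j | ~~ A j) Q i j by [].
  rewrite [RHS]big_mkcond/=; apply: eq_bigr => i _.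
  case: (A i); last by rewrite big1// => j _; rewrite !mul0r.
  rewrite [RHS]big_mkcond/=; apply: eq_bigr => j _.
  by case: (A j); rewrite /= ?mulr0 ?mul0r ?mulr1 ?mul1r.
have [m Hm] := finite_cheeger kap0 Qsym Q0 Q1 cond'.
pose S1 := mean P (fun x => (F x)%:R : R).
pose S2 := mean P (fun x => (F x)%:R ^+ 2 : R).
pose E := mean P (fun x => (F x)%:R * kop K (fun y => (F y)%:R) x).
have S1E : S1 = \sum_(i < N) \sum_(j < N) i%:R * Q i j.
  exact: (mean_step1 (fun i => i%:R)).
have S2E : S2 = \sum_(i < N) \sum_(j < N) i%:R ^+ 2 * Q i j.
  by rewrite -(mean_step1 (fun i => i%:R ^+ 2)).
have EE : E = \sum_(i < N) \sum_(j < N) i%:R * j%:R * Q i j.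
  exact: (mean_step (fun i => i%:R) (fun i => i%:R)).
have LE : \sum_(i < N) (\sum_(j < N) Q i j) * (i%:R - m%:R) ^+ 2 =
    S2 - 2 * m%:R * S1 + m%:R ^+ 2.
  rewrite [X in _ + X](_ : _ =
      m%:R ^+ 2 * \sum_(i < N) \sum_(j < N) Q i j); last by rewrite Q1 mulr1.
  rewrite S1E S2E !mulr_sumr -sumrB -big_split/=.
  apply: eq_bigr => i _; rewrite mulr_suml !mulr_sumr -sumrB -big_split/=.
  by apply: eq_bigr => j _; ring.
have RE : \sum_(i < N) \sum_(j < N) Q i j * (i%:R - j%:R) ^+ 2 = 2 * S2 - 2 * E.
  have S2E' : S2 = \sum_(i < N) \sum_(j < N) j%:R ^+ 2 * Q i j.
    rewrite S2E exchange_big/=; apply: eq_bigr => i _; apply: eq_bigr => j _.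
    by rewrite Qsym.
  rewrite (_ : 2 * S2 = S2 + S2); last by ring.
  rewrite {1}S2E S2E' EE mulr_sumr -big_split/= -sumrB.
  apply: eq_bigr => i _; rewrite mulr_sumr -big_split/= -sumrB.
  by apply: eq_bigr => j _; ring.
move: Hm; rewrite LE RE -/S1 -/S2 -/E => Hm.
(* The second moment about any point, here the median, dominates the variance. *)
apply: (@le_trans _ _ (kap ^+ 2 * (S2 - 2 * m%:R * S1 + m%:R ^+ 2))).
  rewrite ler_wpM2l ?sqr_ge0//.
  by have := sqr_ge0 (S1 - m%:R); rewrite sqrrB; lra.
by apply: (le_trans Hm); lra.
Qed.

End finite_valued.

Let ip f g := mean P (fun x => f x * g x).

Lemma norm_ipB_le f g f' g' C e : bounded_mfun f -> bounded_mfun g ->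
  bounded_mfun f' -> bounded_mfun g' ->
  (forall x, `|f x - f' x| <= e) -> (forall x, `|g x - g' x| <= e) ->
  (forall x, `|g x| <= C) -> (forall x, `|f' x| <= C) ->
  `|ip f g - ip f' g'| <= 2 * C * e.
Proof.
move=> bf bg bf' bg' fe ge gC fC; rewrite /ip -meanB; [|by bmf|by bmf].
apply: normr_mean_le => [|x]; first by bmf.
have -> : f x * g x - f' x * g' x = (f x - f' x) * g x + f' x * (g x - g' x).
  by ring.
rewrite (le_trans (ler_normD _ _))// !normrM -mulrA mulr_natl mulr2n lerD//.
  by rewrite mulrC ler_pM.
by rewrite ler_pM.
Qed.

(** [f] is a uniform limit of step functions that are affine images of integer-valued ones; both
    sides ignore additive constants and are quadratic, so the finite-valued case passes to these
    step functions. *)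
Lemma poincare f : bounded_mfun f ->
  kap ^+ 2 * (mean P (fun x => f x ^+ 2) - mean P f ^+ 2) <=
  8 * (mean P (fun x => f x ^+ 2) - mean P (fun x => f x * kop K f x)).
Proof.
move=> bf; case: (bf) => mf [M fM].
have M0 : 0 <= M by exact: le_trans (normr_ge0 _) (fM point).
have fl x : - M <= f x by have := fM x; rewrite ler_norml => /andP[].
have fu x : f x <= M by have := fM x; rewrite ler_norml => /andP[].
pose C := 2 * M + 2.
have approx (n : nat) : exists g, [/\ bounded_mfun g,
    (forall x, `|f x - g x| <= n.+1%:R^-1), (forall x, `|g x| <= C) &
    kap ^+ 2 * (ip g g - mean P g ^+ 2) <= 8 * (ip g g - ip g (kop K g))].
  have [r rE] : exists r : R, r = n.+1%:R by exists n.+1%:R.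
  have r0 : 0 < r by rewrite rE ltr0n.
  rewrite -rE.
  pose N := Num.truncn (2 * M * r).
  pose F x : 'I_N.+1 := inord (Num.truncn ((f x + M) * r)).
  have fMr0 x : 0 <= (f x + M) * r.
    by rewrite mulr_ge0 ?(ltW r0)//; have := fl x; lra.
  have FE x : (F x : nat) = Num.truncn ((f x + M) * r).
    rewrite inordK// ltnS; apply: le_truncn; rewrite ler_pM2r//.
    by have := fu x; lra.
  have mF i : measurable (F @^-1` [set i]).
    rewrite (_ : _ @^-1` _ = (fun x => (f x + M) * r) @^-1`
        `[(i%:R : R), i.+1%:R[%classic); last first.
      apply/seteqP; split => x /=.
        by move=> /(congr1 val)/=; rewrite FE in_itv/= => <-; exact: truncn_itv.
      by rewrite in_itv/= => xi; apply: val_inj; rewrite /= FE; exact: truncn_def.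
    rewrite -[X in measurable X]setTI.
    have mfr : measurable_fun setT (fun x => (f x + M) * r).
      by apply: measurable_funM => //; exact: measurable_funD.
    exact: mfr.
  have bF : bounded_mfun (fun x => (F x)%:R : R).
    exact: (bounded_mfun_finite_valued mF (fun i => i%:R)).
  pose g x := r^-1 * (F x)%:R - M; exists g.
  have bg : bounded_mfun g by rewrite /g; bmf.
  have fg x : `|f x - g x| <= r^-1.
    rewrite /g ler_norml; apply/andP.
    have /andP[] := truncn_itv (fMr0 x); rewrite -FE.
    set k : R := (F x)%:R; rewrite -natr1 -/k => h1 h2.
    have rV : r^-1 * r = 1 by rewrite mulVf// gt_eqF.
    have rV0 : 0 <= r^-1 by rewrite invr_ge0 ltW.
    have : r^-1 * k <= f x + M.
      by rewrite mulrC ler_pdivrMr.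
    have : f x + M <= r^-1 * k + r^-1.
      by rewrite -[X in _ <= _ + X]mulr1 -mulrDr mulrC ler_pdivlMr// ltW.
    by move=> ? ?; split; lra.
  split => //.
    move=> x; have -> : g x = f x - (f x - g x) by ring.
    rewrite (le_trans (ler_normB _ _))//.
    have := fM x; have := fg x.
    have : r^-1 <= 1 by rewrite rE invf_le1// ler1n.
    rewrite /C; lra.
  have := finite_valued_poincare mF.
  set V := (X in kap ^+ 2 * X <= _); set E := (X in _ <= 8 * X) => VE.
  have bKF := bounded_mfun_kop K bF.
  have Kg x : kop K g x = r^-1 * kop K (fun y => (F y)%:R) x - M.
    by rewrite /g kopB ?kopZ ?kop_cst//; bmf.
  have -> : ip g g - mean P g ^+ 2 = r^-1 ^+ 2 * V.
    rewrite /V /ip mulrBr -exprMn.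
    have -> : mean P (fun x => g x * g x) =
       r^-1 ^+ 2 * mean P (fun x => (F x)%:R ^+ 2) -
       2 * M * r^-1 * mean P (fun x => (F x)%:R) + M ^+ 2.
      rewrite -!meanZ; [|by bmf..]; rewrite -(mean_cst P (M ^+ 2)) -meanB; [|by bmf..].
      rewrite -meanD; [|by bmf..]; apply: eq_mean => x.
      by rewrite /g; ring.
    have -> : mean P g = r^-1 * mean P (fun x => (F x)%:R) - M.
      by rewrite -meanZ// -[X in _ = _ - X](mean_cst P) -meanB//; bmf.
    ring.
  have -> : ip g g - ip g (kop K g) = r^-1 ^+ 2 * E.
    have -> : ip g g = r^-1 ^+ 2 * mean P (fun x => (F x)%:R ^+ 2) -
       2 * M * r^-1 * mean P (fun x => (F x)%:R) + M ^+ 2.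
      rewrite /ip -!meanZ; [|by bmf..].
      rewrite -(mean_cst P (M ^+ 2)) -meanB; [|by bmf..].
      by rewrite -meanD; [|by bmf..]; apply: eq_mean => x; rewrite /g; ring.
    have -> : ip g (kop K g) =
       r^-1 ^+ 2 * mean P (fun x => (F x)%:R * kop K (fun y => (F y)%:R) x) -
       M * r^-1 * mean P (fun x => (F x)%:R) -
       M * r^-1 * mean P (kop K (fun y => (F y)%:R)) + M ^+ 2.
      rewrite /ip -!meanZ; [|by bmf..].
      rewrite -(mean_cst P (M ^+ 2)) -!meanB; [|by bmf..].
      rewrite -meanD; [|by bmf..]; apply: eq_mean => x; rewrite Kg /g; ring.
    by rewrite (mean_kop Krev)// /E; ring.
  by rewrite mulrCA [leRHS]mulrCA ler_wpM2l// sqr_ge0.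
have C0 : 0 <= C by rewrite /C; lra.
have fC x : `|f x| <= C by have := fM x; rewrite /C; lra.
have bK := bounded_mfun_kop K bf.
rewrite -subr_le0 leNgt; apply/negP; set D := (X in 0 < X) => D0.
(* Replacing [f] by [g] moves each inner product and the squared mean by at most [2 * C * e], hence
   the difference of the two sides by at most [c * e]; a failure by [D > c * e] would persist for
   [g]. *)
pose c := (4 * kap ^+ 2 + 32) * C.
pose n := Num.truncn (c / D).
have [g [bg fg gC]] := approx n; set e := n.+1%:R^-1 in fg *.
have bKg := bounded_mfun_kop K bg.
have ceD : c * e < D.
  by rewrite /e ltr_pdivrMr ?ltr0n// mulrC -ltr_pdivrMr//; exact: truncnS_gt.
have Kfg x : `|kop K f x - kop K g x| <= e.
  by rewrite -kopB//; apply: normr_mean_le => //; bmf.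
have KfC x : `|kop K f x| <= C by exact: normr_mean_le.
have := norm_ipB_le bf bf bg bg fg fg fC gC.
have := norm_ipB_le bf bK bg bKg fg Kfg KfC gC.
have mfg : `|mean P f ^+ 2 - mean P g ^+ 2| <= e * (2 * C).
  rewrite subr_sqr normrM ler_pM//.
    by rewrite -meanB//; apply: normr_mean_le => //; bmf.
  by rewrite -meanD//; apply: normr_mean_le; [bmf|] => x;
    rewrite (le_trans (ler_normD _ _))// mulr_natl mulr2n lerD.
move: mfg; rewrite !ler_norml => /andP[m1 m2] /andP[k1 k2] /andP[i1 i2].
have DE : D = kap ^+ 2 * (ip f f - mean P f ^+ 2) -
  8 * (ip f f - ip f (kop K f)) by [].
move: ceD; rewrite DE /c.
set u := ip f f in i1 i2 *; set v := ip g g in i1 i2 *.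
set u' := ip f (kop K f) in k1 k2 *; set v' := ip g (kop K g) in k1 k2 *.
set a := mean P f ^+ 2 in m1 m2 *; set b := mean P g ^+ 2 in m1 m2 *.
have k0 := sqr_ge0 kap.
have h1 : kap ^+ 2 * (u - a) <= kap ^+ 2 * (v - b + 4 * C * e).
  by rewrite ler_wpM2l//; lra.
move=> h3 h2.
have h4 : kap ^+ 2 * (v - b + 4 * C * e) =
  kap ^+ 2 * (v - b) + 4 * kap ^+ 2 * C * e by ring.
have h5 : (4 * kap ^+ 2 + 32) * C * e = 4 * kap ^+ 2 * C * e + 32 * C * e.
  by ring.
lra.
Qed.

End poincare_inequality.

(** * Second moments of path sums *)

Section kernel_cons_integral.
Context {d0 d : measure_display} {T0 : measurableType d0}
  {T : measurableType d} {R : realType} {n : nat}.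
Variables (l : R.-pker T0 ~> T) (k : R.-pker T ~> (n.-tuple T)).

Let nu (y : T) : {measure set (n.+1.-tuple T) -> \bar R}.
Proof. by refine (pushforward (k y) (tcons y)); exact: measurable_tcons. Defined.

Let measurable_nu U : measurable U -> measurable_fun setT (fun y => nu y U).
Proof. exact: measurable_kcons_section. Qed.

Let integral_nu (F : n.+1.-tuple T -> \bar R) y : (forall t, 0 <= F t) ->
  measurable_fun setT F -> \int[nu y]_t F t = \int[k y]_s F (tcons y s).
Proof. by move=> F0 mF; rewrite ge0_integral_pushforward//; exact: measurable_tcons. Qed.

Lemma measurable_integral_tcons (F : n.+1.-tuple T -> \bar R) :
  (forall t, 0 <= F t) -> measurable_fun setT F ->
  measurable_fun setT (fun y => \int[k y]_s F (tcons y s)).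
Proof.
move=> F0 mF; under eq_fun do rewrite -integral_nu//.
exact: measurable_mixture.
Qed.

Lemma integral_mkcons (F : n.+1.-tuple T -> \bar R) x : (forall t, 0 <= F t) ->
  measurable_fun setT F ->
  \int[mkcons l k x]_t F t = \int[l x]_y \int[k y]_s F (tcons y s).
Proof.
move=> F0 mF; rewrite (@integral_mixture _ _ _ _ _ _ (l x) nu)//.
by apply: eq_integral => y _; rewrite integral_nu.
Qed.

Lemma bounded_mfun_tcons (G : n.+1.-tuple T -> R) y : bounded_mfun G ->
  bounded_mfun (fun s => G (tcons y s)).
Proof.
move=> [mG [M GM]]; split; last by exists M.
exact: measurableT_comp mG (measurable_tcons _).
Qed.

Let shift_ge0 (G : n.+1.-tuple T -> R) M : (forall t, `|G t| <= M)%R ->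
  forall t, (0 <= G t + M)%R.
Proof.
by move=> GM t; rewrite -lerBlDr sub0r; have := GM t; rewrite ler_norml => /andP[].
Qed.

Lemma bounded_mfun_mean_tcons (G : n.+1.-tuple T -> R) : bounded_mfun G ->
  bounded_mfun (fun y => mean (kernel_law k y) (fun s => G (tcons y s))).
Proof.
move=> bG; case: (bG) => mG [M GM]; split; last first.
  by exists M => y; apply: normr_mean_le => //; exact: bounded_mfun_tcons.
have -> : (fun y => mean (kernel_law k y) (fun s => G (tcons y s))) =
    (fun y => fine (\int[k y]_s (G (tcons y s) + M)%:E) - M)%R.
  apply/funext => y; rewrite -[X in (_ = _ - X)%R](mean_cst (kernel_law k y)).
  rewrite -[LHS](addrK (mean (kernel_law k y) (fun=> M))) -meanD//.
    exact: bounded_mfun_tcons.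
  exact: bounded_mfun_cst.
apply: measurable_funB => //; apply: measurableT_comp => //.
apply: (@measurable_integral_tcons (fun t => (G t + M)%:E)) => [t|].
  by rewrite lee_fin shift_ge0.
by apply/measurable_EFinP; exact: measurable_funD.
Qed.

Lemma mean_mkcons (G : n.+1.-tuple T -> R) x : bounded_mfun G ->
  mean (kernel_law (mkcons l k) x) G =
  mean (kernel_law l x)
    (fun y => mean (kernel_law k y) (fun s => G (tcons y s))).
Proof.
move=> bG; case: (bG) => mG [M GM].
have bGM : bounded_mfun (fun t => G t + M)%R by bmf.
have bt y := bounded_mfun_tcons y bG.
have bk := bounded_mfun_mean_tcons bG.
have : mean (kernel_law (mkcons l k) x) (fun t => G t + M)%R =
    mean (kernel_law l x) (fun y => mean (kernel_law k y)
      (fun s => G (tcons y s) + M))%R.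
  congr fine; rewrite [LHS](@integral_mkcons (fun t => (G t + M)%:E))//.
  - apply: eq_integral => y _.
    by rewrite (meanE (kernel_law k y) (bounded_mfun_tcons y bGM)).
  - by move=> t; rewrite lee_fin shift_ge0.
  - by apply/measurable_EFinP; case: bGM.
have -> : mean (kernel_law l x) (fun y => mean (kernel_law k y)
      (fun s => G (tcons y s) + M))%R =
    mean (kernel_law l x) (fun y => mean (kernel_law k y)
      (fun s => G (tcons y s)) + M)%R.
  apply: eq_mean => y; rewrite meanD ?mean_cst//; exact: bounded_mfun_cst.
rewrite meanD ?mean_cst//; last exact: bounded_mfun_cst.
rewrite meanD ?mean_cst//; last exact: bounded_mfun_cst.
exact: addIr.
Qed.

End kernel_cons_integral.

Section chain_moments.
Context {d : measure_display} {T : measurableType d} {R : realType}.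
Variables (P : probability T R) (K : R.-pker T ~> T).
Hypothesis Krev : reversible_kernel P K.

Definition path_sum {n} (f : T -> R) (t : n.-tuple T) : R :=
  (\sum_(i < n) f (tnth t i))%R.

Lemma path_sum_tcons n (f : T -> R) y (s : n.-tuple T) :
  path_sum f (tcons y s) = (f y + path_sum f s)%R.
Proof.
rewrite /path_sum big_ord_recl; congr (_ + _)%R; apply: eq_bigr => i _.
by rewrite tnthS.
Qed.

Lemma measurable_path_sum n (f : T -> R) : measurable_fun setT f ->
  measurable_fun setT (@path_sum n f).
Proof.
move=> mf; apply: measurable_sum => i.
exact: measurableT_comp mf (measurable_tnth i).
Qed.

Lemma bounded_mfun_path_sum n (f : T -> R) : bounded_mfun f ->
  bounded_mfun (@path_sum n f).
Proof.
move=> bf; apply: bounded_mfun_sum => i; case: bf => mf [M fM]; split.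
  exact: measurableT_comp mf (measurable_tnth i).
by exists M.
Qed.

Lemma stationary_integral (f : T -> \bar R) : (forall x, 0 <= f x) ->
  measurable_fun setT f -> \int[P]_x \int[K x]_y f y = \int[P]_x f x.
Proof.
move=> f0 mf; rewrite [RHS](@integral_mixture _ _ _ _ _ _ P (fun x => K x))//.
  by move=> U mU; exact: measurable_kernel.
move=> U mU; rewrite -[RHS]/(\int[P]_(x in setT) _) Krev//.
under eq_integral do rewrite prob_kernel.
by rewrite integral_cst// mul1e.
Qed.

Lemma integral_initial_kernel (f : T -> \bar R) :
  \int[initial_kernel P tt]_y f y = \int[P]_y f y.
Proof. by []. Qed.

(** Stated for unbounded nonnegative [phi], since it serves for the square of a square-integrable
    function, before any integrability of path sums is known. *)
Lemma integral_path_sum_trajectory n (phi : T -> R) :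
  (forall x, (0 <= phi x)%R) -> measurable_fun setT phi ->
  \int[P]_y \int[trajectory K n y]_s (path_sum phi s)%:E =
  n%:R%:E * \int[P]_y (phi y)%:E.
Proof.
move=> phi0 mphi.
have ps0 m (t : m.-tuple T) : 0 <= (path_sum phi t)%:E.
  by rewrite lee_fin sumr_ge0.
have mps m : measurable_fun setT (fun t : m.-tuple T => (path_sum phi t)%:E).
  by apply/measurable_EFinP; exact: measurable_path_sum.
elim: n => [|n IH].
  rewrite mul0e integral0_eq// => y _; rewrite integral0_eq// => s _.
  by rewrite /path_sum big_ord0.
under eq_integral do rewrite /= integral_mkcons//.
rewrite (stationary_integral (f := fun y =>
  \int[trajectory K n y]_s (path_sum phi (tcons y s))%:E)); last 2 first.
- by move=> y; apply: integral_ge0.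
- exact: (@measurable_integral_tcons _ _ _ _ _ (fun t => (path_sum phi t)%:E)).
transitivity (\int[P]_y ((phi y)%:E +
    \int[trajectory K n y]_s (path_sum phi s)%:E)).
  apply: eq_integral => y _.
  under eq_integral do rewrite path_sum_tcons EFinD.
  rewrite ge0_integralD//; last 2 first.
  - by move=> s _; rewrite lee_fin.
  - exact: mps.
  by rewrite integral_cst// prob_kernel mule1.
rewrite ge0_integralD//.
- by rewrite IH -natr1 EFinD ge0_muleDl// mul1e addeC.
- by move=> y _; rewrite lee_fin.
- exact/measurable_EFinP.
- by move=> y _; apply: integral_ge0.
- apply: (@measurable_mixture _ _ _ _ _ (fun y => trajectory K n y)
    (fun t => (path_sum phi t)%:E)); [|by move=> t|exact: mps].
  by move=> U mU; exact: (measurable_kernel (trajectory K n) U mU).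
Qed.

Lemma integral_path_sum n (phi : T -> R) :
  (forall x, (0 <= phi x)%R) -> measurable_fun setT phi ->
  \int[chain_law P K n]_t (path_sum phi t)%:E =
  n%:R%:E * \int[P]_y (phi y)%:E.
Proof.
move=> phi0 mphi; rewrite -integral_path_sum_trajectory//.
case: n => [|n].
  rewrite /= integral0_eq; last by move=> t _; rewrite /path_sum big_ord0.
  by rewrite integral0_eq// => y _; rewrite integral0_eq// => t _;
    rewrite /path_sum big_ord0.
have ps0 m (t : m.-tuple T) : 0 <= (path_sum phi t)%:E.
  by rewrite lee_fin sumr_ge0.
have mps m : measurable_fun setT (fun t : m.-tuple T => (path_sum phi t)%:E).
  by apply/measurable_EFinP; exact: measurable_path_sum.
rewrite [LHS](@integral_mkcons _ _ _ _ _ _ (initial_kernel P) (trajectory K n)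
  (fun t => (path_sum phi t)%:E))//.
rewrite integral_initial_kernel.
rewrite -(stationary_integral (f := fun y =>
  \int[trajectory K n y]_s (path_sum phi (tcons y s))%:E)); last 2 first.
- by move=> y; apply: integral_ge0.
- exact: (@measurable_integral_tcons _ _ _ _ _ (fun t => (path_sum phi t)%:E)).
by apply: eq_integral => y _; rewrite /= integral_mkcons.
Qed.

Local Open Scope ring_scope.

Lemma bounded_mfun_iter f k : bounded_mfun f ->
  bounded_mfun (iter k (kop K) f).
Proof. by move=> bf; elim: k => //= k IH; bmf. Qed.

Lemma mean_iter f k : bounded_mfun f -> mean P (iter k (kop K) f) = mean P f.
Proof.
move=> bf; elim: k => //= k IH; rewrite (mean_kop Krev)//.
exact: bounded_mfun_iter.
Qed.

(** The powers start at 1 because a trajectory leaves out its starting point. *)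
Lemma mean_path_sum_trajectory n f y : bounded_mfun f ->
  mean (kernel_law (trajectory K n) y) (path_sum f) =
  \sum_(k < n) iter k.+1 (kop K) f y.
Proof.
move=> bf; elim: n y => [|n IH] y.
  rewrite big_ord0 -(mean_cst (kernel_law (trajectory K 0) y) 0).
  by apply: eq_mean => s; rewrite /path_sum big_ord0.
have bi k := bounded_mfun_iter k bf.
rewrite mean_mkcons; last exact: bounded_mfun_path_sum.
transitivity (kop K (fun z => f z + \sum_(k < n) iter k.+1 (kop K) f z) y).
  apply: eq_mean => z; under eq_mean do rewrite path_sum_tcons.
  rewrite meanD ?mean_cst ?IH//; first exact: bounded_mfun_cst.
  exact: bounded_mfun_path_sum.
rewrite kopD//; last by apply: bounded_mfun_sum => k; exact: (bi k.+1).
rewrite big_ord_recl; congr (_ + _).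
rewrite [LHS]mean_sum//.
Qed.

(** For [f] of mean zero, the covariance of [f] at two times [k] steps apart in the stationary
    chain; no centring is built in. *)
Definition autocov f k : R := mean P (fun x => f x * iter k (kop K) f x).

(** Conditioning on the first state splits the square of a path sum into the square of the first
    term, twice its product with the conditional mean [A] of the rest, and the conditional second
    moment [B] of the rest. By stationarity the mean of [B] satisfies the same recursion. *)
Lemma mean_sqr_path_sum n f : bounded_mfun f ->
  mean (chain_law P K n) (fun t => path_sum f t ^+ 2) =
  \sum_(m < n) (autocov f 0 + 2 * \sum_(k < m) autocov f k.+1).
Proof.
move=> bf; have bi k := bounded_mfun_iter k bf.
have bps m := @bounded_mfun_path_sum m f bf.
pose A m y := mean (kernel_law (trajectory K m) y) (path_sum f).
pose B m y := mean (kernel_law (trajectory K m) y) (fun t => path_sum f t ^+ 2).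
have AE m y : A m y = \sum_(k < m) iter k.+1 (kop K) f y.
  exact: mean_path_sum_trajectory.
have bA m : bounded_mfun (A m).
  rewrite (_ : A m = fun y => \sum_(k < m) iter k.+1 (kop K) f y).
    by apply: bounded_mfun_sum => k; exact: (bi k.+1).
  by apply/funext => y; exact: AE.
have tc m y (s : m.-tuple T) : path_sum f (tcons y s) ^+ 2 =
    f y ^+ 2 + (2 * f y) * path_sum f s + path_sum f s ^+ 2.
  by rewrite path_sum_tcons; ring.
have step m y : mean (kernel_law (trajectory K m) y)
    (fun s => path_sum f (tcons y s) ^+ 2) =
    f y ^+ 2 + (2 * f y) * A m y + B m y.
  under eq_mean do rewrite tc.
  have b1 := bounded_mfunX 2 (bps m); have b2 := bounded_mfunM _ (bps m).
  rewrite meanD; [|by bmf..].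
  by rewrite meanD ?meanZ ?mean_cst//; bmf.
have BS m y : B m.+1 y =
    kop K (fun z => f z ^+ 2 + (2 * f z) * A m z + B m z) y.
  rewrite /B mean_mkcons; last by bmf.
  by apply: eq_mean => z; exact: step.
have bB m : bounded_mfun (B m).
  elim: m => [|m IH].
    rewrite (_ : B 0%N = fun=> 0); first exact: bounded_mfun_cst.
    apply/funext => y; rewrite -(mean_cst (kernel_law (trajectory K 0) y) 0).
    by apply: eq_mean => s; rewrite /path_sum big_ord0 expr0n.
  rewrite (_ : B m.+1 =
    kop K (fun z => f z ^+ 2 + (2 * f z) * A m z + B m z)).
    by bmf.
  by apply/funext.
have b1 m : bounded_mfun (fun z => f z ^+ 2 + (2 * f z) * A m z) by bmf.
have mB m : mean P (B m.+1) =
    mean P (fun z => f z ^+ 2 + (2 * f z) * A m z + B m z).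
  by rewrite -[RHS](mean_kop Krev); [apply: eq_mean => y; exact: BS|bmf].
have mBE m : mean P (B m) =
    \sum_(m < m) (autocov f 0 + 2 * \sum_(k < m) autocov f k.+1).
  elim: m => [|m IH].
    rewrite big_ord0 -(mean_cst P 0); apply: eq_mean => y.
    rewrite -(mean_cst (kernel_law (trajectory K 0) y) 0).
    by apply: eq_mean => s; rewrite /path_sum big_ord0 expr0n.
  rewrite big_ord_recr/= -IH mB meanD; [|by bmf..].
  rewrite addrC; congr (_ + _); rewrite meanD; [|by bmf..]; congr (_ + _).
  transitivity (mean P (fun z => 2 *
      \sum_(k < m) (f z * iter k.+1 (kop K) f z))).
    by apply: eq_mean => z; rewrite AE -mulr_sumr mulrA.
  have b2 (k : 'I_m) : bounded_mfun (fun z => f z * iter k.+1 (kop K) f z).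
    by apply: bounded_mfunM => //; exact: (bi k.+1).
  by rewrite meanZ ?mean_sum//; exact: bounded_mfun_sum.
rewrite -mBE; case: n => [|n].
  rewrite mBE big_ord0 -(mean_cst (chain_law P K 0) 0); apply: eq_mean => t.
  by rewrite /path_sum big_ord0 expr0n.
rewrite mB.
transitivity (mean (kernel_law (mkcons (initial_kernel P) (trajectory K n)) tt)
  (fun t => path_sum f t ^+ 2)) => //.
rewrite mean_mkcons; last by bmf.
by apply: eq_mean => y; exact: step.
Qed.

Lemma mean_path_sum n f : bounded_mfun f ->
  mean (chain_law P K n) (path_sum f) = n%:R * mean P f.
Proof.
move=> bf; case: n => [|n].
  rewrite mul0r -(mean_cst (chain_law P K 0) 0); apply: eq_mean => t.
  by rewrite /path_sum big_ord0.
have bi (k : 'I_n) := bounded_mfun_iter k.+1 bf.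
transitivity (mean (kernel_law (mkcons (initial_kernel P) (trajectory K n)) tt)
  (path_sum f)) => //.
rewrite mean_mkcons; last exact: bounded_mfun_path_sum.
transitivity (mean P (fun y => f y + \sum_(k < n) iter k.+1 (kop K) f y)).
  apply: eq_mean => y; under eq_mean do rewrite path_sum_tcons.
  rewrite meanD ?mean_cst ?mean_path_sum_trajectory//.
    exact: bounded_mfun_cst.
  exact: bounded_mfun_path_sum.
rewrite meanD ?mean_sum//; last exact: bounded_mfun_sum.
under eq_bigr do rewrite mean_iter//.
by rewrite sumr_const card_ord -mulrS mulr_natl.
Qed.

End chain_moments.

(** * Scaled variances of square-integrable functions *)

Section weighted_cauchy_schwarz.
Local Open Scope ring_scope.

(** Lagrange's identity: twice the difference of the two sides is the sum of the squares
    [(f i - f j) ^+ 2] with weights [a i * a j]. *)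
Lemma weighted_cauchy_schwarz {R : realFieldType} (I : Type) (s : seq I)
    (a f : I -> R) : (forall i, 0 <= a i) ->
  (\sum_(i <- s) a i * f i) ^+ 2 <=
   (\sum_(i <- s) a i) * \sum_(i <- s) a i * f i ^+ 2.
Proof.
move=> a0; set S := \sum_(i <- s) a i * f i; set A := \sum_(i <- s) a i.
set Q := \sum_(i <- s) a i * f i ^+ 2.
have E : \sum_(i <- s) \sum_(j <- s) a i * a j * (f i - f j) ^+ 2 =
    2 * (A * Q) - 2 * S ^+ 2.
  have -> : 2 * (A * Q) - 2 * S ^+ 2 = A * Q + Q * A - 2 * (S * S) by ring.
  rewrite /A /Q /S !mulr_suml mulr_sumr -big_split/= -sumrB.
  apply: eq_bigr => i _; rewrite !mulr_sumr -big_split/= -sumrB.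
  by apply: eq_bigr => j _; ring.
have : 0 <= \sum_(i <- s) \sum_(j <- s) a i * a j * (f i - f j) ^+ 2.
  by do 2 (apply: sumr_ge0 => ? _); rewrite mulr_ge0 ?sqr_ge0 ?mulr_ge0.
by rewrite E; lra.
Qed.

End weighted_cauchy_schwarz.

Section square_integrable.
Local Open Scope ring_scope.
Context {d : measure_display} {T : measurableType d} {R : realType}.
Variable P : probability T R.
Implicit Types f g : T -> R.

Lemma Lfun2P f : f \in Lfun P 2%:E <->
  measurable_fun setT f /\ (\int[P]_x (f x ^+ 2)%:E < +oo)%E.
Proof.
split=> [lf|[mf foo]].
  split; first by move: lf; rewrite inE => /andP[/[!inE]].
  exact: (integrable_lty measurableT (Lfun2_integrable_sqr lf)).
rewrite inE; apply/andP; split; rewrite inE//=.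
rewrite /finite_norm unlock; apply: poweR_lty.
rewrite (_ : (fun _ => _) = (fun x => (f x ^+ 2)%:E))//; apply/funext => x /=.
by rewrite powR_mulrn// -normrX ger0_norm ?sqr_ge0.
Qed.

Lemma measurable_Lfun2 f : f \in Lfun P 2%:E -> measurable_fun setT f.
Proof. by move=> /Lfun2P[]. Qed.

Lemma Lfun2D f g : f \in Lfun P 2%:E -> g \in Lfun P 2%:E ->
  (fun x => f x + g x) \in Lfun P 2%:E.
Proof.
move=> lf lg; apply: (@GRing.rpredD _ (Lfun P 2%:E) f g lf lg).
by rewrite lee1n.
Qed.

Lemma Lfun2Z c f : f \in Lfun P 2%:E -> (fun x => c * f x) \in Lfun P 2%:E.
Proof.
move=> lf; under eq_fun do rewrite mulrC.
by apply: Lfun_scale => //; rewrite ler1n.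
Qed.

Lemma Lfun2B f g : f \in Lfun P 2%:E -> g \in Lfun P 2%:E ->
  (fun x => f x - g x) \in Lfun P 2%:E.
Proof.
move=> lf lg; apply: (@GRing.rpredB _ (Lfun P 2%:E) f g lf lg).
by rewrite lee1n.
Qed.

Lemma bounded_mfun_Lfun2 f : bounded_mfun f -> f \in Lfun P 2%:E.
Proof.
move=> bf; apply/Lfun2P; split; first by case: bf.
by rewrite (meanE P (bounded_mfunX 2 bf)) ltry.
Qed.

Lemma Lfun2_meanE f : f \in Lfun P 2%:E ->
  (\int[P]_x (f x ^+ 2)%:E = (mean P (fun x => f x ^+ 2))%:E)%E.
Proof.
move=> /Lfun2P[_ foo]; rewrite fineK// ge0_fin_numE//.
by apply: integral_ge0 => x _; rewrite lee_fin sqr_ge0.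
Qed.

Lemma mean_sqrD_le f g : f \in Lfun P 2%:E -> g \in Lfun P 2%:E ->
  mean P (fun x => (f x + g x) ^+ 2) <=
  2 * mean P (fun x => f x ^+ 2) + 2 * mean P (fun x => g x ^+ 2).
Proof.
move=> lf lg; rewrite -lee_fin EFinD !EFinM -!Lfun2_meanE//; last exact: Lfun2D.
have mf := measurable_Lfun2 lf; have mg := measurable_Lfun2 lg.
have mX2 (u : T -> R) : measurable_fun setT u ->
    measurable_fun setT (fun x => (u x ^+ 2)%:E).
  by move=> mu; apply/measurable_EFinP/measurable_funX.
have mZ2 (u : T -> R) : measurable_fun setT u ->
    measurable_fun setT (fun x => 2%:E * (u x ^+ 2)%:E)%E.
  by move=> mu; apply: measurable_funeM; exact: mX2.
rewrite -!ge0_integralZl_EFin//; try (by move=> x _; rewrite lee_fin sqr_ge0);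
  try exact: mX2.
rewrite -ge0_integralD//; try exact: mZ2;
  try (by move=> x _; rewrite -EFinM lee_fin mulr_ge0 ?sqr_ge0).
apply: ge0_le_integral => //.
- by move=> x _; rewrite lee_fin sqr_ge0.
- by apply: mX2; exact: measurable_funD.
- by apply: emeasurable_funD; exact: mZ2.
- move=> x _; rewrite -!EFinM -EFinD lee_fin.
  by have := sqr_ge0 (f x - g x); nra.
Qed.

(** Cutting [f] to 0 where its modulus exceeds [n] leaves a squared error dominated by [f ^+ 2] and
    null at each point from some [n] on. *)
Lemma Lfun2_truncation f e : f \in Lfun P 2%:E -> 0 < e ->
  exists2 u, bounded_mfun u & mean P (fun x => (f x - u x) ^+ 2) <= e.
Proof.
move=> lf e0; have mf := measurable_Lfun2 lf.
pose A (n : nat) := f @^-1` `[- n%:R, n%:R]%classic.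
have mA n : measurable (A n) by rewrite -[A n]setTI; exact: mf.
pose u n x := f x * \1_(A n) x.
have uE n x : u n x = if `|f x| <= n%:R then f x else 0.
  rewrite /u indicE; case: ifPn => [fn|/negP fn].
    by rewrite mem_set ?mulr1// /A /= in_itv/= -ler_norml.
  by rewrite memNset ?mulr0// /A /= in_itv/= -ler_norml.
have bu n : bounded_mfun (u n).
  split; first by apply: measurable_funM => //; exact: measurable_indic.
  by exists n%:R => x; rewrite uE; case: ifP => // _; rewrite normr0.
have lu n := Lfun2B lf (bounded_mfun_Lfun2 (bu n)).
have [_ _ cv] : [/\ P.-integrable setT (cst 0%E : T -> \bar R),
    (\int[P]_x `|((f x - u n x) ^+ 2)%:E - 0|)%E @[n --> \oo] --> 0%E &
    (\int[P]_x ((f x - u n x) ^+ 2)%:E)%E @[n --> \oo] --> (\int[P]_x 0)%E].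
  apply: (@dominated_convergence _ _ _ P setT measurableT
    (fun n x => ((f x - u n x) ^+ 2)%:E) (cst 0%E) (fun x => (f x ^+ 2)%:E)).
  - by move=> n; apply/measurable_EFinP/measurable_funX; exact: measurable_Lfun2.
  - exact: measurable_cst.
  - apply: aeW => x _; apply: (@cvg_near_cst).
    exists (Num.truncn `|f x|).+1 => // n /= fn; rewrite uE.
    case: ifPn => [_|]; first by rewrite subrr expr0n.
    move=> /negP; case; rewrite ltW//; apply: (lt_le_trans (truncnS_gt _)).
    by rewrite ler_nat.
  - exact: Lfun2_integrable_sqr.
  - apply: aeW => x n _; rewrite gee0_abs ?lee_fin ?sqr_ge0// uE.
    by case: ifP => _; rewrite ?subr0// subrr expr0n sqr_ge0.
rewrite integral0 in cv.
have [n _ /(_ n (leqnn n)) /= un] := cv _ (open_ereal_lt' (e0 : (0%:E < e%:E)%E)).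
exists (u n); first exact: bu.
by rewrite -lee_fin -Lfun2_meanE// ltW.
Qed.

Definition var f : R := fine ('V_P[f])%E.
Definition cov f g : R := fine (covariance P f g).

Lemma var_lin (a b : R) f g : f \in Lfun P 2%:E -> g \in Lfun P 2%:E ->
  var (fun x => a * f x + b * g x) =
  a ^+ 2 * var f + 2 * a * b * cov f g + b ^+ 2 * var g.
Proof.
move=> lf lg; have lf1 := Lfun_subset12 (fin_num_measure P _ measurableT) lf.
have lg1 := Lfun_subset12 (fin_num_measure P _ measurableT) lg.
have lfg := Lfun2_mul_Lfun1 lf lg.
have laf : (a \o* f) \in Lfun P 2%:E by apply: Lfun_scale => //; rewrite ler1n.
have lbg : (b \o* g) \in Lfun P 2%:E by apply: Lfun_scale => //; rewrite ler1n.
have lbg1 := Lfun_subset12 (fin_num_measure P _ measurableT) lbg.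
rewrite /var (_ : (fun x => _) = (a \o* f \+ b \o* g)); last first.
  by apply/funext => x /=; rewrite mulrC (mulrC b).
rewrite varianceD// !varianceZ// covarianceZl//; last exact: Lfun2_mul_Lfun1.
rewrite covarianceZr//.
rewrite -(fineK (variance_fin_num lf)) -(fineK (variance_fin_num lg)).
rewrite -(fineK (covariance_fin_num lf1 lg1 lfg)) -!EFinM -!EFinD /= /var /cov.
ring.
Qed.

Lemma var_ge0 f : 0 <= var f.
Proof. by apply: fine_ge0; exact: variance_ge0. Qed.

Lemma varDc f (c : R) : f \in Lfun P 2%:E -> var (fun x => f x + c) = var f.
Proof. by move=> lf; congr fine; exact: varianceD_cst_r. Qed.

Lemma var_le_sqr f : f \in Lfun P 2%:E -> var f <= mean P (fun x => f x ^+ 2).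
Proof.
move=> lf; rewrite -lee_fin -Lfun2_meanE// fineK ?variance_fin_num//.
have E2 : ('E_P[f ^+ 2] = \int[P]_x (f x ^+ 2)%:E)%E by rewrite unlock.
rewrite varianceE// E2.
have lf1 := Lfun_subset12 (fin_num_measure P _ measurableT) lf.
rewrite -(fineK (expectation_fin_num lf1)) -EFin_expe leeBlDr//.
by rewrite leeDl// lee_fin sqr_ge0.
Qed.

Lemma var_bounded f : bounded_mfun f ->
  var f = mean P (fun x => f x ^+ 2) - mean P f ^+ 2.
Proof.
move=> bf; rewrite /var varianceE ?bounded_mfun_Lfun2// unlock.
rewrite (meanE P (bounded_mfunX 2 bf)) (meanE P bf).
by [].
Qed.

End square_integrable.

Section scaled_variance.
Local Open Scope ring_scope.
Context {d : measure_display} {T : measurableType d} {R : realType}.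
Variables (P : probability T R) (K : R.-pker T ~> T).
Hypothesis Krev : reversible_kernel P K.
Implicit Types f g : T -> R.

(** Cauchy-Schwarz along the path bounds the squared sum by [n] times the path sum of [f ^+ 2],
    whose mean stationarity evaluates. The quadratic growth is crude, but serves at a fixed time. *)
Lemma path_sum_Lfun2 n f : f \in Lfun P 2%:E ->
  @path_sum _ T R n f \in Lfun (chain_law P K n) 2%:E /\
  mean (chain_law P K n) (fun t => path_sum f t ^+ 2) <=
  n%:R ^+ 2 * mean P (fun x => f x ^+ 2).
Proof.
move=> lf; have mf := measurable_Lfun2 lf.
have mps : measurable_fun setT (@path_sum _ T R n f).
  exact: measurable_path_sum.
have f20 x : 0 <= f x ^+ 2 by exact: sqr_ge0.
have mf2 : measurable_fun setT (fun x => f x ^+ 2) by exact: measurable_funX.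
have H : (\int[chain_law P K n]_t (path_sum f t ^+ 2)%:E <=
    (n%:R ^+ 2 * mean P (fun x => f x ^+ 2))%:E)%E.
  rewrite expr2 -mulrA EFinM EFinM -Lfun2_meanE//.
  rewrite -(integral_path_sum Krev n f20 mf2).
  have mps2 : measurable_fun setT
      (fun t => (@path_sum _ T R n (fun x => f x ^+ 2) t)%:E).
    by apply/measurable_EFinP; exact: measurable_path_sum.
  rewrite -ge0_integralZl_EFin//; last first.
    by move=> t _; rewrite lee_fin sumr_ge0.
  apply: ge0_le_integral => //.
  - by move=> t _; rewrite lee_fin sqr_ge0.
  - by apply/measurable_EFinP; exact: measurable_funX.
  - exact: measurable_funeM.
  - move=> t _; rewrite -EFinM lee_fin.
    have := weighted_cauchy_schwarz (index_enum 'I_n)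
      (fun i => f (tnth t i)) (fun=> ler01).
    rewrite sumr_const card_ord.
    by under eq_bigr do rewrite mul1r;
      under [in X in _ <= _ * X]eq_bigr do rewrite mul1r.
have lps : @path_sum _ T R n f \in Lfun (chain_law P K n) 2%:E.
  by apply/Lfun2P; split => //; rewrite (le_lt_trans H)// ltry.
by split => //; rewrite -lee_fin -Lfun2_meanE.
Qed.

(** The scaled variance as a real number; at [n = 0] the inverse is 0, hence so is [Vn]. *)
Definition Vn n f : R := n%:R^-1 * var (chain_law P K n) (@path_sum _ T R n f).
Definition Cn n f g : R :=
  n%:R^-1 * cov (chain_law P K n) (@path_sum _ T R n f) (@path_sum _ T R n g).

Lemma scaled_varianceE n f : f \in Lfun P 2%:E ->
  scaled_variance P K f n = (Vn n f)%:E.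
Proof.
move=> lf; have [lps _] := path_sum_Lfun2 n lf.
rewrite /scaled_variance /Vn.
have -> : (fun t : n.-tuple T => n%:R^-1 * \sum_(i < n) f (tnth t i)) =
    n%:R^-1 \o* @path_sum _ T R n f.
  by apply/funext => t /=; rewrite mulrC.
rewrite varianceZ// -(fineK (variance_fin_num lps)) -!EFinM mulrA.
congr (_ * _)%:E; case: n {lps} => [|n]; first by rewrite invr0 mul0r.
by rewrite expr2 mulrA mulfV ?mul1r.
Qed.

Lemma Vn_ge0 n f : 0 <= Vn n f.
Proof. by rewrite mulr_ge0 ?invr_ge0 ?ler0n// var_ge0. Qed.

Lemma Vn_lin n (a b : R) f g : f \in Lfun P 2%:E -> g \in Lfun P 2%:E ->
  Vn n (fun x => a * f x + b * g x) =
  a ^+ 2 * Vn n f + 2 * a * b * Cn n f g + b ^+ 2 * Vn n g.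
Proof.
move=> lf lg; have [lpf _] := path_sum_Lfun2 n lf.
have [lpg _] := path_sum_Lfun2 n lg.
rewrite /Vn /Cn (_ : path_sum _ = fun t => a * path_sum f t + b * path_sum g t).
  by rewrite var_lin//; ring.
by apply/funext => t; rewrite /path_sum big_split !mulr_sumr.
Qed.

Lemma VnZ n c f : f \in Lfun P 2%:E ->
  Vn n (fun x => c * f x) = c ^+ 2 * Vn n f.
Proof.
move=> lf; have := Vn_lin n c 0 lf lf.
rewrite (_ : (fun x => _ + 0 * _) = (fun x => c * f x)); last first.
  by apply/funext => x; rewrite mul0r addr0.
by move=> ->; ring.
Qed.

Lemma VnDc n f c : f \in Lfun P 2%:E -> Vn n (fun x => f x + c) = Vn n f.
Proof.
move=> lf; have [lpf _] := path_sum_Lfun2 n lf.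
rewrite /Vn (_ : path_sum _ = fun t => path_sum f t + n%:R * c).
  by rewrite varDc.
apply/funext => t; rewrite /path_sum big_split/= sumr_const card_ord.
by rewrite mulr_natl.
Qed.

Lemma Vn_le n f : f \in Lfun P 2%:E ->
  Vn n f <= n%:R * mean P (fun x => f x ^+ 2).
Proof.
move=> lf; have [lpf H] := path_sum_Lfun2 n lf.
case: n lpf H => [|n] lpf H; first by rewrite /Vn invr0 !mul0r.
rewrite /Vn mulrC ler_pdivrMr ?ltr0n// (le_trans (var_le_sqr lpf))//.
by rewrite mulrAC -expr2.
Qed.

(** Young's inequality for the covariance. With [t = 1] it gives rough bounds, with small [t] the
    continuity of the scaled variance under a small perturbation [g]. *)
Lemma VnD_le n f g (t : R) : 0 < t -> f \in Lfun P 2%:E -> g \in Lfun P 2%:E ->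
  Vn n (fun x => f x + g x) <= (1 + t) * Vn n f + (1 + t^-1) * Vn n g.
Proof.
move=> t0 lf lg.
have := Vn_ge0 n (fun x => t * f x + (-1) * g x); rewrite Vn_lin// => H.
have := Vn_lin n 1 1 lf lg; under eq_fun do rewrite !mul1r.
have : 0 <= t^-1 * (t ^+ 2 * Vn n f + 2 * t * -1 * Cn n f g + (-1) ^+ 2 * Vn n g).
  by rewrite mulr_ge0// invr_ge0 ltW.
have -> : t^-1 * (t ^+ 2 * Vn n f + 2 * t * -1 * Cn n f g + (-1) ^+ 2 * Vn n g) =
  t * Vn n f - 2 * Cn n f g + t^-1 * Vn n g by field; rewrite gt_eqF.
by move=> h ->; lra.
Qed.

Lemma Vn_bounded n f : bounded_mfun f -> mean P f = 0 ->
  Vn n f = n%:R^-1 *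
    \sum_(m < n) (autocov P K f 0 + 2 * \sum_(k < m) autocov P K f k.+1).
Proof.
move=> bf f0; rewrite /Vn var_bounded; last exact: bounded_mfun_path_sum.
rewrite mean_sqr_path_sum//.
by rewrite mean_path_sum// f0 mulr0 expr0n subr0.
Qed.

End scaled_variance.

(** * A spectral gap implies variance bounding *)

Section limits.
Local Open Scope ring_scope.
Context {R : realType}.

Lemma le_geometric (a b c r : R) : 0 <= r < 1 ->
  (forall m, a <= b + c * r ^+ m) -> a <= b.
Proof.
move=> /andP[r0 r1] H.
have cv : (fun m => b + c * r ^+ m) @ \oo --> b.
  rewrite -[X in _ --> X]addr0; apply: cvgD; first exact: cvg_cst.
  by apply: (@cvg_geometric R c r); rewrite ger0_norm.
rewrite -(cvg_lim _ cv)//; apply: limr_ge; first by apply/cvg_ex; exists b.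
by apply: nearW.
Qed.

(** A uniform limit of convergent sequences is Cauchy. *)
Lemma cvgn_approx (u : nat -> R) :
  (forall e, 0 < e -> exists2 v : nat -> R, cvgn v &
     forall n, `|u n - v n| <= e) -> cvgn u.
Proof.
move=> H; apply: R_complete; apply: cauchy_exP => e e0.
have e40 : 0 < e / 4 by rewrite divr_gt0.
have [v cv uv] := H _ e40; exists (limn v).
have /cvgrPdist_le /(_ _ e40) := cv; apply: filterS => n /= vn.
rewrite /ball/= -(subrK (v n) (limn v)) -addrA (le_lt_trans (ler_normD _ _))//.
have := uv n; rewrite distrC => uvn.
by rewrite (le_lt_trans (lerD vn uvn))//; lra.
Qed.

(** The inner sum telescopes once and the outer sum once more, so that for bounded [b] only a
    bounded term accompanies the one proportional to [N]. *)
Lemma sum_second_difference (b c : nat -> R) N :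
  (forall k, c k = b k - 2 * b k.+1 + b k.+2) ->
  \sum_(m < N) (c 0 + 2 * \sum_(k < m) c k.+1) =
  N%:R * (b 0 - b 2) - 2 * (b 1 - b N.+1).
Proof.
move=> cE.
have inner m : \sum_(k < m) c k.+1 = (b 1 - b 2) - (b m.+1 - b m.+2).
  elim: m => [|m IH]; first by rewrite big_ord0 subrr.
  by rewrite big_ord_recr/= IH cE; ring.
elim: N => [|N IH]; first by rewrite big_ord0 subrr; ring.
by rewrite big_ord_recr/= IH inner cE -natr1; ring.
Qed.

End limits.

Section gap_variance_bounding.
Local Open Scope ring_scope.
Context {d : measure_display} {T : measurableType d} {R : realType}.
Variables (P : probability T R) (K : R.-pker T ~> T).
Hypothesis Krev : reversible_kernel P K.
Variable gam : R.
Hypotheses (gam0 : 0 < gam) (gam1 : gam <= 1).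
Hypothesis gap : forall f : T -> R, bounded_mfun f -> mean P f = 0 ->
  gam * mean P (fun x => f x ^+ 2) <=
  mean P (fun x => f x ^+ 2) - mean P (fun x => f x * kop K f x).
Implicit Types f g : T -> R.

Let ip f g := mean P (fun x => f x * g x).
Let sqn f := mean P (fun x => f x ^+ 2).

Let ipC f g : ip f g = ip g f.
Proof. by apply: eq_mean => x; rewrite mulrC. Qed.

Let ipxx f : ip f f = sqn f.
Proof. by []. Qed.

Let sqn_ge0 f : 0 <= sqn f.
Proof. by apply: mean_ge0 => x; exact: sqr_ge0. Qed.

Let sqn_lin (a b : R) f g : bounded_mfun f -> bounded_mfun g ->
  sqn (fun x => a * f x + b * g x) =
  a ^+ 2 * sqn f + 2 * a * b * ip f g + b ^+ 2 * sqn g.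
Proof.
move=> bf bg; rewrite /sqn /ip -!meanZ; [|by bmf..].
rewrite -!meanD; [|by bmf..]; apply: eq_mean => x; ring.
Qed.

Let ip_le f g : bounded_mfun f -> bounded_mfun g ->
  2 * `|ip f g| <= sqn f + sqn g.
Proof.
move=> bf bg.
have := sqn_ge0 (fun x => 1 * f x + 1 * g x).
have := sqn_ge0 (fun x => 1 * f x + (-1) * g x).
rewrite !sqn_lin// => h1 h2.
by case: (ger0P (ip f g)) => _; lra.
Qed.

(** Jensen's inequality at each point, read as nonnegativity of a conditional variance, followed by
    stationarity. *)
Let sqn_kop f : bounded_mfun f -> sqn (kop K f) <= sqn f.
Proof.
move=> bf; have bK := bounded_mfun_kop K bf.
rewrite /sqn -[leRHS](mean_kop Krev); last by bmf.
apply: mean_le => [||x]; [by bmf|by bmf|].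
have : 0 <= kop K (fun y => (f y - kop K f x) ^+ 2) x.
  by apply: kop_ge0 => y; exact: sqr_ge0.
have -> : kop K (fun y => (f y - kop K f x) ^+ 2) x =
    kop K (fun y => f y ^+ 2 + (- (2 * kop K f x) * f y + kop K f x ^+ 2)) x.
  by congr kop; apply/funext => y; ring.
rewrite kopD; [|by bmf|by bmf].
rewrite kopD; [|by bmf|by bmf].
by rewrite kopZ// kop_cst; lra.
Qed.

(** Averaging with the identity moves the spectrum into [0, 1], where the gap at 1 makes powers
    contract on mean-zero functions. The bound [1 - gam] becomes [rho]. *)
Let lazy f x := 2^-1 * f x + 2^-1 * kop K f x.

Let bounded_lazy f : bounded_mfun f -> bounded_mfun (lazy f).
Proof. by move=> bf; rewrite /lazy; bmf. Qed.

Let mean_lazy f : bounded_mfun f -> mean P (lazy f) = mean P f.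
Proof.
move=> bf; have bK := bounded_mfun_kop K bf.
rewrite /lazy meanD; [|by bmf|by bmf].
by rewrite !meanZ// (mean_kop Krev)//; lra.
Qed.

Let rho := 1 - gam / 2.

Let rho_bnd : 0 < rho < 1.
Proof. by rewrite /rho; apply/andP; split; move: gam0 gam1; lra. Qed.

Let ip_lazyE f g : bounded_mfun f -> bounded_mfun g ->
  ip f (lazy g) = 2^-1 * ip f g + 2^-1 * ip f (kop K g).
Proof.
move=> bf bg; have bK := bounded_mfun_kop K bg.
rewrite /ip -!meanZ; [|by bmf|by bmf].
rewrite -meanD; [|by bmf|by bmf].
by apply: eq_mean => x; rewrite /lazy; ring.
Qed.

Let ip_lazyC f g : bounded_mfun f -> bounded_mfun g ->
  ip f (lazy g) = ip g (lazy f).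
Proof.
move=> bf bg; rewrite (ip_lazyE bf bg) (ip_lazyE bg bf) (ipC f g).
by congr (_ + _ * _); exact: (reversible_kop Krev bf bg).
Qed.

Let ip_lazy_ge0 f : bounded_mfun f -> 0 <= ip f (lazy f).
Proof.
move=> bf; have bK := bounded_mfun_kop K bf.
rewrite ip_lazyE//.
have := ip_le bf bK; have := sqn_kop bf.
have : - ip f (kop K f) <= `|ip f (kop K f)| by rewrite -normrN ler_norm.
by rewrite ipxx; lra.
Qed.

Let ip_lazy_le f : bounded_mfun f -> mean P f = 0 ->
  ip f (lazy f) <= rho * sqn f.
Proof.
move=> bf f0; rewrite ip_lazyE//.
have := gap bf f0; rewrite ipxx -/(sqn f) -/(ip f (kop K f)) /rho.
lra.
Qed.

(* Cauchy-Schwarz for the nonnegative form [ip f (lazy g)]. *)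
Let sqn_lazy f : bounded_mfun f -> mean P f = 0 ->
  sqn (lazy f) <= rho ^+ 2 * sqn f.
Proof.
move=> bf f0; have /andP[r0 r1] := rho_bnd.
have bL := bounded_lazy bf.
have bLL := bounded_lazy bL.
have H := ip_lazy_le bL (etrans (mean_lazy bf) f0).
have a := ip_lazy_le bf f0.
(* At this function, nonnegativity of the form reads [2 * rho * b <= rho ^+ 2 * a' + c]; as
   [c <= rho * b] by the gap, it yields [b <= rho * a']. *)
have bh : bounded_mfun (fun x => f x - rho^-1 * lazy f x) by bmf.
have := ip_lazy_ge0 bh.
have -> : ip (fun x => f x - rho^-1 * lazy f x)
     (lazy (fun x => f x - rho^-1 * lazy f x)) =
  ip f (lazy f) - rho^-1 * ip (lazy f) (lazy f) - rho^-1 * ip f (lazy (lazy f))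
  + rho^-1 ^+ 2 * ip (lazy f) (lazy (lazy f)).
  have bK := bounded_mfun_kop K bf; have bKL := bounded_mfun_kop K bL.
  rewrite /ip -!meanZ; [|by bmf..].
  rewrite -!meanB; [|by bmf..].
  rewrite -!meanD; [|by bmf..].
  have E x : lazy (fun x => f x - rho^-1 * lazy f x) x =
      lazy f x - rho^-1 * lazy (lazy f) x.
    have Ldef g y : lazy g y = 2^-1 * g y + 2^-1 * kop K g y by [].
    rewrite (Ldef (fun _ => _)) kopB; [|by bmf|by bmf].
    rewrite kopZ// (Ldef (lazy f)); have := Ldef f x.
    by move: (lazy f x) => u ->; ring.
  by apply: eq_mean => x; rewrite E; ring.
rewrite (ip_lazyC bf bL) ipxx.
set b := sqn (lazy f) in H *; set c := ip (lazy f) (lazy (lazy f)) in H *.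
set a' := ip f (lazy f) in a *.
have b0 : 0 <= b by exact: sqn_ge0.
move=> h.
have h2 : 0 <= rho ^+ 2 * (a' - rho^-1 * b - rho^-1 * b + rho^-1 ^+ 2 * c).
  by rewrite mulr_ge0// sqr_ge0.
have h3 : rho ^+ 2 * (a' - rho^-1 * b - rho^-1 * b + rho^-1 ^+ 2 * c) =
  rho ^+ 2 * a' - 2 * rho * b + c by field; rewrite gt_eqF.
have h4 : rho * b <= rho * (rho * a') by rewrite mulrA -expr2; lra.
rewrite ler_pM2l// in h4.
by rewrite (le_trans h4)// expr2 -mulrA ler_wpM2l// ltW.
Qed.

Let bounded_iter_lazy m f : bounded_mfun f -> bounded_mfun (iter m lazy f).
Proof. by move=> bf; elim: m => //= m IH; exact: bounded_lazy. Qed.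

Let mean_iter_lazy m f : bounded_mfun f ->
  mean P (iter m lazy f) = mean P f.
Proof.
move=> bf; elim: m => //= m IH; rewrite mean_lazy//; exact: bounded_iter_lazy.
Qed.

Let sqn_iter_lazy m f : bounded_mfun f -> mean P f = 0 ->
  sqn (iter m lazy f) <= (rho ^+ 2) ^+ m * sqn f.
Proof.
move=> bf f0; elim: m => [|m IH]; first by rewrite expr0 mul1r.
have bi := bounded_iter_lazy m bf.
apply: (le_trans (sqn_lazy bi _)); first by rewrite mean_iter_lazy.
by rewrite (exprS _ m) -mulrA ler_wpM2l// sqr_ge0.
Qed.

(** Truncated Neumann series for the Poisson equation; the factor 1/2 comes from I - K = 2 (I - L),
    with L the operator [lazy]. *)
Let poisson f m x := \sum_(k < m) 2^-1 * iter k lazy f x.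

Let bounded_poisson f m : bounded_mfun f -> bounded_mfun (poisson f m).
Proof.
move=> bf; apply: bounded_mfun_sum => k; apply: bounded_mfunZ.
exact: bounded_iter_lazy.
Qed.

Let poissonE f m x : bounded_mfun f ->
  poisson f m x - kop K (poisson f m) x = f x - iter m lazy f x.
Proof.
move=> bf; have bi k := bounded_iter_lazy k bf.
rewrite /poisson kop_sum; last by move=> k; bmf.
rewrite -sumrB; elim: m => [|m IH]; first by rewrite big_ord0 subrr.
rewrite big_ord_recr/= IH kopZ//.
have -> : lazy (iter m lazy f) x =
  2^-1 * iter m lazy f x + 2^-1 * kop K (iter m lazy f) x by [].
lra.
Qed.

Let mean_poisson f m : bounded_mfun f -> mean P f = 0 ->
  mean P (poisson f m) = 0.
Proof.
move=> bf f0; have bi k := bounded_iter_lazy k bf.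
rewrite mean_sum; last by move=> k; bmf.
by rewrite big1// => k _; rewrite meanZ// mean_iter_lazy// f0 mulr0.
Qed.

(** The gap applied to the solution [g] gives [gam * sqn g <= ip g h], and Young's inequality
    absorbs half of it. The bound is uniform in [m] because [sqn h <= 4 * sqn f] for every [m]. *)
Let sqn_poisson f m : bounded_mfun f -> mean P f = 0 ->
  sqn (poisson f m) <= 4 / gam ^+ 2 * sqn f.
Proof.
move=> bf f0; have bg := bounded_poisson m bf.
have bi := bounded_iter_lazy m bf.
have := gap bg (mean_poisson m bf f0).
set g := poisson f m in bg *.
pose h x := f x - iter m lazy f x.
have bh : bounded_mfun h by rewrite /h; bmf.
have -> : mean P (fun x => g x ^+ 2) - mean P (fun x => g x * kop K g x) = ip g h.
  rewrite -meanB; [|by bmf|by bmf].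
  by apply: eq_mean => x; rewrite /h -poissonE// -/g; ring.
rewrite -/(sqn g) => H.
have nh : sqn h <= 4 * sqn f.
  have : sqn (fun x => 1 * f x + (-1) * iter m lazy f x) = sqn h.
    by congr (mean P); apply/funext => x; rewrite /h; ring.
  rewrite sqn_lin// => <-.
  have := ip_le bf bi; have := ler_norm (- ip f (iter m lazy f)).
  rewrite normrN; have := sqn_iter_lazy m bf f0.
  have : (rho ^+ 2) ^+ m * sqn f <= 1 * sqn f.
    rewrite ler_wpM2r// exprn_ile1 ?sqr_ge0// exprn_ile1//; have := rho_bnd; lra.
  lra.
have bgg : bounded_mfun (fun x => gam * g x) by bmf.
have := ip_le bgg bh.
have -> : sqn (fun x => gam * g x) = gam ^+ 2 * sqn g.
  rewrite /sqn -meanZ; last by bmf.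
  by apply: eq_mean => x; rewrite exprMn.
have -> : ip (fun x => gam * g x) h = gam * ip g h.
  rewrite /ip -meanZ; last by bmf.
  by apply: eq_mean => x; rewrite mulrA.
have := ler_norm (gam * ip g h) => h1 h2.
have h3 : gam * (gam * sqn g) <= gam * ip g h by rewrite ler_wpM2l// ltW.
have h4 : gam ^+ 2 * sqn g <= 4 * sqn f by move: h3; rewrite mulrA -expr2; lra.
by rewrite mulrAC ler_pdivlMr ?exprn_gt0// mulrC.
Qed.

Let iterB k f g x : bounded_mfun f -> bounded_mfun g ->
  iter k (kop K) (fun y => f y - g y) x =
  iter k (kop K) f x - iter k (kop K) g x.
Proof.
move=> bf bg; elim: k x => //= k IH x; rewrite -kopB; first last.
- exact: bounded_mfun_iter.
- exact: bounded_mfun_iter.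
- by congr (kop K _ x); apply/funext => y; exact: IH.
Qed.

(** Reversibility moves one factor I - K across the inner product, leaving its square, a second
    difference in the number of steps. *)
Lemma autocov_coboundary g k : bounded_mfun g ->
  autocov P K (fun x => g x - kop K g x) k =
  autocov P K g k - 2 * autocov P K g k.+1 + autocov P K g k.+2.
Proof.
move=> bg; have bi j := bounded_mfun_iter K j bg.
have bK := bounded_mfun_kop K bg.
have ip1 j : mean P (fun x => kop K g x * iter j (kop K) g x) =
    autocov P K g j.+1.
  rewrite [RHS](reversible_kop Krev bg (bi j)).
  by apply: eq_mean => x; rewrite mulrC.
rewrite -(ip1 k.+1) (_ : 2 * _ = mean P (fun x => kop K g x * iter k (kop K) g x) +
  mean P (fun x => g x * iter k.+1 (kop K) g x)); last first.
  by rewrite ip1 /autocov; ring.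
rewrite /autocov -meanD; [|by bmf|by bmf].
rewrite -meanB; [|by bmf|by bmf].
rewrite -meanD; [|by bmf|by bmf].
by apply: eq_mean => x; rewrite iterB// -iterSr; ring.
Qed.

Lemma autocov_le g k : bounded_mfun g -> `|autocov P K g k| <= sqn g.
Proof.
move=> bg; have bi := bounded_mfun_iter K k bg.
have si : sqn (iter k (kop K) g) <= sqn g.
  elim: k {bi} => //= k IH; apply: le_trans IH; apply: sqn_kop.
  exact: bounded_mfun_iter.
by have := ip_le bg bi; rewrite -[ip _ _]/(autocov P K g k); lra.
Qed.

Lemma Vn_coboundary n g : bounded_mfun g ->
  Vn P K n.+1 (fun x => g x - kop K g x) =
  (autocov P K g 0 - autocov P K g 2) -
  n.+1%:R^-1 * (2 * (autocov P K g 1 - autocov P K g n.+2)).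
Proof.
move=> bg; have bK := bounded_mfun_kop K bg.
rewrite Vn_bounded//; [|by bmf|]; last first.
  by rewrite meanB// (mean_kop Krev)// subrr.
rewrite (sum_second_difference (b := autocov P K g)); last first.
  by move=> k; exact: autocov_coboundary.
move: (autocov P K g 0) (autocov P K g 1) (autocov P K g 2).
move: (autocov P K g n.+2) => b0 b1 b2 b3.
by field; rewrite addrC natr1 pnatr_eq0.
Qed.

Let Vn_coboundary_dist n g : bounded_mfun g ->
  `|Vn P K n.+1 (fun x => g x - kop K g x) -
    (autocov P K g 0 - autocov P K g 2)| <= n.+1%:R^-1 * (4 * sqn g).
Proof.
move=> bg; rewrite Vn_coboundary// addrAC subrr add0r normrN normrM.
rewrite ger0_norm ?invr_ge0 ?ler0n// ler_wpM2l ?invr_ge0 ?ler0n//.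
rewrite normrM ger0_norm//; have := autocov_le 1 bg.
have := autocov_le n.+2 bg; have := ler_normB (autocov P K g 1) (autocov P K g n.+2).
move: (autocov P K g 1) (autocov P K g n.+2) => b1 b2; lra.
Qed.

(** In the constant 6, 2 bounds the limit and 4 the boundary term left by telescoping. *)
Lemma Vn_coboundary_le n g : bounded_mfun g ->
  Vn P K n (fun x => g x - kop K g x) <= 6 * sqn g.
Proof.
move=> bg; case: n => [|n].
  by rewrite /Vn invr0 mul0r mulr_ge0.
have := Vn_coboundary_dist n bg; rewrite ler_norml => /andP[_].
have : n.+1%:R^-1 * (4 * sqn g) <= 1 * (4 * sqn g).
  by rewrite ler_wpM2r ?mulr_ge0// invf_le1 ?ltr0n// ler1n.
move: (n.+1%:R^-1 * (4 * sqn g)) => y; move: (Vn _ _ _ _) => v.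
have := ler_norm (autocov P K g 0); have := autocov_le 0 bg.
have := ler_norm (- autocov P K g 2); have := autocov_le 2 bg.
rewrite normrN; move: (autocov P K g 0) (autocov P K g 2) => b0 b2; lra.
Qed.

Lemma cvgn_Vn_coboundary g : bounded_mfun g ->
  cvgn (fun n => Vn P K n (fun x => g x - kop K g x)).
Proof.
move=> bg; apply/cvg_ex; exists (autocov P K g 0 - autocov P K g 2).
apply/cvgrPdist_le => e e0.
exists (Num.truncn (4 * sqn g / e)).+1 => // -[//|n] /= Nn.
rewrite distrC (le_trans (Vn_coboundary_dist n bg))//.
rewrite ler_pdivrMl ?ltr0n// -ler_pdivrMr// ltW//.
by apply: (lt_le_trans (truncnS_gt _)); rewrite ler_nat.
Qed.

(** 48 = 2 * 6 * 4: the splitting with [t = 1], the bound on coboundaries, and the bound on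
    [poisson]. *)
Let C := 48 / gam ^+ 2.

Let C_ge0 : 0 <= C.
Proof. by rewrite /C divr_ge0// exprn_ge0// ltW. Qed.

Lemma Vn_bounded_le n f : bounded_mfun f -> Vn P K n f <= C * sqn f.
Proof.
move=> bf; wlog f0 : f bf / mean P f = 0 => [wlg|].
  have bf0 : bounded_mfun (fun x => f x + - mean P f) by bmf.
  rewrite -(VnDc Krev n (- mean P f) (bounded_mfun_Lfun2 P bf)).
  apply: (le_trans (wlg _ bf0 _)).
    by rewrite meanD ?mean_cst ?subrr//; exact: bounded_mfun_cst.
  rewrite ler_wpM2l//.
  have -> : sqn (fun x => f x + - mean P f) =
      sqn (fun x => 1 * f x + (- mean P f) * 1).
    by congr (mean P); apply/funext => x; ring.
  rewrite (sqn_lin _ _ bf (bounded_mfun_cst 1)).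
  have -> : ip f (fun=> 1) = mean P f by apply: eq_mean => x; rewrite mulr1.
  have -> : sqn (fun=> 1) = 1.
    by rewrite -[RHS](mean_cst P); apply: eq_mean => x; rewrite expr1n.
  by have := sqr_ge0 (mean P f); lra.
have /andP[r0 r1] := rho_bnd.
(* The time [n] is fixed while [m] grows: the remainder [iter m lazy f], estimated with the loss of
   a factor [n], disappears in the limit. *)
apply: (@le_geometric R _ _ (2 * n%:R * sqn f) (rho ^+ 2)) => [|m].
  by rewrite sqr_ge0 expr_lt1// ltW.
have bi := bounded_iter_lazy m bf.
have bg := bounded_poisson m bf; have bKg := bounded_mfun_kop K bg.
have fE : f = (fun x => (poisson f m x - kop K (poisson f m) x) +
    iter m lazy f x).
  by apply/funext => x; rewrite poissonE// subrK.
have bw : bounded_mfun (fun x => poisson f m x - kop K (poisson f m) x) by bmf.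
rewrite {1}fE (le_trans (VnD_le Krev n ltr01 (bounded_mfun_Lfun2 P bw)
  (bounded_mfun_Lfun2 P bi)))//.
have := Vn_coboundary_le n bg; have := sqn_poisson m bf f0.
have := Vn_le Krev n (bounded_mfun_Lfun2 P bi); rewrite -/(sqn _).
have : n%:R * sqn (iter m lazy f) <= n%:R * ((rho ^+ 2) ^+ m * sqn f).
  by rewrite ler_wpM2l ?ler0n// sqn_iter_lazy.
rewrite invr1.
have -> : C * sqn f = 12 * (4 / gam ^+ 2 * sqn f).
  by rewrite /C; field; rewrite gt_eqF.
have -> : 2 * n%:R * sqn f * (rho ^+ 2) ^+ m =
  2 * (n%:R * ((rho ^+ 2) ^+ m * sqn f)) by ring.
lra.
Qed.

Lemma Vn_Lfun2_le n f : f \in Lfun P 2%:E ->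
  Vn P K n f <= 4 * C * sqn f.
Proof.
move=> lf; apply/ler_addgt0Pr => e e0.
(* The truncation may depend on [n], since only its error [r] does: the excess over the bound is
   [(4 * C + 2 * n%:R) * r]. *)
pose D := 4 * C + 2 * n%:R + 1.
have D0 : 0 < D.
  by rewrite /D ltr_wpDl// addr_ge0// mulr_ge0 ?ler0n.
have [u bu fu] := Lfun2_truncation lf (divr_gt0 e0 D0).
have lu := bounded_mfun_Lfun2 P bu; have lfu := Lfun2B lf lu.
have fE : f = (fun x => u x + (f x - u x)) by apply/funext => x; rewrite addrC subrK.
have := VnD_le Krev n ltr01 lu lfu; rewrite -fE invr1 => h1.
have := Vn_le Krev n lfu => h2.
have h3 := Vn_bounded_le n bu.
have h4 : sqn u <= 2 * sqn f + 2 * mean P (fun x => (f x - u x) ^+ 2).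
  have luf := Lfun2B lu lf.
  have := mean_sqrD_le lf luf.
  have -> : mean P (fun x => (f x + (u x - f x)) ^+ 2) = sqn u.
    by apply: eq_mean => x; rewrite addrC subrK.
  have -> // : mean P (fun x => (u x - f x) ^+ 2) =
    mean P (fun x => (f x - u x) ^+ 2).
  by apply: eq_mean => x; rewrite -sqrrN opprB.
set r := mean P (fun x => (f x - u x) ^+ 2) in fu h2 h4.
have r0 : 0 <= r by apply: mean_ge0 => x; exact: sqr_ge0.
have h5 : C * sqn u <= C * (2 * sqn f + 2 * r) by rewrite ler_wpM2l.
have h6 : D * r <= e by rewrite mulrC -ler_pdivlMr.
have h7 : D * r = 4 * (C * r) + 2 * (n%:R * r) + r by rewrite /D; ring.
have h8 : C * (2 * sqn f + 2 * r) = 2 * (C * sqn f) + 2 * (C * r) by ring.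
have h9 : 4 * C * sqn f = 4 * (C * sqn f) by ring.
lra.
Qed.

Lemma approx_coboundary f e : f \in Lfun P 2%:E -> 0 < e ->
  exists g c, bounded_mfun g /\
    sqn (fun x => f x - (g x - kop K g x + c)) <= e.
Proof.
move=> lf e0; have e40 : 0 < e / 4 by rewrite divr_gt0.
have [u bu fu] := Lfun2_truncation lf e40.
pose c := mean P u; pose u0 x := u x - c.
have bu0 : bounded_mfun u0 by rewrite /u0; bmf.
have u00 : mean P u0 = 0.
  rewrite /u0 meanB ?mean_cst ?subrr//; exact: bounded_mfun_cst.
have [m Hm] : exists m, sqn u0 * (rho ^+ 2) ^+ m <= e / 4.
  apply: contrapT => /forallNP H.
  have : e / 4 <= 0.
    apply: (@le_geometric R _ _ (sqn u0) (rho ^+ 2)) => [|m].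
      by have /andP[r0 r1] := rho_bnd; rewrite sqr_ge0 expr_lt1// ltW.
    by rewrite add0r ltW// ltNge; apply/negP; exact: H.
  by rewrite leNgt e40.
have bi := bounded_iter_lazy m bu0.
exists (poisson u0 m), c; split; first exact: bounded_poisson.
have -> : sqn (fun x => f x - (poisson u0 m x - kop K (poisson u0 m) x + c)) =
    mean P (fun x => ((f x - u x) + iter m lazy u0 x) ^+ 2).
  apply: eq_mean => x; rewrite poissonE//.
  by congr (_ ^+ 2); rewrite {1}/u0; ring.
apply: (le_trans (mean_sqrD_le (Lfun2B lf (bounded_mfun_Lfun2 P bu))
  (bounded_mfun_Lfun2 P bi))).
have := sqn_iter_lazy m bu0 u00; rewrite -/(sqn (iter m lazy u0)) mulrC.
lra.
Qed.

(** Convergence is known for coboundaries; the time-uniform bound [Vn_Lfun2_le], applied to the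
    remainder, keeps the scaled variances of [f] and of a nearby coboundary within [e] at all
    times. *)
Lemma cvgn_Vn f : f \in Lfun P 2%:E -> cvgn (fun n => Vn P K n f).
Proof.
move=> lf; apply: cvgn_approx => e e0.
pose A := 4 * C * sqn f.
have A0 : 0 <= A by rewrite /A mulr_ge0 ?sqn_ge0// mulr_ge0 ?C_ge0.
(* Both scaled variances will be at most [2 * A + 2], so a factor [1 + de] costs at most [e / 2];
   then [ep] is taken so small that the remainder, with its factor [1 + de^-1], costs at most
   [e / 2] as well. *)
pose de := e / (2 * (2 * A + 2)).
have A2 : 0 < 2 * A + 2 by lra.
have de0 : 0 < de by rewrite /de divr_gt0// mulr_gt0.
have deV : 0 < de^-1 by rewrite invr_gt0.
pose D := (1 + de^-1) * (4 * C + 1).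
have C1 : 0 < 4 * C + 1 by have := C_ge0; lra.
have D0 : 0 < D by rewrite /D mulr_gt0// addr_gt0.
pose ep := Num.min 1 (e / 2) / D.
have ep0 : 0 < ep by rewrite /ep divr_gt0// lt_min ltr01 divr_gt0.
have [g [c [bg Hr]]] := approx_coboundary lf ep0.
have bK := bounded_mfun_kop K bg.
have bw : bounded_mfun (fun x => g x - kop K g x) by bmf.
have bwc : bounded_mfun (fun x => g x - kop K g x + c) by bmf.
have lw := bounded_mfun_Lfun2 P bw; have lwc := bounded_mfun_Lfun2 P bwc.
set r := (fun x => f x - (g x - kop K g x + c)) in Hr.
have lr : r \in Lfun P 2%:E by exact: Lfun2B.
exists (fun n => Vn P K n (fun x => g x - kop K g x)).
  exact: cvgn_Vn_coboundary.
move=> n; rewrite -(VnDc Krev n c lw).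
have fE : f = (fun x => (g x - kop K g x + c) + r x).
  by apply/funext => x; rewrite /r addrC subrK.
have wE : (fun x => g x - kop K g x + c) = (fun x => f x + (- 1) * r x).
  by apply/funext => x; rewrite /r mulN1r subKr.
have lNr := Lfun2Z (-1) lr.
have Vf := Vn_Lfun2_le n lf; have Vr := Vn_Lfun2_le n lr.
have VNr : Vn P K n (fun x => (-1) * r x) = Vn P K n r.
  by rewrite VnZ// sqrrN expr1n mul1r.
have := VnD_le Krev n de0 lwc lr; rewrite -fE => h1.
have := VnD_le Krev n de0 lf lNr; rewrite -wE VNr => h2.
have := VnD_le Krev n ltr01 lf lNr; rewrite -wE VNr invr1 => h3.
set w := Vn P K n (fun x => g x - kop K g x + c) in h1 h2 h3 *.
set v := Vn P K n f in h1 h2 h3 Vf *; set z := Vn P K n r in h1 h2 h3 Vr.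
have z0 : 0 <= z by exact: Vn_ge0.
have zC : z <= (4 * C + 1) * ep.
  apply: (le_trans Vr); apply: (@le_trans _ _ (4 * C * ep)).
    by rewrite ler_wpM2l// mulr_ge0.
  by rewrite ler_wpM2r ?(ltW ep0)//; lra.
have zD : (1 + de^-1) * z <= Num.min 1 (e / 2).
  have -> : Num.min 1 (e / 2) = (1 + de^-1) * ((4 * C + 1) * ep).
    by rewrite /ep [RHS]mulrA -/D [RHS]mulrC divfK// gt_eqF.
  by rewrite ler_wpM2l// addr_ge0// ltW.
have m1 : Num.min 1 (e / 2) <= 1 by rewrite ge_min lexx.
have m2 : Num.min 1 (e / 2) <= e / 2 by rewrite ge_min lexx orbT.
have zd : 0 <= de^-1 * z by rewrite mulr_ge0// ltW.
have w2 : w <= 2 * A + 2 by move: Vf; rewrite -/A; lra.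
have v2 : v <= 2 * A + 2 by move: Vf; rewrite -/A; lra.
have de2 : de * (2 * A + 2) = e / 2 by rewrite /de; field; rewrite gt_eqF.
have dw : de * w <= de * (2 * A + 2) by rewrite ler_wpM2l// ltW.
have dv : de * v <= de * (2 * A + 2) by rewrite ler_wpM2l// ltW.
rewrite ler_norml; apply/andP; split; lra.
Qed.

Lemma gap_variance_bounding : variance_bounding P K.
Proof.
move=> f lf; have cv := cvgn_Vn lf.
have E : scaled_variance P K f = EFin \o (fun n => Vn P K n f).
  by apply/funext => n; exact: scaled_varianceE.
rewrite /asymptotic_variance E; split.
  apply/cvg_ex; exists (limn (fun n => Vn P K n f))%:E.
  by apply: cvg_EFin; [exact: nearW|exact: cv].
by rewrite EFin_lim// ltry.
Qed.

End gap_variance_bounding.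

(** * Gliding hump along sets of small conductance *)

Section limsup_bounds.
Context {R : realType}.
Implicit Types u : nat -> \bar R.

Lemma limn_esup_le u (c : \bar R) k : (forall n, (k <= n)%N -> u n <= c) ->
  limn_esup u <= c.
Proof.
move=> uc; rewrite limn_esup_lim; apply: lime_le; first exact: is_cvg_esups.
exists k => // n /= kn; apply: ge_ereal_sup => _ [m /= nm <-].
by apply: uc; exact: leq_trans nm.
Qed.

Lemma limn_esup_ge u (c : \bar R) k : (forall n, (k <= n)%N -> c <= u n) ->
  c <= limn_esup u.
Proof.
move=> uc; rewrite limn_esup_lim; apply: lime_ge; first exact: is_cvg_esups.
exists k => // n /= kn; apply: (le_trans (uc _ kn)); apply: ereal_sup_ubound.
by exists n => /=.
Qed.

End limsup_bounds.

Section slow_sets.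
Local Open Scope ring_scope.
Context {d : measure_display} {T : measurableType d} {R : realType}.
Variables (P : probability T R) (K : R.-pker T ~> T).
Hypothesis Krev : reversible_kernel P K.
Variables (B : set T) (mB : measurable B).

Let flow := mean P (fun x => \1_B x * kop K \1_(~` B) x).
Let p := mean P \1_B.
Let c k : T -> R := iter k (kop K) \1_(~` B).

Let bB : bounded_mfun (\1_B : T -> R).
Proof. exact: bounded_mfun_indic. Qed.

Let bc k : bounded_mfun (c k).
Proof. by apply: bounded_mfun_iter; apply: bounded_mfun_indic; exact: measurableC. Qed.

Let indicCE (x : T) : \1_(~` B) x = 1 - \1_B x :> R.
Proof. by rewrite !indicE in_setC; case: (x \in B); rewrite ?subrr ?subr0. Qed.

Let indic01 (A : set T) (x : T) : 0 <= (\1_A x : R) <= 1.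
Proof. by rewrite indicE; case: (x \in A); rewrite ?lexx ?ler01. Qed.

Let kop01 (f : T -> R) : bounded_mfun f -> (forall x, 0 <= f x <= 1) ->
  forall x, 0 <= kop K f x <= 1.
Proof.
move=> bf f01 x; rewrite kop_ge0/=; last by move=> y; have /andP[] := f01 y.
rewrite -(kop_cst K 1 x); apply: mean_le => //; first exact: bounded_mfun_cst.
by move=> y; have /andP[] := f01 y.
Qed.

Let c01 k x : 0 <= c k x <= 1.
Proof.
elim: k x => [|k IH] x; first exact: indic01.
by apply: kop01 => //; exact: bc.
Qed.

(** Reversibility turns the mean for [k.+1] into that of [c k * kop K \1_B]. On [B] this is at most
    [c k], which gives the mean for [k]; off [B] it is at most [kop K \1_B], whose integral there is
    one more [flow]. *)
Let escape_le k : mean P (fun x => \1_B x * c k x) <= k%:R * flow.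
Proof.
have bK := bounded_mfun_kop K bB.
elim: k => [|k IH].
  rewrite mul0r -(mean_cst P 0) le_eqVlt; apply/orP; left; apply/eqP.
  by apply: eq_mean => x; rewrite /c/= indicCE indicE; case: (_ \in _);
    rewrite ?mul0r// subrr mulr0.
have -> : mean P (fun x => \1_B x * c k.+1 x) =
    mean P (fun x => c k x * kop K \1_B x) by exact: reversible_kop.
have flowE : flow = mean P (fun x => \1_(~` B) x * kop K \1_B x).
  by apply: (reversible_kop Krev bB (bc 0)).
apply: (@le_trans _ _ (mean P (fun x => \1_B x * c k x +
    \1_(~` B) x * kop K \1_B x))).
  have bc0 := bc 0; have bck := bc k.
  apply: mean_le; [by bmf| |move=> x].
    by apply: bounded_mfunD; [bmf|apply: (bounded_mfunM bc0 bK)].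
  have /andP[k0 k1] := kop01 bB (indic01 B) x; have /andP[c0 c1] := c01 k x.
  rewrite indicCE indicE; case: (_ \in _) => /=.
    by rewrite subrr mul0r addr0 mul1r ler_piMr.
  by rewrite mul0r add0r subr0 mul1r ler_piMl.
rewrite meanD; [|exact: (bounded_mfunM bB (bc k))|exact: (bounded_mfunM (bc 0) bK)].
by rewrite -flowE -natr1 mulrDl mul1r lerD2r.
Qed.

(** The autocovariance is [p * (1 - p)] minus the mass escaped after [k] steps, and [1 - p] is at
    least 1/2. *)
Lemma autocov_indic_ge k : p <= 2^-1 ->
  p / 2 - k%:R * flow <= autocov P K (fun x => \1_B x - p) k.
Proof.
move=> p2; have bck := bc k.
have iE j x : iter j (kop K) (fun x => \1_B x - p) x = (1 - p) - c j x.
  elim: j x => [|j IH] x; first by rewrite /c/= indicCE; ring.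
  have -> : iter j.+1 (kop K) (fun x => \1_B x - p) x =
      kop K (fun y => (1 - p) - c j y) x.
    by congr (kop K _ x); apply/funext => y; exact: IH.
  by rewrite kopB ?kop_cst//; exact: bounded_mfun_cst.
rewrite /autocov.
have -> : mean P (fun x => (\1_B x - p) * iter k (kop K) (fun x => \1_B x - p) x) =
    (1 - p) * p - mean P (fun x => \1_B x * c k x) - p * (1 - p) +
    p * mean P (c k).
  have E1 : (1 - p) * p = mean P (fun x => (1 - p) * \1_B x) by rewrite meanZ.
  have E2 : p * mean P (c k) = mean P (fun x => p * c k x) by rewrite meanZ.
  rewrite E1 E2 -(mean_cst P (p * (1 - p))).
  rewrite -!meanB; [|by bmf..].
  by rewrite -meanD; [|by bmf..]; apply: eq_mean => x; rewrite iE; ring.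
have -> : mean P (c k) = 1 - p.
  rewrite /c mean_iter//; last exact: (bc 0).
  rewrite -(mean_cst P 1) -meanB//; last exact: bounded_mfun_cst.
  by apply: eq_mean => x; rewrite indicCE.
have := escape_le k.
have p0 : 0 <= p by apply: mean_ge0 => x; have /andP[] := indic01 B x.
nra.
Qed.

(** Up to lag [n] the escaped mass stays below [p / 4], so each of the [n ^+ 2] covariances in the
    variance of the path sum is at least [p / 4]. *)
Lemma Vn_indic_ge n : p <= 2^-1 -> n%:R * flow <= p / 4 ->
  n%:R * (p / 4) <= Vn P K n \1_B.
Proof.
move=> p2 nf; case: n nf => [|n] nf; first by rewrite mul0r Vn_ge0.
have p0 : 0 <= p by apply: mean_ge0 => x; have /andP[] := indic01 B x.
have flow0 : 0 <= flow.
  apply: mean_ge0 => x; apply: mulr_ge0; first by have /andP[] := indic01 B x.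
  by apply: kop_ge0 => y; have /andP[] := indic01 (~` B) y.
rewrite -(VnDc Krev n.+1 (- p) (bounded_mfun_Lfun2 P bB)).
have bf : bounded_mfun (fun x => \1_B x - p) by bmf.
rewrite Vn_bounded//; last first.
  by rewrite meanB ?mean_cst ?subrr//; exact: bounded_mfun_cst.
have cge k : (k <= n.+1)%N -> p / 4 <= autocov P K (fun x => \1_B x - p) k.
  move=> kn; apply: le_trans (autocov_indic_ge k p2).
  have : k%:R * flow <= n.+1%:R * flow by rewrite ler_wpM2r// ler_nat.
  lra.
have sums N : (N <= n.+1)%N -> N%:R ^+ 2 * (p / 4) <=
    \sum_(m < N) (autocov P K (fun x => \1_B x - p) 0 +
    2 * \sum_(k < m) autocov P K (fun x => \1_B x - p) k.+1).
  elim: N => [|N IH] Nn; first by rewrite big_ord0 expr0n mul0r.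
  rewrite big_ord_recr/=.
  have -> : N.+1%:R ^+ 2 * (p / 4) = N%:R ^+ 2 * (p / 4) +
      (p / 4 + 2 * (N%:R * (p / 4))) by rewrite -natr1; ring.
  apply: lerD; first exact/IH/ltnW.
  apply: lerD; first exact: cge.
  rewrite ler_pM2l// mulr_natl -[N in _ *+ N]card_ord -sumr_const.
  by apply: ler_sum => k _; apply: cge; exact: (leq_trans (ltn_ord k) (ltnW Nn)).
have := sums n.+1 (leqnn _).
set S := \sum_(m < n.+1) _ => h.
by rewrite ler_pdivlMl ?ltr0n//; move: h; rewrite expr2 -(mulrA n.+1%:R).
Qed.

End slow_sets.

Section gliding_hump.
Local Open Scope ring_scope.
Context {d : measure_display} {T : measurableType d} {R : realType}.
Variables (P : probability T R) (K : R.-pker T ~> T).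
Hypothesis Krev : reversible_kernel P K.
Variables (n : nat -> nat) (f : nat -> T -> R).
Hypothesis bf : forall j, bounded_mfun (f j).
Hypothesis sf : forall j, mean P (fun x => f j x ^+ 2) <= 1.
Hypothesis Vf : forall j, (n j)%:R / 4 <= Vn P K (n j) (f j).

Let sqr_normr (x : R) : `|x| ^+ 2 = x ^+ 2.
Proof. exact/real_normK/num_real. Qed.

(** With ratio 1/5 the amplitudes after index [k] sum to [a k / 4], small enough for later humps not
    to undo hump [k]. *)
Let a j : R := 5^-1 ^+ j.

Let a0 j : 0 < a j.
Proof. by rewrite exprn_gt0// invr_gt0. Qed.

Let aS j : a j.+1 = a j / 5.
Proof. by rewrite /a exprS mulrC. Qed.

(* The sign is chosen so that the new summand is not cancelled by the old ones
   at time [n k]. *)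
Fixpoint hump k : T -> R :=
  if k is k'.+1 then
    let s : R := if Vn P K (n k') (fun x => hump k' x + a k' * f k' x) >=
                    a k' ^+ 2 * Vn P K (n k') (f k') then 1 else -1 in
    fun x => hump k' x + s * a k' * f k' x
  else fun=> 0.

Lemma bounded_mfun_hump k : bounded_mfun (hump k).
Proof.
elim: k => [|k IH]; first exact: bounded_mfun_cst.
by rewrite /=; bmf.
Qed.

(** Parallelogram law: the scaled variances for the two signs add up to at least twice that of
    [a k * f k], so if the sign 1 falls short, the sign -1 does not. *)
Lemma Vn_hump k :
  a k ^+ 2 * ((n k)%:R / 4) <= Vn P K (n k) (hump k.+1).
Proof.
apply: (@le_trans _ _ (a k ^+ 2 * Vn P K (n k) (f k))).
  by rewrite ler_wpM2l ?sqr_ge0.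
rewrite /=; case: ifPn => [H|].
  by rewrite (_ : (fun x => _) = (fun x => hump k x + a k * f k x))//;
    apply/funext => x; rewrite mul1r.
rewrite -ltNge => H.
have lh := bounded_mfun_Lfun2 P (bounded_mfun_hump k).
have lf := bounded_mfun_Lfun2 P (bf k).
rewrite (_ : (fun x => _) = (fun x => 1 * hump k x + (- a k) * f k x)); last first.
  by apply/funext => x; rewrite mul1r mulN1r.
move: H; rewrite (_ : (fun x => _) = (fun x => 1 * hump k x + a k * f k x)); last first.
  by apply/funext => x; rewrite mul1r.
rewrite !Vn_lin//; have := Vn_ge0 P K (n k) (hump k).
move: (Vn _ _ _ (hump k)) (Cn _ _ _ _ _) (Vn _ _ _ (f k)) => v c w v0.
by rewrite sqrrN; nra.
Qed.

Let sum_a k m : \sum_(i < m) a (k + i) = 5 / 4 * (a k - a (k + m)).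
Proof.
elim: m => [|m IH]; first by rewrite big_ord0 addn0 subrr mulr0.
by rewrite big_ord_recr/= IH addnS aS; field.
Qed.

Let sum_a_le k m : \sum_(i < m) a (k + i) <= 5 / 4 * a k.
Proof. by rewrite sum_a ler_wpM2l// gerBl ltW. Qed.

(** Cauchy-Schwarz with weights [a] replaces the triangle inequality of L^2: the bound holds at each
    point and involves only squares of the [f j], whose means are controlled. *)
Let hump_dist k m x :
  (hump (k + m) x - hump k x) ^+ 2 <=
  5 / 4 * a k * \sum_(i < m) a (k + i) * f (k + i) x ^+ 2.
Proof.
have H : `|hump (k + m) x - hump k x| <= \sum_(i < m) a (k + i) * `|f (k + i) x|.
  elim: m => [|m IH]; first by rewrite big_ord0 addn0 subrr normr0.
  rewrite big_ord_recr/= addnS /=.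
  rewrite addrAC (le_trans (ler_normD _ _))// lerD// !normrM.
  rewrite (gtr0_norm (a0 _)); case: ifP => _; rewrite ?normrN normr1 mul1r//.
rewrite -sqr_normr.
have S0 : 0 <= \sum_(i < m) a (k + i) * `|f (k + i) x|.
  by apply: sumr_ge0 => i _; rewrite mulr_ge0// ltW.
apply: (@le_trans _ _ ((\sum_(i < m) a (k + i) * `|f (k + i) x|) ^+ 2)).
  by rewrite ler_sqr ?nnegrE.
apply: (le_trans (weighted_cauchy_schwarz (index_enum 'I_m)
  (fun i : 'I_m => `|f (k + i) x|) (fun i : 'I_m => ltW (a0 (k + i))))).
under [X in _ * X <= _]eq_bigr do rewrite sqr_normr.
apply: ler_wpM2r; last exact: sum_a_le.
by apply: sumr_ge0 => i _; rewrite mulr_ge0 ?sqr_ge0// ltW.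
Qed.

(** A majorant of the tail, integrable term by term. Where it is finite, [hump N x] stays close to
    [hump k x] for [N >= k], so the limit is built pointwise, without completeness of L^2. *)
Let G k x : \bar R := (\sum_(i <oo) (a (k + i) * f (k + i) x ^+ 2)%:E)%E.

Let G_ge k m x : ((\sum_(i < m) a (k + i) * f (k + i) x ^+ 2)%:E <= G k x)%E.
Proof.
rewrite /G -sumEFin -(big_mkord xpredT (fun i => (a (k + i) * f (k + i) x ^+ 2)%:E)).
by apply: nneseries_lim_ge => i _ _; rewrite lee_fin mulr_ge0 ?sqr_ge0// ltW.
Qed.

Let int_G k : (\int[P]_x G k x <= (5 / 4 * a k)%:E)%E.
Proof.
have mf2 i : measurable_fun setT (fun x => (f i x ^+ 2)%:E).
  by apply/measurable_EFinP; case: (bounded_mfunX 2 (bf i)).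
rewrite integral_nneseries//; last 2 first.
- by move=> i; apply/measurable_EFinP/measurable_funM => //;
    case: (bounded_mfunX 2 (bf (k + i))).
- by move=> i x _; rewrite lee_fin mulr_ge0 ?sqr_ge0// ltW.
apply: lime_le.
  by apply: is_cvg_nneseries => i _ _; apply: integral_ge0 => x _;
    rewrite lee_fin mulr_ge0 ?sqr_ge0// ltW.
apply: nearW => m; apply: (@le_trans _ _ (\sum_(i < m) a (k + i))%:E); last first.
  by rewrite lee_fin.
rewrite big_mkord -sumEFin lee_sum// => i _.
rewrite (meanE P (bounded_mfunZ (a (k + i)) (bounded_mfunX 2 (bf (k + i))))).
rewrite lee_fin meanZ; last exact: bounded_mfunX.
by rewrite ler_piMr// ltW.
Qed.

Let measurable_G k : measurable_fun setT (G k).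
Proof.
apply: ge0_emeasurable_sum => [i x _ _|i _].
  by rewrite lee_fin mulr_ge0 ?sqr_ge0// ltW.
apply/measurable_EFinP/measurable_funM => //.
by case: (bounded_mfunX 2 (bf (k + i))).
Qed.

(* [fine] is junk only where [hump] is unbounded, hence where [G k] is [+oo]. *)
Definition hump_limit x : R := fine (limn_esup (fun N => (hump N x)%:E)).

Lemma measurable_hump_limit : measurable_fun setT hump_limit.
Proof.
apply: measurableT_comp => //; apply: measurable_fun_limn_esup => N.
by apply/measurable_EFinP; case: (bounded_mfun_hump N).
Qed.

Let hump_limit_dist k x :
  (((hump_limit x - hump k x) ^+ 2)%:E <= (5 / 4 * a k)%:E * G k x)%E.
Proof.
have c0 : 0 < 5 / 4 * a k by rewrite mulr_gt0.
have [->|Gfin] := eqVneq (G k x) +oo%E; first by rewrite gt0_muley ?leey ?lte_fin.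
have G0 : (0 <= G k x)%E.
  by apply: nneseries_ge0 => i _ _; rewrite lee_fin mulr_ge0 ?sqr_ge0// ltW.
have /fineK <- : G k x \is a fin_num by rewrite ge0_fin_numE// ltey.
set r := fine (G k x); rewrite -EFinM lee_fin.
have r0 : 0 <= r by exact: fine_ge0.
pose b := Num.sqrt (5 / 4 * a k * r).
have bE : b ^+ 2 = 5 / 4 * a k * r by rewrite sqr_sqrtr// mulr_ge0// ltW.
have b0 : 0 <= b by exact: sqrtr_ge0.
have near_k N : (k <= N)%N -> `|hump N x - hump k x| <= b.
  move=> kN; rewrite -(ler_sqr (normr_ge0 _) b0) sqr_normr bE -(subnKC kN).
  apply: (le_trans (hump_dist k (N - k) x)); rewrite ler_wpM2l ?(ltW c0)//.
  rewrite -lee_fin; apply: (le_trans (G_ge _ _ _)).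
  by rewrite fineK// ge0_fin_numE// ltey.
set L := limn_esup (fun N => (hump N x)%:E).
have Lle : (L <= (hump k x + b)%:E)%E.
  apply: (@limn_esup_le _ _ _ k) => N /near_k; rewrite lee_fin ler_norml.
  by move=> /andP[_]; lra.
have Lge : ((hump k x - b)%:E <= L)%E.
  apply: (@limn_esup_ge _ _ _ k) => N /near_k; rewrite lee_fin ler_norml.
  by move=> /andP[+ _]; lra.
have Lfin : L \is a fin_num.
  by rewrite fin_numE; apply/andP; split; apply/eqP => LE;
    [move: Lge; rewrite LE leeNy_eq|move: Lle; rewrite LE leye_eq].
rewrite -bE -sqr_normr ler_sqr ?nnegrE// /hump_limit -/L.
move: Lle Lge; rewrite -(fineK Lfin) !lee_fin /= => h1 h2.
by rewrite ler_norml; apply/andP; split; lra.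
Qed.

Let hump_limit_sqr k :
  (\int[P]_x ((hump_limit x - hump k x) ^+ 2)%:E <= ((5 / 4 * a k) ^+ 2)%:E)%E.
Proof.
have c0 : 0 < 5 / 4 * a k by rewrite mulr_gt0.
have mh := measurable_hump_limit.
have mk : measurable_fun setT (hump k) by case: (bounded_mfun_hump k).
apply: (@le_trans _ _ (\int[P]_x ((5 / 4 * a k)%:E * G k x))%E).
  apply: ge0_le_integral => //.
  - by move=> x _; rewrite lee_fin sqr_ge0.
  - by apply/measurable_EFinP/measurable_funX; exact: measurable_funB.
  - exact: measurable_funeM.
rewrite ge0_integralZl_EFin// ?(ltW c0)//; last first.
  by move=> x _; apply: nneseries_ge0 => i _ _;
    rewrite lee_fin mulr_ge0 ?sqr_ge0// ltW.
by rewrite expr2 [leRHS]EFinM lee_wpmul2l// lee_fin ltW.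
Qed.

Lemma hump_limit_Lfun2 : hump_limit \in Lfun P 2%:E.
Proof.
apply/Lfun2P; split; first exact: measurable_hump_limit.
have := hump_limit_sqr 0; under eq_integral do rewrite subr0.
by move=> /le_lt_trans; apply; rewrite ltry.
Qed.

(** Write X for the left-hand side: the partial sum through hump [k] has scaled variance at least 4
    X and the tail at most X, so that [VnD_le] with [t = 1] leaves at least X for the limit. *)
Lemma Vn_hump_limit_ge k :
  (n k)%:R * a k ^+ 2 / 16 <= Vn P K (n k) hump_limit.
Proof.
have lh := hump_limit_Lfun2.
have lk := bounded_mfun_Lfun2 P (bounded_mfun_hump k.+1).
have lB := Lfun2B lh lk.
have := VnD_le Krev (n k) ltr01 lh (Lfun2Z (-1) lB).
rewrite (_ : (fun x => _ + _) = hump k.+1); last first.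
  by apply/funext => x; rewrite mulN1r subKr.
rewrite VnZ// sqrrN expr1n mul1r.
have Hk := Vn_hump k; have := Vn_le Krev (n k) lB.
have := hump_limit_sqr k.+1; rewrite Lfun2_meanE// lee_fin aS invr1.
set s := mean _ _ => hs.
have : (n k)%:R * s <= (n k)%:R * (5 / 4 * (a k / 5)) ^+ 2 by rewrite ler_wpM2l.
have -> : (n k)%:R * (5 / 4 * (a k / 5)) ^+ 2 = (n k)%:R * a k ^+ 2 / 16 by field.
move: Hk; have -> : a k ^+ 2 * ((n k)%:R / 4) = 4 * ((n k)%:R * a k ^+ 2 / 16) by field.
lra.
Qed.

End gliding_hump.

(** * Variance bounding and conductance *)

Section conductance.
Local Open Scope ring_scope.
Context {d : measure_display} {T : measurableType d} {R : realType}.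
Variables (P : probability T R) (K : R.-pker T ~> T).
Hypothesis Krev : reversible_kernel P K.

Definition conductance_ge (kap : R) : Prop := forall B : set T,
  measurable B -> mean P \1_B <= 2^-1 ->
  kap * mean P \1_B <= mean P (fun x => \1_B x * kop K \1_(~` B) x).

Lemma conductance_variance_bounding kap : 0 < kap -> conductance_ge kap ->
  variance_bounding P K.
Proof.
move=> kap0 cond.
have k8 : 0 < kap ^+ 2 / 8 by rewrite divr_gt0// exprn_gt0.
apply: (@gap_variance_bounding _ _ _ P K Krev (Num.min 1 (kap ^+ 2 / 8))).
- by rewrite lt_min ltr01.
- by rewrite ge_min lexx.
- move=> f bf f0; have := poincare Krev kap0 cond bf.
  rewrite f0 expr0n subr0 => H.
  apply: (@le_trans _ _ (kap ^+ 2 / 8 * mean P (fun x => f x ^+ 2))).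
    rewrite ler_wpM2r//; first by apply: mean_ge0 => x; exact: sqr_ge0.
    by rewrite ge_min lexx orbT.
  by rewrite mulrAC ler_pdivrMr// [leRHS]mulrC.
Qed.

Lemma variance_bounding_conductance : variance_bounding P K ->
  exists2 kap, 0 < kap & conductance_ge kap.
Proof.
move=> VB; apply: contrapT => noK.
(* 50 is twice the square of 5: against the squared amplitudes [25^-1 ^+ j] these times leave
   [2 ^+ j], which diverges. *)
pose n j : nat := (50 ^ j)%N.
have n0 j : 0 < (n j)%:R :> R by rewrite ltr0n expn_gt0.
pose flow (B : set T) := mean P (fun x => \1_B x * kop K \1_(~` B) x).
have indic0 (A : set T) x : 0 <= (\1_A x : R) by rewrite indicE ler0n.
have flow0 B : 0 <= flow B.
  by apply: mean_ge0 => x; apply: mulr_ge0 => //; exact: kop_ge0.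
have /choice[B HB] : forall j, exists B : set T, [/\ measurable B,
    mean P \1_B <= 2^-1, 0 < mean P \1_B &
    (n j)%:R * flow B <= mean P \1_B / 4].
  move=> j; apply: contrapT => noB; apply: noK.
  exists ((n j)%:R * 4)^-1; first by rewrite invr_gt0 mulr_gt0.
  move=> B mB B2; rewrite leNgt; apply/negP => fB; apply: noB; exists B.
  split => //.
    have : 0 < ((n j)%:R * 4)^-1 * mean P \1_B := le_lt_trans (flow0 B) fB.
    by rewrite pmulr_rgt0// invr_gt0 mulr_gt0.
  move: fB; rewrite -/(flow B) ltr_pdivlMl ?mulr_gt0// => /ltW.
  by rewrite ler_pdivlMr// mulrAC.
pose p j := mean P \1_(B j).
pose f j (x : T) : R := (Num.sqrt (p j))^-1 * \1_(B j) x.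
have bB j : bounded_mfun (\1_(B j) : T -> R).
  by apply: bounded_mfun_indic; have [] := HB j.
have bf j : bounded_mfun (f j) by exact: bounded_mfunZ.
have p0 j : 0 < p j by have [] := HB j.
have sqrp j : (Num.sqrt (p j))^-1 ^+ 2 = (p j)^-1.
  by rewrite exprVn sqr_sqrtr// ltW.
have sf j : mean P (fun x => f j x ^+ 2) <= 1.
  under eq_mean do rewrite exprMn sqrp.
  rewrite meanZ; last exact: bounded_mfunX.
  have -> : mean P (fun x => \1_(B j) x ^+ 2) = p j.
    by apply: eq_mean => x; rewrite indicE; case: (_ \in _); rewrite ?expr1n ?expr0n.
  by rewrite mulVf// gt_eqF.
have Vf j : (n j)%:R / 4 <= Vn P K (n j) (f j).
  have [mB B2 _ nB] := HB j.
  rewrite VnZ ?bounded_mfun_Lfun2// sqrp ler_pdivlMl//.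
  apply: le_trans (Vn_indic_ge Krev mB B2 nB).
  by rewrite le_eqVlt; apply/orP; left; apply/eqP; rewrite -/(p j); ring.
set h := hump_limit P K n f.
have lh : h \in Lfun P 2%:E by exact: hump_limit_Lfun2.
have Vh j : 2 ^+ j / 16 <= Vn P K (n j) h.
  have := Vn_hump_limit_ge Krev bf sf Vf j; rewrite -/h.
  suff -> : (n j)%:R * (5^-1 ^+ j) ^+ 2 = 2 ^+ j :> R by [].
  rewrite /n natrX exprAC -exprMn; congr (_ ^+ j).
  by field.
have [cv limh] := VB h lh.
have E : scaled_variance P K h = EFin \o (fun n => Vn P K n h).
  by apply/funext => k; exact: scaled_varianceE.
move: cv limh; rewrite /asymptotic_variance E => cv limh.
set L := limn _ in limh.
have [M LM] : exists M : R, (L < M%:E)%E.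
  case: (L) limh => [r _|//|_]; last by exists 0; rewrite ltNyr.
  by exists (r + 1); rewrite lte_fin ltrDl.
have [N _ NM] := cv _ (open_ereal_lt' LM).
pose k := maxn N (Num.truncn (16 * M)).+1.
have kn : (k < n k)%N by rewrite ltn_expl.
have := NM (n k) (ltnW (leq_ltn_trans (leq_maxl _ _) kn)) => /=.
rewrite lte_fin => VM.
have := Vh k; rewrite leNgt => /negP; apply; apply: (lt_le_trans VM).
rewrite ler_pdivlMr// mulrC ltW//.
apply: (lt_le_trans (truncnS_gt _)).
apply: (@le_trans _ _ k%:R); first by rewrite ler_nat leq_maxr.
by rewrite -natrX ler_nat ltnW// ltn_expl.
Qed.

End conductance.

(** * Accept-reject kernels *)

(** Suprema over simple functions are compared directly, so that this applies to the complement of a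
    ball, whose measurability is not established. *)
Lemma ge0_integral_subset {d} {T : measurableType d} {R : realType}
    (mu : {measure set T -> \bar R}) (A B : set T) (f : T -> \bar R) :
  A `<=` B -> (forall x, 0 <= f x) ->
  \int[mu]_(x in A) f x <= \int[mu]_(x in B) f x.
Proof.
move=> AB f0; rewrite !ge0_integralE//; apply: ereal_sup_le => _ [h hf <-].
exists h => // x; apply: (le_trans (hf x)); rewrite !patchE.
by case: ifPn => [/set_mem/AB/mem_set -> //|_]; case: ifP.
Qed.

Section measurable_acceptance.
Local Open Scope ring_scope.
Context {d : measure_display} {T : measurableType d} {R : realType}.
Implicit Types a b : T -> R.

(** Reduces to the power -1 of the nonnegative [a x ^+ 2]; at [a x = 0] both expressions are 0. *)
Lemma measurable_funV a : measurable_fun setT a ->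
  measurable_fun setT (fun x => (a x)^-1).
Proof.
move=> ma; rewrite (_ : (fun _ => _) = fun x => a x * (a x ^+ 2) `^ (-1)).
  apply: measurable_funM => //; apply: (measurableT_comp (measurable_powR _)).
  exact: measurable_funX.
apply/funext => x; rewrite powR_inv1 ?sqr_ge0//.
by have [->|ax] := eqVneq (a x) 0; [rewrite invr0 mul0r|field].
Qed.

Lemma measurable_acceptance_ratio a b :
  measurable_fun setT a -> measurable_fun setT b ->
  measurable_fun setT (fun x => acceptance_ratio (a x) (b x)).
Proof.
move=> ma mb; apply: measurable_fun_ifT => //.
- by apply: measurable_fun_eqr => //; exact: measurable_cst.
- by apply: measurable_funM => //; exact: measurable_funV.
Qed.

End measurable_acceptance.

Lemma acceptance_ratio_ge0 {R : realType} (a b : R) :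
  (0 <= a -> 0 <= b -> 0 <= acceptance_ratio a b)%R.
Proof.
move=> a0 b0; rewrite /acceptance_ratio; case: ifP => // _.
by rewrite divr_ge0.
Qed.

(** The symmetry of the right-hand side is detailed balance. If [b = 0], the conventional ratio is
    multiplied by 0, and the minimum of 0 and [a >= 0] is 0. *)
Lemma acceptance_ratio_min {R : realType} (a b : R) :
  (0 <= a -> 0 <= b -> b * Num.min 1 (acceptance_ratio a b) = Num.min b a)%R.
Proof.
move=> a0 b0; rewrite /acceptance_ratio; case: eqP => [->|/eqP bn].
  by rewrite mul0r min_l.
by rewrite minr_pMr// mulr1 mulrC divfK.
Qed.

Section metropolis_hastings_kernels.
Context {R : realType} {n : nat} {X : lebesgue_domain R n}.
Local Notation S := (state X).
Local Notation lam := (lebesgue_state X).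
Variables (Pi : probability S R) (pi : S -> R) (q : S -> S -> R).
Hypothesis Pi_density : is_density Pi pi.
Hypothesis q_density : is_proposal_density q.

Let mpi : measurable_fun setT pi. Proof. by case: Pi_density. Qed.
Let pi0 x : (0 <= pi x)%R. Proof. by case: Pi_density. Qed.
Let mq : measurable_fun [set: S * S] (fun z => q z.1 z.2).
Proof. by case: q_density. Qed.
Let q0 x y : (0 <= q x y)%R. Proof. by case: q_density. Qed.

Lemma integral_density_set (B : set S) (g : S -> \bar R) : measurable B ->
  (forall x, 0 <= g x) -> measurable_fun setT g ->
  \int[Pi]_(x in B) g x = \int[lam]_(x in B) ((pi x)%:E * g x).
Proof.
move=> mB g0 mg; case: Pi_density => _ _ PiE.
rewrite integral_mkcond (integral_density (l := lam) pi0 mpi)//.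
- rewrite [RHS]integral_mkcond; apply: eq_integral => x _; rewrite !patchE.
  by case: ifP => // _; rewrite mule0.
- by move=> x; rewrite patchE; case: ifP.
- by apply/(measurable_restrictT _ mB); exact: measurable_funTS.
Qed.

Lemma ae_density_gt0 : {ae Pi, forall x, (0 < pi x)%R}.
Proof.
case: Pi_density => _ _ PiE.
have mZ : measurable [set x | pi x = 0%R].
  rewrite -[X in measurable X]setTI.
  exact: (mpi measurableT (measurable_set1 (0%R : R))).
exists [set x | pi x = 0%R]; split => //.
  by rewrite PiE// integral0_eq// => x /= ->.
by move=> x /= /negP; rewrite -leNgt => h; apply/eqP; rewrite eq_le h pi0.
Qed.

Section reversibility.
Variables (K : R.-pker S ~> S) (a m : S -> S -> R).
Hypothesis K_ar : is_accept_reject_kernel q a K.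
Hypothesis mm : measurable_fun [set: S * S] (fun z => m z.1 z.2).
Hypothesis m0 : forall x y, (0 <= m x y)%R.
Hypothesis msym : forall x y, m x y = m y x.
Hypothesis m_null : forall x y, pi y = 0%R -> m x y = 0%R.
Hypothesis mE : {ae Pi, forall x, forall y, (pi x * (q x y * a x y))%R = m x y}.

(* Off the diagonal [K x] has density [k x] with respect to [Pi] itself, so that
   Tonelli applies without sigma-finiteness of [lam]; the junk value 0 at
   [pi x * pi y = 0] is harmless by [m_null]. *)
Let k x y := (m x y / (pi x * pi y))%R.

Let k0 x y : (0 <= k x y)%R.
Proof. by rewrite divr_ge0// mulr_ge0. Qed.

Let mk : measurable_fun [set: S * S] (fun z => k z.1 z.2).
Proof.
apply: measurable_funM => //; apply: measurable_funV; apply: measurable_funM.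
- exact: measurableT_comp mpi measurable_fst.
- exact: measurableT_comp mpi measurable_snd.
Qed.

(** The rejection atom at [x] does not charge a set that avoids [x]. *)
Lemma accept_reject_off_diagonal : {ae Pi, forall x, forall B, measurable B ->
  ~ B x -> K x B = \int[Pi]_(y in B) (k x y)%:E}.
Proof.
apply: filterS2 ae_density_gt0 mE => x px mEx B mB nBx.
rewrite K_ar// diracE memNset// mule0 adde0 integral_density_set//; last 2 first.
- by move=> y; rewrite lee_fin.
- apply/measurable_EFinP.
  exact: measurableT_comp mk (pair1_measurable x).
apply: eq_integral => y _; rewrite -EFinM; congr (_%:E).
have -> : (q x y * a x y = m x y / pi x)%R.
  by rewrite -mEx mulrAC mulfV ?mul1r// gt_eqF.
rewrite /k; have [py|py] := eqVneq (pi y) 0%R.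
  by rewrite m_null// !mul0r mulr0.
by field; rewrite py gt_eqF.
Qed.

Let flow A B := \int[Pi]_(x in A) K x B.

Let flow_disjointE A B : measurable A -> measurable B -> A `&` B = set0 ->
  flow A B = \int[Pi]_x \int[Pi]_y ((\1_A x * \1_B y * k x y)%R)%:E.
Proof.
move=> mA mB AB; rewrite /flow integral_mkcond.
have m1A : measurable_fun setT (\1_A : S -> R) by exact: measurable_indic.
have m1B : measurable_fun setT (\1_B : S -> R) by exact: measurable_indic.
have mf : measurable_fun [set: S * S]
    (fun z => ((\1_A z.1 * \1_B z.2 * k z.1 z.2)%R)%:E).
  apply/measurable_EFinP; apply: measurable_funM => //; apply: measurable_funM.
  - exact: measurableT_comp m1A measurable_fst.
  - exact: measurableT_comp m1B measurable_snd.
have f0 z : 0 <= ((\1_A z.1 * \1_B z.2 * k z.1 z.2)%R)%:E.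
  by rewrite lee_fin; apply: mulr_ge0; [apply: mulr_ge0; rewrite indicE ler0n|].
apply: ge0_ae_eq_integral => //.
- apply/(measurable_restrictT _ mA); apply: measurable_funTS.
  exact: measurable_kernel.
- exact: (measurable_fun_fubini_tonelli_F (m2 := Pi) _ mf f0).
- by move=> x _; rewrite patchE; case: ifP.
- by move=> x _; apply: integral_ge0 => y _; exact: (f0 (x, y)).
apply: filterS accept_reject_off_diagonal => x Kx _; rewrite patchE.
case: ifPn => [/set_mem Ax|nA].
  rewrite Kx//; last by move=> Bx; have : (A `&` B) x by []; rewrite AB.
  rewrite integral_mkcond; apply: eq_integral => y _; rewrite epatch_indic.
  by rewrite indicE mem_set//= mul1r mulrC EFinM.
by rewrite integral0_eq// => y _; rewrite indicE (negbTE nA) !mul0r.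
Qed.

Let flow_disjointC A B : measurable A -> measurable B -> A `&` B = set0 ->
  flow A B = flow B A.
Proof.
move=> mA mB AB; rewrite (flow_disjointE mA mB AB).
rewrite (flow_disjointE mB mA); last by rewrite setIC.
have m1A : measurable_fun setT (\1_A : S -> R) by exact: measurable_indic.
have m1B : measurable_fun setT (\1_B : S -> R) by exact: measurable_indic.
have mf : measurable_fun [set: S * S]
    (fun z => ((\1_A z.1 * \1_B z.2 * k z.1 z.2)%R)%:E).
  apply/measurable_EFinP; apply: measurable_funM => //; apply: measurable_funM.
  - exact: measurableT_comp m1A measurable_fst.
  - exact: measurableT_comp m1B measurable_snd.
have f0 z : 0 <= ((\1_A z.1 * \1_B z.2 * k z.1 z.2)%R)%:E.
  by rewrite lee_fin; apply: mulr_ge0; [apply: mulr_ge0; rewrite indicE ler0n|].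
rewrite (fubini_tonelli (m1 := Pi) (m2 := Pi) _ mf f0).
apply: eq_integral => y _; apply: eq_integral => x _.
by congr (_%:E); rewrite /k msym/= (mulrC (pi x)) (mulrC (\1_A x)).
Qed.

(** Cutting [A] and [B] along their intersection, cross flows join disjoint sets, where Tonelli and
    the symmetry of [m] apply; the flow from the intersection to itself occurs on both sides, so the
    rejection probability is never evaluated. *)
Lemma reversible_accept_reject : reversible_kernel Pi K.
Proof.
have flowUr A B C : measurable A -> measurable B -> measurable C ->
    B `&` C = set0 -> flow A (B `|` C) = flow A B + flow A C.
  move=> mA mB mC BC; rewrite /flow -ge0_integralD//.
  - by apply: eq_integral => x _; rewrite measureU.
  - by apply: measurable_funTS; exact: measurable_kernel.
  - by apply: measurable_funTS; exact: measurable_kernel.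
have flowUl A B C : measurable A -> measurable B -> measurable C ->
    B `&` C = set0 -> flow (B `|` C) A = flow B A + flow C A.
  move=> mA mB mC BC; rewrite /flow ge0_integral_setU//.
  - by apply: measurable_funTS; exact: measurable_kernel.
  - by apply/disj_setPS; rewrite BC.
move=> A B mA mB; rewrite -/(flow A B) -/(flow B A).
have mAB := measurableD mA mB; have mBA := measurableD mB mA.
have mI := measurableI _ _ mA mB.
have dAI : (A `\` B) `&` (A `&` B) = set0.
  by apply/seteqP; split => // x [[_ nB] [_ /nB]].
have dBI : (B `\` A) `&` (A `&` B) = set0.
  by apply/seteqP; split => // x [[_ nA] [/nA]].
have dAB : (A `\` B) `&` (B `\` A) = set0.
  by apply/seteqP; split => // x [[_ nB] [/nB]].
have AE : A = (A `\` B) `|` (A `&` B).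
  by rewrite setUC setUIDK.
have BE : B = (B `\` A) `|` (A `&` B).
  by rewrite setUC setIC setUIDK.
have AE2 C : measurable C -> flow A C = flow (A `\` B) C + flow (A `&` B) C.
  by move=> mC; rewrite {1}AE flowUl.
have BE2 C : measurable C -> flow B C = flow (B `\` A) C + flow (A `&` B) C.
  by move=> mC; rewrite {1}BE flowUl.
have AE3 C : measurable C -> flow C A = flow C (A `\` B) + flow C (A `&` B).
  by move=> mC; rewrite {1}AE flowUr.
have BE3 C : measurable C -> flow C B = flow C (B `\` A) + flow C (A `&` B).
  by move=> mC; rewrite {1}BE flowUr.
rewrite AE2// BE2// !BE3// !AE3// addeACA.
rewrite (flow_disjointC mAB mBA dAB) (flow_disjointC mAB mI dAI).
by rewrite (flow_disjointC mBA mI dBI).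
Qed.

End reversibility.
(** These are the bad proposals of the comparison. The factor [q x y] on both sides keeps points
    that are never proposed out of them. *)
Lemma measurable_low_acceptance (a a' : S -> S -> R) (c : R) (x : S) :
  measurable_fun [set: S * S] (fun z => a z.1 z.2) ->
  measurable_fun [set: S * S] (fun z => a' z.1 z.2) ->
  measurable [set y | (q x y * a' x y < c * (q x y * a x y))%R].
Proof.
move=> ma ma'.
have mqx : measurable_fun setT (fun y => q x y).
  exact: measurableT_comp mq (pair1_measurable x).
have max : measurable_fun setT (fun y => a x y).
  exact: measurableT_comp ma (pair1_measurable x).
have ma'x : measurable_fun setT (fun y => a' x y).
  exact: measurableT_comp ma' (pair1_measurable x).
rewrite (_ : [set y | _] =
    (fun y => q x y * a' x y < c * (q x y * a x y))%R @^-1` [set true]).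
  rewrite -[X in measurable X]setTI; apply: measurable_fun_ltr => //.
    exact: measurable_funM.
  by apply: measurable_funM => //; exact: measurable_funM.
by apply/seteqP; split.
Qed.

Section conductance_comparison.
Variables (K K' : R.-pker S ~> S) (a a' : S -> S -> R) (c eps kap : R).
Hypothesis K_ar : is_accept_reject_kernel q a K.
Hypothesis K'_ar : is_accept_reject_kernel q a' K'.
Hypothesis ma : measurable_fun [set: S * S] (fun z => a z.1 z.2).
Hypothesis ma' : measurable_fun [set: S * S] (fun z => a' z.1 z.2).
Hypothesis a0 : forall x y, (0 <= a x y)%R.
Hypothesis a1 : forall x y, (a x y <= 1)%R.
Hypothesis a'0 : forall x y, (0 <= a' x y)%R.
Hypothesis c0 : (0 < c)%R.
Hypothesis eps0 : (0 <= eps)%R.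
Hypothesis bad_le : {ae Pi, forall x,
  \int[lam]_(y in [set y | (q x y * a' x y < c * (q x y * a x y))%R]) (q x y)%:E
    <= eps%:E}.

Let kop_indicE (k : R.-pker S ~> S) (B : set S) x : measurable B ->
  ((kop k \1_B x)%:E = k x B).
Proof.
move=> mB; rewrite /kop mean_indic//= fineK//.
exact: (fin_num_measure (kernel_law k x)).
Qed.

(** Off the bad set [q * a] is at most [c^-1 * (q * a')]; on it [a <= 1] leaves the proposal mass,
    at most [eps]. *)
Let kop_compare : {ae Pi, forall x, forall B, measurable B -> ~ B x ->
  (kop K \1_B x <= c^-1 * kop K' \1_B x + eps)%R}.
Proof.
apply: filterS bad_le => x bx B mB nBx.
have mqx : measurable_fun setT (fun y => q x y).
  exact: measurableT_comp mq (pair1_measurable x).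
have max : measurable_fun setT (fun y => a x y).
  exact: measurableT_comp ma (pair1_measurable x).
have ma'x : measurable_fun setT (fun y => a' x y).
  exact: measurableT_comp ma' (pair1_measurable x).
have mN := measurable_low_acceptance c x ma ma'.
set N := [set y | _] in bx mN.
have m1N : measurable_fun setT (\1_N : S -> R) by exact: measurable_indic.
rewrite -lee_fin EFinD EFinM !kop_indicE//.
rewrite K_ar// K'_ar// diracE memNset// !mule0 !adde0.
have iN : \int[lam]_(y in B) (q x y * \1_N y)%:E <= eps%:E.
  apply: le_trans bx.
  apply: (@le_trans _ _ (\int[lam]_y (q x y * \1_N y)%:E)).
    apply: ge0_integral_subset => // y.
    by rewrite lee_fin mulr_ge0// indicE ler0n.
  rewrite [leRHS]integral_mkcond le_eqVlt; apply/orP; left; apply/eqP.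
  by apply: eq_integral => y _; rewrite epatch_indic EFinM.
apply: le_trans (leeD2l _ iN).
rewrite -ge0_integralZl_EFin//; last 3 first.
- by move=> y _; rewrite lee_fin mulr_ge0.
- by apply/measurable_EFinP; apply: measurable_funTS; exact: measurable_funM.
- by rewrite invr_ge0 ltW.
rewrite -ge0_integralD//; last 4 first.
- by move=> y _; rewrite -EFinM lee_fin mulr_ge0 ?invr_ge0 ?(ltW c0)// mulr_ge0.
- apply: measurable_funTS; apply: measurable_funeM.
  by apply/measurable_EFinP; exact: measurable_funM.
- by move=> y _; rewrite lee_fin mulr_ge0// indicE ler0n.
- apply: measurable_funTS; apply/measurable_EFinP.
  by apply: measurable_funM; [exact: mqx|exact: m1N].
apply: ge0_le_integral => //.
- by move=> y _; rewrite lee_fin mulr_ge0.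
- by apply/measurable_EFinP; apply: measurable_funTS; exact: measurable_funM.
- apply: measurable_funTS; apply: emeasurable_funD.
    by apply: measurable_funeM; apply/measurable_EFinP; exact: measurable_funM.
  apply/measurable_EFinP.
  by apply: measurable_funM; [exact: mqx|exact: m1N].
- move=> y _; rewrite -EFinM -EFinD lee_fin indicE.
  have qa' : (0 <= c^-1 * (q x y * a' x y))%R.
    by rewrite mulr_ge0 ?invr_ge0 ?(ltW c0)// mulr_ge0.
  case: (boolP (y \in N)) => [yN|/negP yN] /=.
    by rewrite mulr1 ler_wpDl// ler_piMr.
  rewrite mulr0 addr0 ler_pdivlMl// leNgt; apply/negP => Ny.
  by apply: yN; rewrite inE.
Qed.

Lemma conductance_ge_compare : conductance_ge Pi K kap ->
  conductance_ge Pi K' (c * (kap - eps)).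
Proof.
move=> cond A mA A2; have := cond A mA A2.
have mCA := measurableC mA.
have bA : bounded_mfun (\1_A : S -> R) by exact: bounded_mfun_indic.
have bC : bounded_mfun (\1_(~` A) : S -> R) by exact: bounded_mfun_indic.
have bK := bounded_mfun_kop K bC; have bK' := bounded_mfun_kop K' bC.
have A0 x : (0 <= (\1_A x : R))%R by rewrite indicE ler0n.
have C0 x : (0 <= (\1_(~` A) x : R))%R by rewrite indicE ler0n.
have bf := bounded_mfunM bA bK.
have bg : bounded_mfun (fun x => c^-1 * (\1_A x * kop K' \1_(~` A) x) +
   eps * \1_A x)%R by bmf.
have f0 x : (0 <= \1_A x * kop K \1_(~` A) x)%R by rewrite mulr_ge0// kop_ge0.
have g0 x : (0 <= c^-1 * (\1_A x * kop K' \1_(~` A) x) + eps * \1_A x)%R.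
  by rewrite addr_ge0 ?mulr_ge0 ?invr_ge0 ?(ltW c0)// kop_ge0.
have H : (mean Pi (fun x => \1_A x * kop K \1_(~` A) x) <=
    mean Pi (fun x => c^-1 * (\1_A x * kop K' \1_(~` A) x) + eps * \1_A x))%R.
  rewrite -lee_fin -!meanE//; apply: ae_ge0_le_integral => //.
  - by move=> x _; rewrite lee_fin.
  - by apply/measurable_EFinP; case: bf.
  - by move=> x _; rewrite lee_fin.
  - by apply/measurable_EFinP; case: bg.
  - apply: filterS kop_compare => x /(_ (~` A) mCA) Hx _.
    rewrite lee_fin (indicE R A); case: (boolP (x \in A)) => [/set_mem Ax|_] /=.
      by rewrite !mul1r mulr1 Hx//; apply.
    by rewrite !mul0r !mulr0 addr0.
have bg1 : bounded_mfun (fun x => c^-1 * (\1_A x * kop K' \1_(~` A) x))%R by bmf.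
move: H; rewrite meanD//; last by bmf.
rewrite !meanZ//; last by bmf.
move=> H1 H2; have H3 := le_trans H2 H1.
by rewrite -mulrA -ler_pdivlMl// mulrBl; lra.
Qed.

End conductance_comparison.

End metropolis_hastings_kernels.

Section min_mul.
Local Open Scope ring_scope.

(** Here [u] and [v] stand for the two acceptance ratios. When they lie on the same side of 1, two
    stages accept at least as often as one; otherwise a [v] between [c] and [c^-1] loses at most the
    factor [c]. *)
Lemma min_mul_ge {R : realFieldType} (c u v : R) : 0 < c -> c <= 1 ->
  0 <= u -> 0 <= v ->
  (c <= v /\ v <= c^-1) \/ (1 <= u /\ 1 <= v) \/ (u <= 1 /\ v <= 1) ->
  c * Num.min 1 (u * v) <= Num.min 1 u * Num.min 1 v.
Proof.
move=> c0 c1 u0 v0; case=> [[cv vc]|[[u1 v1]|[u1 v1]]].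
- have cv1 : c * v <= 1 by rewrite -ler_pdivlMl// mulr1.
  have [u1|u1] := leP 1 u; have [v1|v1] := leP 1 v; rewrite ?mul1r ?mulr1.
  + by rewrite (le_trans _ c1)// ler_piMr ?(ltW c0)// ge_min lexx.
  + by apply: le_trans cv; rewrite ler_piMr ?(ltW c0)// ge_min lexx.
  + apply: (@le_trans _ _ (c * (u * v))).
      by rewrite ler_wpM2l ?(ltW c0)// ge_min lexx orbT.
    by rewrite mulrCA ler_piMr.
  + apply: (@le_trans _ _ (1 * (u * v))); last by rewrite mul1r.
    rewrite ler_pM ?(ltW c0)//; last by rewrite ge_min lexx orbT.
    by rewrite le_min ler01 mulr_ge0.
- rewrite (min_l u1) (min_l v1) mulr1 (le_trans _ c1)// ler_piMr ?(ltW c0)//.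
  by rewrite ge_min lexx.
- rewrite (min_r u1) (min_r v1).
  apply: (@le_trans _ _ (1 * (u * v))); last by rewrite mul1r.
  rewrite ler_pM ?(ltW c0)//; last by rewrite ge_min lexx orbT.
  by rewrite le_min ler01 mulr_ge0.
Qed.

End min_mul.

(** This includes [r <= 0], where [lne] is [-oo]: a vanishing ratio counts as lying below 1. *)
Lemma esign_lne_lt1 {R : realType} (r : R) : (r < 1)%R ->
  esign (lne r%:E) = (-1)%R.
Proof.
move=> r1; rewrite /lne; case: leP => //= r0.
by rewrite ltr0_sg// ln_lt0// r0 r1.
Qed.

Lemma esign_lne_gt1 {R : realType} (r : R) : (1 < r)%R ->
  esign (lne r%:E) = 1%R.
Proof.
move=> r1; rewrite lne_EFin ?(lt_trans ltr01)//=.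
by rewrite gtr0_sg// ln_gt0.
Qed.

(** * Metropolis-Hastings and delayed acceptance *)

Section acceptance_probabilities.
Context {R : realType} {n : nat} {X : lebesgue_domain R n}.
Local Notation S := (state X).
Variables (Pi Pihat : probability S R) (pi pihat : S -> R) (q : S -> S -> R).
Hypothesis Pi_density : is_density Pi pi.
Hypothesis Pihat_density : is_density Pihat pihat.
Hypothesis Pi_dominated : Pi `<< Pihat.
Hypothesis q_density : is_proposal_density q.

Let mpi : measurable_fun setT pi. Proof. by case: Pi_density. Qed.
Let pi0 x : (0 <= pi x)%R. Proof. by case: Pi_density. Qed.
Let mpihat : measurable_fun setT pihat. Proof. by case: Pihat_density. Qed.
Let pihat0 x : (0 <= pihat x)%R. Proof. by case: Pihat_density. Qed.
Let q0 x y : (0 <= q x y)%R. Proof. by case: q_density. Qed.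

Let mq : measurable_fun [set: S * S] (fun z => q z.1 z.2).
Proof. by case: q_density. Qed.
Let mqC : measurable_fun [set: S * S] (fun z => q z.2 z.1).
Proof. exact: (measurableT_comp mq (@measurable_swap _ _ S S)). Qed.
Let m1 (f : S -> R) : measurable_fun setT f ->
  measurable_fun [set: S * S] (fun z => f z.1).
Proof. by move=> mf; exact: measurableT_comp mf measurable_fst. Qed.
Let m2 (f : S -> R) : measurable_fun setT f ->
  measurable_fun [set: S * S] (fun z => f z.2).
Proof. by move=> mf; exact: measurableT_comp mf measurable_snd. Qed.

Let measurable_mh_ratio (f : S -> R) : measurable_fun setT f ->
  measurable_fun [set: S * S] (fun z => mh_ratio f q z.1 z.2).
Proof.
move=> mf; apply: measurable_acceptance_ratio; apply: measurable_funM => //.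
- exact: m2.
- exact: m1.
Qed.

Lemma measurable_mh_acceptance :
  measurable_fun [set: S * S] (fun z => mh_acceptance pi q z.1 z.2).
Proof. by apply: measurable_minr => //; exact: measurable_mh_ratio. Qed.

Lemma measurable_da_acceptance :
  measurable_fun [set: S * S] (fun z => da_acceptance pi pihat q z.1 z.2).
Proof.
apply: measurable_funM; apply: measurable_minr => //.
  exact: measurable_mh_ratio.
have mw : measurable_fun setT (fun x => pi x / pihat x)%R.
  by apply: measurable_funM => //; exact: measurable_funV.
by apply: measurable_acceptance_ratio; [exact: (m2 mw)|exact: (m1 mw)].
Qed.

Let da_ratio2_ge0 x y : (0 <= da_ratio2 pi pihat x y)%R.
Proof. by rewrite acceptance_ratio_ge0// divr_ge0. Qed.

Let da_ratio1_ge0 x y : (0 <= da_ratio1 pihat q x y)%R.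
Proof. by rewrite acceptance_ratio_ge0// mulr_ge0. Qed.

Lemma mh_acceptance_ge0 x y : (0 <= mh_acceptance pi q x y)%R.
Proof. by rewrite /mh_acceptance le_min ler01/= acceptance_ratio_ge0// mulr_ge0. Qed.

Lemma da_acceptance_ge0 x y : (0 <= da_acceptance pi pihat q x y)%R.
Proof. by rewrite mulr_ge0// le_min ler01/=. Qed.

(** The zeros of [pihat] are null for [Pihat], hence for [Pi] by domination. *)
Lemma ae_surrogate_gt0 : {ae Pi, forall x, (0 < pihat x)%R}.
Proof.
case: (ae_density_gt0 Pihat_density) => N [mN N0 sub].
exists N; split => //.
have /Pi_dominated H : Pihat.-null_set N by exact/measure0_null_setP.
exact: H.
Qed.

Lemma reversible_mh (P : R.-pker S ~> S) : is_mh_kernel pi q P ->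
  reversible_kernel Pi P.
Proof.
move=> P_mh.
pose m x y := (Num.min (pi x * q x y) (pi y * q y x))%R.
apply: (reversible_accept_reject (m := m) Pi_density P_mh).
- apply: measurable_minr; apply: measurable_funM => //; [exact: m1|exact: m2].
- by move=> x y; rewrite /m le_min !mulr_ge0.
- by move=> x y; rewrite /m minC.
- by move=> x y; rewrite /m => ->; rewrite mul0r min_r// mulr_ge0.
- apply: aeW => x y; rewrite /m mulrA /mh_acceptance acceptance_ratio_min//.
  + exact: mulr_ge0.
  + exact: mulr_ge0.
Qed.

(** Where [pihat x > 0], factoring [pi x] as [pihat x * (pi x / pihat x)] assigns one factor to each
    stage, and each stage becomes a symmetric minimum. *)
Lemma reversible_da (P : R.-pker S ~> S) : is_da_kernel pi pihat q P ->
  reversible_kernel Pi P.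
Proof.
move=> P_da.
pose m x y := (Num.min (pihat x * q x y) (pihat y * q y x) *
  Num.min (pi x / pihat x) (pi y / pihat y))%R.
apply: (reversible_accept_reject (m := m) Pi_density P_da).
- have mw : measurable_fun setT (fun x => pi x / pihat x)%R.
    by apply: measurable_funM => //; exact: measurable_funV.
  apply: measurable_funM; apply: measurable_minr.
  + by apply: measurable_funM => //; exact: m1.
  + by apply: measurable_funM => //; exact: m2.
  + exact: (m1 mw).
  + exact: (m2 mw).
- by move=> x y; apply: mulr_ge0; rewrite le_min ?divr_ge0// !mulr_ge0.
- by move=> x y; rewrite /m minC (minC (pi x / _)%R).
- by move=> x y; rewrite /m => ->; rewrite mul0r [X in (_ * X)%R]min_r ?mulr0// divr_ge0.
- apply: filterS ae_surrogate_gt0 => x px y.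
  rewrite /m -acceptance_ratio_min ?mulr_ge0// -acceptance_ratio_min ?divr_ge0//.
  rewrite /da_acceptance -/(da_ratio1 pihat q x y) -/(da_ratio2 pi pihat x y).
  by field; rewrite gt_eqF.
Qed.

Lemma measurable_null_surrogate :
  measurable [set y | pihat y = 0%R /\ pi y <> 0%R].
Proof.
have mZ (f : S -> R) : measurable_fun setT f -> measurable (f @^-1` [set 0%R]).
  by move=> mf; rewrite -[X in measurable X]setTI; exact: mf.
by apply: measurableI; [exact: (mZ _ mpihat)|apply: measurableC; exact: (mZ _ mpi)].
Qed.

(** Domination makes this set null for [Pi]; as [pi] is positive on it, it is null for Lebesgue
    measure, against which proposals are integrated. *)
Lemma null_surrogate :
  lebesgue_state X [set y | pihat y = 0%R /\ pi y <> 0%R] = 0.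
Proof.
case: Pi_density => _ _ PiE; case: Pihat_density => _ _ PihatE.
have mN := measurable_null_surrogate; set N := [set y | _] in mN *.
have PiN : Pi N = 0.
  have N0 : Pihat N = 0 by rewrite PihatE// integral0_eq// => y [-> _].
  have /Pi_dominated H : Pihat.-null_set N by exact/measure0_null_setP.
  exact: H.
have mpiN : measurable_fun N (fun y => (pi y)%:E).
  by apply: measurable_funTS; exact/measurable_EFinP.
have [+ _] := ae_eq_integral_abs (lebesgue_state X) mN mpiN.
under eq_integral do rewrite gee0_abs ?lee_fin//.
rewrite -PiE// => /(_ PiN) [A [mA A0 sub]].
apply: (subset_measure0 mN mA _ A0) => y Ny; apply: sub => /= /(_ Ny) [].
by case: Ny.
Qed.

(** The one-stage ratio is the product of the two, so [min_mul_ge] applies: the second ratio lies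
    between [expR (- H)] and [expR H], or else concordance puts both on the same side of 1. If
    [pihat y = 0], then [pi y = 0] and the one-stage acceptance is 0. *)
Lemma da_acceptance_ge (H : R) x y : (0 <= H)%R -> (0 < pi x)%R ->
  (0 < pihat x)%R -> (0 < q x y)%R -> (pihat y = 0 -> pi y = 0)%R ->
  (H%:E < `|log_ratio2 pi pihat x y| -> concordant pi pihat q x y) ->
  (expR (- H) * mh_acceptance pi q x y <= da_acceptance pi pihat q x y)%R.
Proof.
move=> H0 px phx qxy hy ctrl.
have [py|py] := eqVneq (pihat y) 0%R.
  rewrite /mh_acceptance /mh_ratio hy// mul0r /acceptance_ratio.
  rewrite mulf_eq0 !gt_eqF//= mul0r min_r// mulr0.
  exact: da_acceptance_ge0.
have r1E : da_ratio1 pihat q x y = (pihat y * q y x / (pihat x * q x y))%R.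
  by rewrite /da_ratio1 /acceptance_ratio mulf_eq0 !gt_eqF.
have r2E : da_ratio2 pi pihat x y = ((pi y / pihat y) / (pi x / pihat x))%R.
  by rewrite /da_ratio2 /acceptance_ratio gt_eqF// divr_gt0.
have rE : mh_ratio pi q x y = (da_ratio1 pihat q x y * da_ratio2 pi pihat x y)%R.
  rewrite r1E r2E /mh_ratio /acceptance_ratio mulf_eq0 !gt_eqF//=.
  by field; rewrite py !gt_eqF.
rewrite /mh_acceptance /da_acceptance rE.
apply: min_mul_ge => //; first exact: expR_gt0.
  by rewrite -expR0 ler_expR oppr_le0.
move: ctrl; rewrite /log_ratio2 /concordant /= /log_ratio1 /log_ratio2.
have v0 := da_ratio2_ge0 x y; have u0 := da_ratio1_ge0 x y.
move: (da_ratio1 pihat q x y) (da_ratio2 pi pihat x y) u0 v0 => u v u0 v0 ctrl.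
have [HL|] := ltP H%:E `|lne v%:E|; last first.
  have [v0'|vpos] := leP v 0%R; first by rewrite le0_lneNy ?lee_fin// leNgt ltry.
  rewrite lne_EFin// lee_fin ler_norml => /andP[h1 h2]; left.
  rewrite -expRN opprK.
  by split; [rewrite -[leRHS](lnK vpos)|rewrite -[leLHS](lnK vpos)]; rewrite ler_expR.
right; have := ctrl HL.
have [u1|u1|u1] := ltgtP u 1%R; have [v1|v1|v1] := ltgtP v 1%R;
  try (by move=> _; left; split; rewrite ?u1 ?v1// ltW);
  try (by move=> _; right; split; rewrite ?u1 ?v1// ltW).
- by rewrite (esign_lne_lt1 u1) (esign_lne_gt1 v1) mulr1 oppr_ge0 ler10.
- by rewrite (esign_lne_gt1 u1) (esign_lne_lt1 v1) mul1r oppr_ge0 ler10.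
Qed.

End acceptance_probabilities.

Theorem corollary3 (R : realType) (d : nat) (X : lebesgue_domain R d)
    (pi pihat : state X -> R) (q : state X -> state X -> R)
    (Pi Pihat : probability (state X) R)
    (P Ptilde : R.-pker (state X) ~> (state X)) (h : R -> R)
    (Pi_density : is_density Pi pi)
    (Pihat_density : is_density Pihat pihat)
    (Pi_dominated : Pi `<< Pihat)
    (q_density : is_proposal_density q)
    (P_mh : is_mh_kernel pi q P)
    (Ptilde_da : is_da_kernel pi pihat q Ptilde)
    (q_local : uniformly_local q)
    (h_ge0 : forall r : R, (0 <= r)%R -> (0 <= h r)%R)
    (h_locally_bounded : forall r : R, has_ubound [set h s | s in `[0%R, r]])
    (h_control : {ae Pi, forall x : state X,
      [set y : state X | (h (euclidean_dist x y))%:E < `|log_ratio2 pi pihat x y|]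
        `<=` concordant pi pihat q x}) :
  variance_bounding Pi P -> variance_bounding Pi Ptilde.
Proof.
have revP := reversible_mh Pi_density q_density P_mh.
have revPt := reversible_da Pi_density Pihat_density Pi_dominated q_density Ptilde_da.
have q0 : forall x y, (0 <= q x y)%R by case: q_density.
move=> /(variance_bounding_conductance revP)[kap kap0 cond].
have kap20 : (0 < kap / 2)%R by rewrite divr_gt0.
have [r qr] := q_local _ kap20.
have [M hM] := h_locally_bounded r.
(* [M] may be negative when [r < 0], since it then bounds an empty set, whereas [expR (- H) <= 1] is
   required. *)
pose H := Num.max 0%R M.
have H0 : (0 <= H)%R by rewrite le_max lexx.
apply: (@conductance_variance_bounding _ _ _ _ _ revPt
  (expR (- H) * (kap - kap / 2))%R).
  by rewrite mulr_gt0 ?expR_gt0//; lra.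
have ma := measurable_mh_acceptance Pi_density q_density.
have mat := measurable_da_acceptance Pi_density Pihat_density q_density.
apply: (conductance_ge_compare q_density P_mh Ptilde_da ma mat _ _ _
  (expR_gt0 _) (ltW kap20) _ cond).
- exact: mh_acceptance_ge0 Pi_density q_density.
- by move=> x y; rewrite /mh_acceptance ge_min lexx.
- exact: da_acceptance_ge0 Pi_density Pihat_density q_density.
- apply: filterS3 (ae_density_gt0 Pi_density)
    (ae_surrogate_gt0 Pihat_density Pi_dominated) h_control => x px phx ctrl.
  have mN := measurable_low_acceptance q_density (expR (- H)) x ma mat.
  set N := [set y | _] in mN *.
  set N0 := [set y | pihat y = 0%R /\ pi y <> 0%R].
  have mN0 : measurable N0 by exact: measurable_null_surrogate Pi_density Pihat_density.
  have mqx : measurable_fun N (fun y => (q x y)%:E).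
    apply: measurable_funTS; apply/measurable_EFinP.
    by case: q_density => mq _ _; exact: measurableT_comp mq (pair1_measurable x).
  (* Where [pihat y = 0] and [pi y <> 0], division by 0 makes the second ratio vanish while [P] may
     accept; these points are discarded first. *)
  rewrite (ge0_negligible_integral mN0 mN mqx); last 2 first.
  + by move=> y _; rewrite lee_fin.
  + exact: (null_surrogate Pi_density Pihat_density Pi_dominated).
  apply: le_trans (ltW (qr x)); apply: ge0_integral_subset => [y [Ny N0y]|y]; last first.
    by rewrite lee_fin.
  (* By contraposition: a point within distance [r] of [x] is not bad. *)
  move=> /= dr; move: Ny; apply/negP; rewrite -leNgt.
  have := q0 x y; rewrite le_eqVlt => /predU1P[<-|qxy].
    by rewrite !mul0r mulr0.
  rewrite mulrCA ler_wpM2l//.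
  apply: (da_acceptance_ge Pi_density Pihat_density q_density H0 px phx qxy).
    by move=> phy; apply: contrapT => py; apply: N0y.
  move=> HL; apply: ctrl => /=; apply: le_lt_trans HL; rewrite lee_fin.
  rewrite le_max; apply/orP; right; apply: hM => /=.
  exists (euclidean_dist x y) => //=.
  by rewrite in_itv/= sqrtr_ge0 ltW.
Qed.
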